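(* Let $p$ be a prime and let $\mu_\alpha=\bigotimes_{n=2}^\infty\mu_{\alpha_{1n}}$ be a product measure on $X^1=\prod_{n\ge2}\mathbb F_p$, where each $\mu_{\alpha_{1n}}$ is a probability measure on $\mathbb F_p$ with $\mu_{\alpha_{1n}}(r)=\alpha_{1n}(r)>0$ for all $r\in\mathbb F_p$. Let $\mathfrak A^1$ be the von Neumann algebra generated by the quasiregular representation $T^{R,\mu_\alpha,1}$ of $B_0^{\mathbb N}(\mathbb F_p)$ on $L^2(X^1,\mu_\alpha)$. (a) If $\mu_\alpha\sim\mu_{inv}$, then the commutant $(\mathfrak A^1)'$ is generated as a linear space (that is, as a weakly closed linear span) by the identity and the operators $$\Delta^{1,r}_{s,\infty}=T_{1s}^r\prod_{k=s+1}^\infty p^{-1}C(T_{1k}),\qquad s\ge2,\ r\in\mathbb F_p\setminus\{0\},$$ the infinite product being the strong limit of the finite products; in particular $(\mathfrak A^1)'=\big(\Delta^{1,r}_{s,\infty}\mid s\ge2,\ r\in\mathbb F_p\setminus\{0\}\big)''$. (b) If $\mu_\alpha\perp\mu_{inv}$ (equivalently $S^L_{11}(\mu_\alpha)=\infty$), then the commutant is trivial: $(\mathfrak A^1)'=\{\lambda I\mid\lambda\in\mathbb C\}$.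
   Context: $B_0^{\mathbb N}(\mathbb F_p)$ is the group of infinite upper triangular matrices $I+\sum_{1\le k<n}x_{kn}E_{kn}$ over $\mathbb F_p$ with finitely many nonzero $x_{kn}$. A point of $X^1$ is a row $x=(1,x_{12},x_{13},\dots)$, $x_{1n}\in\mathbb F_p$; the group acts by $R_t(x)=xt^{-1}$, and $(T^{R,\mu_\alpha,1}_tf)(x)=\big(d\mu_\alpha(R_t^{-1}(x))/d\mu_\alpha(x)\big)^{1/2}f(R_t^{-1}(x))$ on $L^2(X^1,\mu_\alpha)$. $\mathfrak A^1=(T^{R,\mu_\alpha,1}_t\mid t\in B_0^{\mathbb N}(\mathbb F_p))''$. Put $T_{kn}=T^{R,\mu_\alpha,1}_{I-E_{kn}}$, so $T_{1n}$ corresponds to $x_{1n}\mapsto x_{1n}-1$ and $T_{kn}$, $1<k<n$, to $x_{1n}\mapsto x_{1n}-x_{1k}$. $C(T)=\sum_{r\in\mathbb F_p}T^r$. $\mu_{inv}=\bigotimes_{n\ge2}\mu^{1n}_{inv}$ with $\mu_{inv}^{1n}(r)=1/p$ for all $r\in\mathbb F_p$. $\sim$ is equivalence of measures, $\perp$ mutual singularity, and $$S^L_{11}(\mu_\alpha)=\sum_{n=2}^\infty\ \sum_{r\in\mathbb F_p\setminus\{0\}}\Big(1-\sum_{k\in\mathbb F_p}\sqrt{\alpha_{1n}(k+r)\alpha_{1n}(k)}\Big).$$ *)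

(* Defs.v *)
From HB Require Import structures.
From mathcomp Require Import all_boot all_order all_algebra.
From mathcomp Require Import complex sesquilinear.
From mathcomp Require Import ring.
From mathcomp Require Import all_classical all_reals all_analysis.

Set Implicit Arguments.
Unset Strict Implicit.
Unset Printing Implicit Defensive.

Import Order.TTheory GRing.Theory Num.Theory.
Import numFieldNormedType.Exports.

Local Open Scope classical_set_scope.
Local Open Scope ring_scope.

(* Rows and columns are numbered from 0: index n here is index n + 1 in the
   usual numbering, so x_(1n), alpha_(1n), T_(1n) with n >= 2 become x n,
   alpha n, Tkn 0 n with n >= 1. *)

Section B0N.
Variable p : nat.

Definition B0N_axiom (t : nat -> nat -> 'F_p) : Prop :=
  [/\ forall k, t k k = 1, forall k n, (n < k)%N -> t k n = 0 &
      finite_set [set kn : nat * nat | (kn.1 < kn.2)%N && (t kn.1 kn.2 != 0)]].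

Definition B0N_pred : {pred nat -> nat -> 'F_p} := fun t => `[< B0N_axiom t >].

Record B0N := MkB0N { B0N_val :> nat -> nat -> 'F_p; _ : B0N_pred B0N_val }.
HB.instance Definition _ := [isSub for B0N_val].
HB.instance Definition _ := [Choice of B0N by <:].

Lemma B0N_diag (t : B0N) k : t k k = 1.
Proof. by case: t => t /= /asboolP[]. Qed.

Lemma B0N_lower (t : B0N) k n : (n < k)%N -> t k n = 0.
Proof. by case: t => t /= /asboolP[_ + _]; exact. Qed.

Lemma B0N_bound (t : B0N) :
  exists N, forall k n, (N <= n)%N -> (k < n)%N -> t k n = 0.
Proof.
case: t => t /= /asboolP[_ _ /finite_seqP[s hs]].
exists (\max_(i <- s) i.2).+1 => k n Nn kn; apply/eqP; apply: contraT => tkn.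
have : (k, n) \in s.
  have : [set` s] (k, n) by rewrite -hs /= kn tkn.
  by [].
move=> /(@leq_bigmax_seq _ _ xpredT (fun i => i.2) ) => /(_ isT).
by rewrite leqNgt /= (leq_trans _ Nn).
Qed.

Lemma B0N_predP (t : nat -> nat -> 'F_p) (N : nat) :
  (forall k, t k k = 1) -> (forall k n, (n < k)%N -> t k n = 0) ->
  (forall k n, (N <= n)%N -> (k < n)%N -> t k n = 0) -> B0N_pred t.
Proof.
move=> t1 t0 tN; apply/asboolP; split => //.
apply: (@sub_finite_set _ _ (`I_N `*` `I_N)); last first.
  by apply: finite_setX; exact: finite_II.
case=> k n /= /andP[kn tkn]; have nN : (n < N)%N.
  by rewrite ltnNge; apply: contraNN tkn => Nn; rewrite tN.
by split => //; exact: ltn_trans nN.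
Qed.

Definition B0N_one_val (k n : nat) : 'F_p := (k == n)%:R.

Lemma B0N_one_subproof : B0N_pred B0N_one_val.
Proof.
apply: (@B0N_predP _ 0%N).
- by move=> k; rewrite /B0N_one_val eqxx.
- by move=> k n nk; rewrite /B0N_one_val gtn_eqF.
- by move=> k n _ nk; rewrite /B0N_one_val ltn_eqF.
Qed.

Definition B0N_one : B0N := MkB0N B0N_one_subproof.

(* (s t)_(kn) = sum_j s_(kj) t_(jn): the terms with j > n vanish *)
Definition B0N_mul_val (s t : nat -> nat -> 'F_p) (k n : nat) : 'F_p :=
  \sum_(j < n.+1) s k j * t j n.

Lemma B0N_mul_subproof (s t : B0N) : B0N_pred (B0N_mul_val s t).
Proof.
have [M hM] := B0N_bound s; have [N hN] := B0N_bound t.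
have low k n : (n < k)%N -> B0N_mul_val s t k n = 0.
  move=> nk; apply: big1 => j _; rewrite B0N_lower ?mul0r//.
  by rewrite (leq_ltn_trans _ nk) // -ltnS.
apply: (@B0N_predP _ (maxn M N)) => //.
- move=> k; rewrite /B0N_mul_val big_ord_recr /= !B0N_diag mulr1.
  by rewrite big1 ?add0r// => j _; rewrite B0N_lower ?mul0r.
- move=> k n; rewrite geq_max => /andP[Mn Nn] kn.
  rewrite /B0N_mul_val big_ord_recr /= hM// mul0r addr0.
  by apply: big1 => j _; rewrite hN// mulr0.
Qed.

Definition B0N_mul (s t : B0N) : B0N := MkB0N (B0N_mul_subproof s t).

(* forward substitution for (t^-1)_(kn) in t^-1 t = 1; only the first n + 1
   recursive steps matter, so the fuel n.+1 is enough *)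
Fixpoint B0N_inv_rec (t : nat -> nat -> 'F_p) (k fuel n : nat) : 'F_p :=
  if fuel is fuel'.+1 then
    (k == n)%:R - \sum_(j < n) B0N_inv_rec t k fuel' j * t j n
  else 0.

Definition B0N_inv_val (t : nat -> nat -> 'F_p) (k n : nat) : 'F_p :=
  B0N_inv_rec t k n.+1 n.

Lemma B0N_inv_recE (t : nat -> nat -> 'F_p) k fuel n : (n < fuel)%N ->
  B0N_inv_rec t k fuel n = B0N_inv_val t k n.
Proof.
suff H f g : (n < f)%N -> (n < g)%N ->
    B0N_inv_rec t k f n = B0N_inv_rec t k g n by move=> ?; exact: H.
elim/ltn_ind: n f g => n IH [//|f] [//|g]; rewrite !ltnS => nf ng /=.
congr (_ - _); apply: eq_bigr => j _; congr (_ * _).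
by apply: IH => //; [exact: leq_trans nf|exact: leq_trans ng].
Qed.

Lemma B0N_inv_valE (t : nat -> nat -> 'F_p) k n :
  B0N_inv_val t k n = (k == n)%:R - \sum_(j < n) B0N_inv_val t k j * t j n.
Proof.
rewrite {1}/B0N_inv_val /=; congr (_ - _); apply: eq_bigr => j _.
by rewrite B0N_inv_recE.
Qed.

Lemma B0N_inv_val_lower (t : nat -> nat -> 'F_p) k n : (n < k)%N ->
  B0N_inv_val t k n = 0.
Proof.
elim/ltn_ind: n => n IH nk; rewrite B0N_inv_valE gtn_eqF// sub0r big1 ?oppr0//.
by move=> j _; rewrite IH ?mul0r// (ltn_trans _ nk).
Qed.

Lemma B0N_inv_subproof (t : B0N) : B0N_pred (B0N_inv_val t).
Proof.
have [N hN] := B0N_bound t.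
apply: (@B0N_predP _ N).
- move=> k; rewrite B0N_inv_valE eqxx big1 ?subr0// => j _.
  by rewrite B0N_inv_val_lower ?mul0r.
- exact: B0N_inv_val_lower.
- move=> k n Nn kn; rewrite B0N_inv_valE ltn_eqF// sub0r big1 ?oppr0// => j _.
  by rewrite hN ?mulr0.
Qed.

Definition B0N_inv (t : B0N) : B0N := MkB0N (B0N_inv_subproof t).

Lemma B0N_eqP (s t : B0N) : (forall k n, s k n = t k n) -> s = t.
Proof. by move=> st; apply/val_inj/funext => k; apply/funext => n; exact: st. Qed.

Lemma sum_widen0 (F : nat -> 'F_p) (m n : nat) : (m <= n)%N ->
  (forall j, (m <= j < n)%N -> F j = 0) -> \sum_(j < n) F j = \sum_(j < m) F j.
Proof.
move=> mn F0; rewrite -!(big_mkord xpredT F) (@big_cat_nat _ _ _ m 0 n)//=.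
by rewrite [X in _ + X]big_nat_cond [X in _ + X]big1 ?addr0// => i /andP[/F0].
Qed.

Lemma B0N_mulA : associative B0N_mul.
Proof.
move=> r s t; apply: B0N_eqP => k n /=; rewrite /B0N_mul_val /= /B0N_mul_val.
under [RHS]eq_bigr => j _.
  rewrite mulr_suml -(@sum_widen0 (fun i => r k i * s i j * t j n) j.+1 n.+1)//;
    first over.
  by move=> i /andP[ji _]; rewrite (B0N_lower s)// mulr0 mul0r.
rewrite exchange_big /=; apply: eq_bigr => j _; rewrite mulr_sumr.
by apply: eq_bigr => i _; rewrite mulrA.
Qed.

Lemma B0N_mul1 : left_id B0N_one B0N_mul.
Proof.
move=> t; apply: B0N_eqP => k n /=; rewrite /B0N_mul_val /= /B0N_one_val.
have [kn|nk] := leqP k n; last first.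
  rewrite B0N_lower// big1// => j _.
  by rewrite gtn_eqF ?mul0r// (leq_ltn_trans _ nk)// -ltnS.
rewrite (bigD1 (inord k)) //= inordK// eqxx mul1r big1 ?addr0// => j jk.
rewrite (_ : (k == j) = false) ?mul0r//; apply/negbTE.
by apply: contraNneq jk => ->; rewrite inord_val.
Qed.

Lemma B0N_mulV : left_inverse B0N_one B0N_inv B0N_mul.
Proof.
move=> t; apply: B0N_eqP => k n /=; rewrite /B0N_mul_val /= /B0N_one_val.
by rewrite big_ord_recr /= B0N_diag mulr1 (B0N_inv_valE t k n) subrKC.
Qed.

Lemma B0N_mulr1 : right_id B0N_one B0N_mul.
Proof.
move=> t; apply: B0N_eqP => k n /=; rewrite /B0N_mul_val /= /B0N_one_val.
rewrite big_ord_recr /= eqxx mulr1 big1 ?add0r// => j _.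
by rewrite ltn_eqF ?mulr0.
Qed.

Lemma B0N_mulrV : right_inverse B0N_one B0N_inv B0N_mul.
Proof.
move=> t; rewrite -[LHS]B0N_mul1 -{1}(B0N_mulV (B0N_inv t)).
by rewrite -B0N_mulA [X in B0N_mul _ X]B0N_mulA B0N_mulV B0N_mul1 B0N_mulV.
Qed.

HB.instance Definition _ := isGroup.Build B0N
  B0N_mulA B0N_mul1 B0N_mulr1 B0N_mulV B0N_mulrV.

(* the matrix I - E_(kn) when k < n, and I otherwise *)
Definition IsubE_val (k n i j : nat) : 'F_p :=
  (i == j)%:R - [&& (k < n)%N, i == k & j == n]%:R.

Lemma IsubE_subproof k n : B0N_pred (IsubE_val k n).
Proof.
apply: (@B0N_predP _ n.+1) => [i|i j ji|i j nj ij]; rewrite /IsubE_val.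
- rewrite eqxx; case: eqP => [->|_]; last by rewrite andbF subr0.
  by case: ltngtP; rewrite ?andbF ?subr0// => ->.
- rewrite gtn_eqF// sub0r (_ : [&& _, _ & _] = false) ?oppr0//.
  apply/negbTE; apply: contraL ji => /and3P[kn /eqP-> /eqP->].
  by rewrite -leqNgt ltnW.
- by rewrite ltn_eqF// (gtn_eqF nj) !andbF subr0.
Qed.

Definition IsubE (k n : nat) : B0N := MkB0N (IsubE_subproof k n).

End B0N.

Section X1.
Variable p : nat.

(* the rows (1, x_(12), x_(13), ...), with the product sigma-algebra *)
Record row1 := MkRow1 { row1_val :> nat -> 'F_p; _ : row1_val 0%N == 1 }.
HB.instance Definition _ := [isSub for row1_val].
HB.instance Definition _ := [Choice of row1 by <:].

Lemma row1_0 (x : row1) : x 0%N = 1.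
Proof. by case: x => x /= /eqP. Qed.

Definition row1_pt : row1 := @MkRow1 (fun n => (n == 0%N)%:R) (eqxx _).
HB.instance Definition _ := isPointed.Build row1 row1_pt.

Definition cylinders : set (set row1) :=
  [set A | exists n r, A = [set x : row1 | x n = r]].

Definition X1 := g_sigma_algebraType cylinders.
HB.instance Definition _ := Measurable.on X1.

Lemma row1_mul_subproof (x : row1) (t : B0N p) :
  \sum_(k < 1) x k * t k 0%N == 1.
Proof. by rewrite big_ord1 /= row1_0 B0N_diag mulr1. Qed.

(* the product xt of the row x with the upper triangular matrix t *)
Definition row1_mul (x : X1) (t : B0N p) : X1 :=
  @MkRow1 (fun n => \sum_(k < n.+1) x k * t k n) (row1_mul_subproof x t).

(* R_t(x) = x t^-1; hence R_t^-1 is Ract t^-1 *)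
Definition Ract (t : B0N p) (x : X1) : X1 := row1_mul x t^-1%g.

Lemma measurable_coord n r : measurable [set x : X1 | x n = r].
Proof. by apply: sub_sigma_algebra; exists n, r. Qed.

Lemma measurable_Ract t : measurable_fun [set: X1] (Ract t).
Proof.
apply: (@measurability _ _ X1 X1 _ _ cylinders) => // _ [_ [n [r ->]] <-].
rewrite setTI /Ract; set s := (t^-1)%g.
rewrite (_ : _ @^-1` _ =
  \bigcup_(a in [set a : {ffun 'I_n.+1 -> 'F_p} | \sum_k a k * s k n = r])
    \bigcap_(k in [set: 'I_n.+1]) [set x : X1 | x k = a k]).
  apply: fin_bigcup_measurable => // a _.
  by apply: fin_bigcap_measurable => // k _; exact: measurable_coord.
apply/seteqP; split => [x /= xr|x [a /= ar xa]].
  exists [ffun k : 'I_n.+1 => x k] => /=; last by move=> k _ /=; rewrite ffunE.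
  by rewrite -xr; apply: eq_bigr => k _; rewrite ffunE.
by rewrite -ar; apply: eq_bigr => k _; rewrite (xa k I).
Qed.

End X1.

Section quasi_regular_measure.
Variables (R : realType) (p : nat).
Local Open Scope ereal_scope.
Local Open Scope charge_scope.

(* the measure A |-> mu (R_t^-1 (A)) *)
Definition translated (mu : probability (X1 p) R) (t : B0N p) :
  set (X1 p) -> \bar R := pushforward mu (@Ract p t).

Variables (mu : probability (X1 p) R) (t : B0N p).

Let translated0 : translated mu t set0 = 0.
Proof. by rewrite /translated /pushforward preimage_set0 measure0. Qed.

Let translated_ge0 A : 0 <= translated mu t A.
Proof. exact: (measure_ge0 mu). Qed.

Let translated_sigma_additive : semi_sigma_additive (translated mu t).
Proof.
exact: (@measure_semi_sigma_additive _ _ _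
  (measure_function_pushforward__canonical__measure_function_Measure mu
    (@measurable_Ract p t))).
Qed.

HB.instance Definition _ := isMeasure.Build _ _ _ (translated mu t)
  translated0 translated_ge0 translated_sigma_additive.

Let translated_setT : translated mu t setT = 1.
Proof. by rewrite /translated /pushforward preimage_setT probability_setT. Qed.

HB.instance Definition _ :=
  Measure_isProbability.Build _ _ _ (translated mu t) translated_setT.

(* d mu (R_t^-1 (x)) / d mu (x) *)
Definition density : X1 p -> \bar R := 'd (charge_of_finite_measure (translated mu t)) '/d mu.

End quasi_regular_measure.

Section L2.
Context d (T : measurableType d) (R : realType).
Variable mu : {measure set T -> \bar R}.
Local Open Scope complex_scope.
Local Open Scope quotient_scope.
Implicit Types f g h : T -> R[i].

(* Complex L^2(mu): functions whose real and imaginary parts are in the real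
   L^2, modulo almost everywhere equality. *)
Definition L2_pred : {pred T -> R[i]} := fun f =>
  (@complex.Re R \o f \in Lfun mu 2%:E) && (@complex.Im R \o f \in Lfun mu 2%:E).

Let LfunD (u v : T -> R) : u \in Lfun mu 2%:E -> v \in Lfun mu 2%:E ->
  (fun x => u x + v x) \in Lfun mu 2%:E.
Proof.
have [_ LD] := Lfun_submod_closed mu (lee1n 2).
by move=> uL vL; have := LD 1 u v uL vL; rewrite scale1r.
Qed.

Let LfunZ (c : R) (u : T -> R) : u \in Lfun mu 2%:E ->
  (fun x => c * u x) \in Lfun mu 2%:E.
Proof.
have [L0 LD] := Lfun_submod_closed mu (lee1n 2).
by move=> uL; have := LD c u 0 uL L0; rewrite addr0.
Qed.

Lemma L2_pred0 : L2_pred (cst 0).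
Proof.
have [L0 _] := Lfun_submod_closed mu (lee1n 2).
by apply/andP; split; exact: L0.
Qed.

Lemma L2_predD f g : L2_pred f -> L2_pred g -> L2_pred (fun x => f x + g x).
Proof.
move=> /andP[f1 f2] /andP[g1 g2]; apply/andP; split.
- have -> : @complex.Re R \o (fun x => f x + g x) =
    (fun x => (@complex.Re R \o f) x + (@complex.Re R \o g) x).
    by apply/funext => x /=; case: (f x) => ? ?; case: (g x).
  exact: LfunD.
- have -> : @complex.Im R \o (fun x => f x + g x) =
    (fun x => (@complex.Im R \o f) x + (@complex.Im R \o g) x).
    by apply/funext => x /=; case: (f x) => ? ?; case: (g x).
  exact: LfunD.
Qed.

Lemma L2_predZ (a : R[i]) f : L2_pred f -> L2_pred (fun x => a * f x).
Proof.
case: a => a b /andP[f1 f2]; apply/andP; split.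
- have -> : @complex.Re R \o (fun x => (a +i* b) * f x) =
    (fun x => a * (@complex.Re R \o f) x + (- b) * (@complex.Im R \o f) x).
    by apply/funext => x /=; case: (f x) => u v /=; rewrite mulNr.
  by apply: LfunD; exact: LfunZ.
- have -> : @complex.Im R \o (fun x => (a +i* b) * f x) =
    (fun x => a * (@complex.Im R \o f) x + b * (@complex.Re R \o f) x).
    by apply/funext => x /=; case: (f x) => u v /=.
  by apply: LfunD; exact: LfunZ.
Qed.

Record L2fun := MkL2fun { L2fun_val :> T -> R[i]; _ : L2_pred L2fun_val }.
HB.instance Definition _ := [isSub for L2fun_val].
HB.instance Definition _ := [Choice of L2fun by <:].

Lemma L2funP (f : L2fun) : L2_pred f. Proof. exact: valP. Qed.

Definition L2fun0 : L2fun := MkL2fun L2_pred0.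

Definition L2_eqv (f g : L2fun) : bool :=
  `[< (f : T -> R[i]) = g %[ae mu] >].

Let L2_eqv_refl : reflexive L2_eqv.
Proof. by move=> f; apply/asboolP; exact: aeW. Qed.

Let L2_eqv_sym : symmetric L2_eqv.
Proof.
by move=> f g; apply/idP/idP => /asboolP fg; apply/asboolP;
  apply: filterS fg => x fgx Dx; rewrite fgx.
Qed.

Let L2_eqv_trans : transitive L2_eqv.
Proof.
move=> f g h /asboolP gf /asboolP fh; apply/asboolP.
by apply: filterS2 gf fh => x e1 e2 Dx; rewrite e1// e2.
Qed.

Canonical L2_eqv_equiv := EquivRel L2_eqv L2_eqv_refl L2_eqv_sym L2_eqv_trans.

Definition L2 : Type := {eq_quot L2_eqv}.
HB.instance Definition _ := Choice.on L2.
HB.instance Definition _ := EqQuotient.on L2.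

Definition L2_repr (f : L2) : T -> R[i] := repr f.
Coercion L2_repr : L2 >-> Funclass.

(* the class of f, or 0 when f is not square-integrable *)
Definition L2class (f : T -> R[i]) : L2 := \pi_L2 (insubd L2fun0 f).

Lemma L2_reprP (u : L2) : L2_pred u. Proof. exact: L2funP. Qed.
Hint Resolve L2_reprP : core.

Lemma L2_eqP (u v : L2) : (u : T -> R[i]) = v %[ae mu] -> u = v.
Proof.
by move=> uv; rewrite -[u]reprK -[v]reprK; apply/eqmodP/asboolP.
Qed.

Lemma L2classE f : L2_pred f -> (L2class f : T -> R[i]) = f %[ae mu].
Proof.
move=> fL; have /eqmodP/asboolP : repr (L2class f) = insubd L2fun0 f %[mod L2].
  by rewrite reprK.
have e : L2fun_val (insubd L2fun0 f) = f by exact: (insubdK L2fun0 fL).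
by rewrite e.
Qed.

Lemma L2class_repr (u : L2) : L2class u = u.
Proof. by apply: L2_eqP; exact: L2classE. Qed.

Lemma eq_L2class f g : L2_pred f -> L2_pred g -> f = g %[ae mu] ->
  L2class f = L2class g.
Proof.
move=> fL gL fg; apply: L2_eqP; apply: filterS3 (L2classE fL) (L2classE gL) fg.
by move=> x e1 e2 e3 Dx; rewrite e1// e2// e3.
Qed.

Definition L2_add (u v : L2) : L2 := L2class (fun x => u x + v x).
Definition L2_scale (a : R[i]) (u : L2) : L2 := L2class (fun x => a * u x).
Definition L2_zero : L2 := L2class (cst 0).
Definition L2_opp (u : L2) : L2 := L2_scale (-1) u.

Lemma L2_addE (u v : L2) :
  (L2_add u v : T -> R[i]) = (fun x => u x + v x) %[ae mu].
Proof. by apply: L2classE; exact: L2_predD. Qed.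

Lemma L2_scaleE a (u : L2) :
  (L2_scale a u : T -> R[i]) = (fun x => a * u x) %[ae mu].
Proof. by apply: L2classE; exact: L2_predZ. Qed.

Lemma L2_zeroE : (L2_zero : T -> R[i]) = cst 0 %[ae mu].
Proof. by apply: L2classE; exact: L2_pred0. Qed.

Let L2_addA : associative L2_add.
Proof.
move=> u v w; apply: L2_eqP.
apply: filterS2 (filterI (L2_addE u (L2_add v w)) (L2_addE v w))
  (filterI (L2_addE (L2_add u v) w) (L2_addE u v)) => x [e1 e2] [e3 e4] Dx.
by rewrite e1// e2// e3// e4// addrA.
Qed.

Let L2_addC : commutative L2_add.
Proof.
move=> u v; apply: L2_eqP.
by apply: filterS2 (L2_addE u v) (L2_addE v u) => x e1 e2 Dx;
  rewrite e1// e2// addrC.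
Qed.

Let L2_add0 : left_id L2_zero L2_add.
Proof.
move=> u; apply: L2_eqP.
by apply: filterS2 (L2_addE L2_zero u) L2_zeroE => x e1 e2 Dx;
  rewrite e1// e2// add0r.
Qed.

Let L2_addN : left_inverse L2_zero L2_opp L2_add.
Proof.
move=> u; apply: L2_eqP.
by apply: filterS3 (L2_addE (L2_opp u) u) (L2_scaleE (-1) u) L2_zeroE
  => x e1 e2 e3 Dx; rewrite e1// e2// e3// mulN1r addNr.
Qed.

HB.instance Definition _ := GRing.isZmodule.Build L2
  L2_addA L2_addC L2_add0 L2_addN.

Let L2_scaleA a b (u : L2) : L2_scale a (L2_scale b u) = L2_scale (a * b) u.
Proof.
apply: L2_eqP.
by apply: filterS3 (L2_scaleE a (L2_scale b u)) (L2_scaleE b u)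
  (L2_scaleE (a * b) u) => x e1 e2 e3 Dx; rewrite e1// e2// e3// mulrA.
Qed.

Let L2_scale1 : left_id 1 L2_scale.
Proof.
move=> u; apply: L2_eqP.
by apply: filterS (L2_scaleE 1 u) => x e1 Dx; rewrite e1// mul1r.
Qed.

Let L2_scaleDr : right_distributive L2_scale +%R.
Proof.
move=> a u v; apply: L2_eqP.
apply: filterS2 (filterI (L2_scaleE a (u + v)) (L2_addE u v))
  (filterI (L2_addE (L2_scale a u) (L2_scale a v))
    (filterI (L2_scaleE a u) (L2_scaleE a v))) => x [e1 e2] [e3 [e4 e5]] Dx.
by rewrite e1// e2// e3// e4// e5// mulrDr.
Qed.

Let L2_scaleDl (u : L2) : {morph L2_scale^~ u : a b / a + b}.
Proof.
move=> a b; apply: L2_eqP.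
apply: filterS2 (L2_scaleE (a + b) u)
  (filterI (L2_addE (L2_scale a u) (L2_scale b u))
    (filterI (L2_scaleE a u) (L2_scaleE b u))) => x e1 [e3 [e4 e5]] Dx.
by rewrite e1// e3// e4// e5// mulrDl.
Qed.

HB.instance Definition _ := GRing.Zmodule_isLmodule.Build R[i] L2
  L2_scaleA L2_scale1 L2_scaleDr L2_scaleDl.

Lemma L2_linE a (u v : L2) :
  ((a *: u + v : L2) : T -> R[i]) = (fun x => a * u x + v x) %[ae mu].
Proof.
by apply: filterS2 (L2_addE (a *: u) v) (L2_scaleE a u) => x e1 e2 Dx;
  rewrite e1// e2.
Qed.

(* the integral of f g^*, real and imaginary parts separately *)
Definition L2_dotfun f g : R[i] :=
  (\int[mu]_x complex.Re (f x * conjc (g x))) +i*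
  (\int[mu]_x complex.Im (f x * conjc (g x))).

Definition L2_dot (u v : L2) : R[i] := L2_dotfun u v.

Lemma L2_integrable_mul f g : L2_pred f -> L2_pred g ->
  mu.-integrable setT (EFin \o (fun x => complex.Re (f x * conjc (g x)))) /\
  mu.-integrable setT (EFin \o (fun x => complex.Im (f x * conjc (g x)))).
Proof.
move=> /andP[f1 f2] /andP[g1 g2].
have I (u v : T -> R) : u \in Lfun mu 2%:E -> v \in Lfun mu 2%:E ->
    mu.-integrable setT (EFin \o (u \* v)).
  by move=> uL vL; apply/Lfun1_integrable; exact: Lfun2_mul_Lfun1.
split.
- have -> : EFin \o (fun x => complex.Re (f x * conjc (g x))) =
    ((EFin \o ((@complex.Re R \o f) \* (@complex.Re R \o g))%R) \+
     (EFin \o ((@complex.Im R \o f) \* (@complex.Im R \o g))%R))%E.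
    apply/funext => x /=; case: (f x) => a b; case: (g x) => c e /=.
    by rewrite -EFinD mulrN opprK.
  by apply: integrableD => //; exact: I.
- have -> : EFin \o (fun x => complex.Im (f x * conjc (g x))) =
    ((EFin \o ((@complex.Im R \o f) \* (@complex.Re R \o g))%R) \-
     (EFin \o ((@complex.Re R \o f) \* (@complex.Im R \o g))%R))%E.
    apply/funext => x /=; case: (f x) => a b; case: (g x) => c e /=.
    by rewrite -EFinB mulrN addrC.
  by apply: integrableB => //; exact: I.
Qed.

Let ae_Rintegral (F G : T -> R) :
  mu.-integrable setT (EFin \o F) -> mu.-integrable setT (EFin \o G) ->
  F = G %[ae mu] -> \int[mu]_x F x = \int[mu]_x G x.
Proof.
move=> Fi Gi FG; rewrite /Rintegral; congr fine.
apply: ae_eq_integral => //; first exact: measurable_int Fi.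
  exact: measurable_int Gi.
by apply: filterS FG => x FG Dx; rewrite /= FG.
Qed.

Let L2_dotfun_ae f g f' g' : L2_pred f -> L2_pred g ->
  L2_pred f' -> L2_pred g' -> f = f' %[ae mu] -> g = g' %[ae mu] ->
  L2_dotfun f g = L2_dotfun f' g'.
Proof.
move=> fL gL fL' gL' ff' gg'; rewrite /L2_dotfun.
have [r i] := L2_integrable_mul fL gL.
have [r' i'] := L2_integrable_mul fL' gL'.
congr (_ +i* _); apply: ae_Rintegral => //;
  by apply: filterS2 ff' gg' => x e1 e2 Dx; rewrite e1// e2.
Qed.

Let L2_dotfun_lin a f g h : L2_pred f -> L2_pred g -> L2_pred h ->
  L2_dotfun (fun x => a * f x + g x) h = a * L2_dotfun f h + L2_dotfun g h.
Proof.
move=> fL gL hL.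
have [fr fi] := L2_integrable_mul fL hL.
have [gr gi] := L2_integrable_mul gL hL.
have IZ (c : R) (F : T -> R) : mu.-integrable setT (EFin \o F) ->
    mu.-integrable setT (EFin \o (fun x => c * F x)).
  by move=> FI; exact: (integrableZl measurableT c FI).
have ID (F G : T -> R) : mu.-integrable setT (EFin \o F) ->
    mu.-integrable setT (EFin \o G) ->
    mu.-integrable setT (EFin \o (fun x => F x + G x)).
  by move=> FI GI; exact: (integrableD measurableT FI GI).
have IB (F G : T -> R) : mu.-integrable setT (EFin \o F) ->
    mu.-integrable setT (EFin \o G) ->
    mu.-integrable setT (EFin \o (fun x => F x - G x)).
  by move=> FI GI; exact: (integrableB measurableT FI GI).
case: a => a b; apply/eqP; rewrite eq_complex /L2_dotfun /=.
under eq_Rintegral => x _.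
  rewrite (_ : complex.Re _ = (a * complex.Re (f x * conjc (h x)) -
    b * complex.Im (f x * conjc (h x))) + complex.Re (g x * conjc (h x)));
    first over.
  by case: (f x) => ? ?; case: (g x) => ? ?; case: (h x) => ? ? /=; ring.
apply/andP; split.
  rewrite RintegralD//; last by apply: IB; exact: IZ.
  by rewrite RintegralB ?RintegralZl//; exact: IZ.
under eq_Rintegral => x _.
  rewrite (_ : complex.Im _ = (a * complex.Im (f x * conjc (h x)) +
    b * complex.Re (f x * conjc (h x))) + complex.Im (g x * conjc (h x)));
    first over.
  by case: (f x) => ? ?; case: (g x) => ? ?; case: (h x) => ? ? /=; ring.
rewrite RintegralD//; last by apply: ID; exact: IZ.
by rewrite RintegralD ?RintegralZl//; exact: IZ.
Qed.

Lemma L2_dot_linl a (u v w : L2) :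
  L2_dot (a *: u + v) w = a * L2_dot u w + L2_dot v w.
Proof.
rewrite /L2_dot -L2_dotfun_lin//; apply: L2_dotfun_ae => //.
- by apply: L2_predD => //; exact: L2_predZ.
- exact: L2_linE.
- exact: aeW.
Qed.

Lemma L2_dot_herm (u v : L2) : L2_dot u v = Num.conj (L2_dot v u).
Proof.
have [_ i] := L2_integrable_mul (L2_reprP v) (L2_reprP u).
rewrite [RHS](_ : _ = conjc (L2_dot v u))//; apply/eqP.
rewrite eq_complex /=; apply/andP; split; apply/eqP.
  by apply: eq_Rintegral => x _; case: (u x) => ? ?; case: (v x) => ? ? /=; ring.
rewrite -mulN1r -RintegralZl//.
by apply: eq_Rintegral => x _; case: (u x) => ? ?; case: (v x) => ? ? /=; ring.
Qed.

Lemma L2_dot_gt0 (u : L2) : u != 0 -> 0 < L2_dot u u.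
Proof.
have [r i] := L2_integrable_mul (L2_reprP u) (L2_reprP u).
have sqE x : complex.Re (u x * conjc (u x)) =
    complex.Re (u x) ^+ 2 + complex.Im (u x) ^+ 2.
  by case: (u x) => a b /=; ring.
have sq_ge0 x : 0 <= complex.Re (u x * conjc (u x)).
  by rewrite sqE addr_ge0// sqr_ge0.
move=> u0; rewrite ltcE /=; apply/andP; split.
  rewrite [X in X == _](_ : _ = \int[mu]_x 0).
    by rewrite /Rintegral integral0.
  by apply: eq_Rintegral => x _; case: (u x) => a b /=; ring.
rewrite lt_neqAle Rintegral_ge0// andbT eq_sym; apply: contra u0 => /eqP I0.
apply/eqP/L2_eqP; have :
  (\int[mu]_x `|(EFin \o (fun x => complex.Re (u x * conjc (u x)))%R) x| = 0)%E.
  rewrite -[LHS]fineK; last exact: integrable_fin_num (integrable_abse r).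
  congr EFin; rewrite -[RHS]I0 /Rintegral; congr fine.
  by apply: eq_integral => x _; rewrite gee0_abs// lee_fin.
move=> /(ae_eq_integral_abs mu measurableT (measurable_int _ r)) H.
apply: filterS2 H L2_zeroE => x H e Dx; rewrite e//.
have /eqP := H I; rewrite /= eqe sqE paddr_eq0 ?sqr_ge0// !sqrf_eq0.
by move=> h; apply/eqP; rewrite eq_complex.
Qed.

Let L2_dot_bilin : bilinear_for *%R (Num.conj \; *%R) L2_dot.
Proof.
split=> [w a u v|w a u v]; first exact: L2_dot_linl.
by rewrite !(L2_dot_herm w) L2_dot_linl rmorphD rmorphM.
Qed.

HB.instance Definition _ := bilinear_isBilinear.Build R[i] L2 L2 R[i]
  *%R (Num.conj \; *%R) L2_dot L2_dot_bilin.

Let L2_dot_hermitian (u v : L2) :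
  L2_dot u v = (-1) ^+ false * Num.conj (L2_dot v u).
Proof. by rewrite expr0 mul1r; exact: L2_dot_herm. Qed.

HB.instance Definition _ := isHermitianSesquilinear.Build R[i] L2 false
  Num.conj L2_dot L2_dot_hermitian.
HB.instance Definition _ := isDotProduct.Build R[i] L2 L2_dot L2_dot_gt0.

End L2.
Arguments L2 {d T R} mu.
Arguments L2class {d T R} mu f.
Arguments L2_dot {d T R} mu u v.

Section operator_algebras.
Variables (C : numClosedFieldType) (H : lmodType C).
Variable ip : {dot H for Num.conj}.
Implicit Types (S : set (H -> H)) (A B : H -> H) (u v : H).

Definition hilbert_norm u : C := sqrtC (ip u u).

Definition bounded_op B : Prop :=
  linear B /\ exists M : C, forall u, hilbert_norm (B u) <= M * hilbert_norm u.

Definition commutant S : set (H -> H) :=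
  [set B | bounded_op B /\ forall A, S A -> B \o A = A \o B].

(* for S closed under adjoints, the von Neumann algebra generated by S *)
Definition bicommutant S : set (H -> H) := commutant (commutant S).

Definition linear_span S : set (H -> H) :=
  [set B | exists n (c : 'I_n -> C) (A : 'I_n -> H -> H),
    (forall i, S (A i)) /\ B = (fun u => \sum_i c i *: A i u)].

(* closure in B(H) for the weak operator topology *)
Definition weak_closure S : set (H -> H) :=
  [set B | bounded_op B /\
    forall (s : seq (H * H)) (eps : C), 0 < eps ->
    exists2 A, S A &
      forall uv, uv \in s -> `|ip (A uv.1) uv.2 - ip (B uv.1) uv.2| < eps].

Definition strong_limit (A_ : nat -> H -> H) B : Prop :=
  bounded_op B /\
  forall u (eps : C), 0 < eps ->
    \forall n \near \oo, hilbert_norm (A_ n u - B u) < eps.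

Definition scalar_ops : set (H -> H) :=
  [set B | exists l : C, B = (fun u => l *: u)].

End operator_algebras.

Section quasi_regular_representation.
Variables (R : realType) (p : nat) (mu : probability (X1 p) R).
Local Open Scope complex_scope.

Definition quasi_regular (t : B0N p) (f : L2 mu) : L2 mu :=
  L2class mu (fun x => (Num.sqrt (fine (density mu t x)))%:C * f (Ract t^-1%g x)).

Definition vN_algebra : set (L2 mu -> L2 mu) :=
  bicommutant (L2_dot mu) (range quasi_regular).

(* meaningful for k < n *)
Definition Tkn (k n : nat) : L2 mu -> L2 mu := quasi_regular (IsubE p k n).

Definition Csum (T : L2 mu -> L2 mu) : L2 mu -> L2 mu :=
  fun f => \sum_(r : 'F_p) iter r T f.

(* T_(1s)^r times the factors k = s + 1, ..., N - 1 of the infinite product;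
   iter reads r as its representative in 0, ..., p - 1 *)
Definition Delta_partial (s : nat) (r : 'F_p) (N : nat) : L2 mu -> L2 mu :=
  iter r (Tkn 0 s) \o
  \big[(fun S T : L2 mu -> L2 mu => S \o T)/id]_(s.+1 <= k < N)
    (fun f => (p%:R)^-1 *: Csum (Tkn 0 k) f).

End quasi_regular_representation.
Arguments Delta_partial {R p} mu s r N _.
Arguments vN_algebra {R p} mu.

Section product_measures.
Variables (R : realType) (p : nat).

(* mu is the product over k >= 1 of the measures r |-> alpha k r on F_p:
   its values on the finite-dimensional cylinders determine it *)
Definition is_product_measure (alpha : nat -> 'F_p -> R)
    (mu : probability (X1 p) R) : Prop :=
  forall (n : nat) (a : nat -> 'F_p),
    mu [set x : X1 p | forall k, (1 <= k <= n)%N -> x k = a k] =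
    (\prod_(1 <= k < n.+1) alpha k (a k))%:E.

Definition uniform_weights (k : nat) (r : 'F_p) : R := (p%:R)^-1.

Definition SL11 (alpha : nat -> 'F_p -> R) : \bar R :=
  (\sum_(1 <= n <oo)
    (\sum_(r : 'F_p | r != 0)
      (1 - \sum_(k : 'F_p) Num.sqrt (alpha n (k + r) * alpha n k)))%:E)%E.

End product_measures.

Definition measure_equivalent d (T : measurableType d) (R : realType)
    (mu nu : {measure set T -> \bar R}) : Prop := mu `<< nu /\ nu `<< mu.

Definition mutually_singular d (T : measurableType d) (R : realType)
    (mu nu : {measure set T -> \bar R}) : Prop :=
  exists A, [/\ measurable A, mu A = 0%E & nu (~` A) = 0%E].

(* Main.v *)
(** Proof idea. For a matrix t fixing the rows beyond level N, the density of
    mu_alpha o R_t is the quotient of two finite products of weights, so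
    T_t f (x) = sqrt(w_N(xt) / w_N(x)) f(xt).

    (a) If mu_alpha ~ mu_inv, the vectors xi_N(x) = 1_{cyl_N(x)} (d mu_inv / d mu_alpha)^(1/2),
    with cyl_N(x) the cylinder of the rows agreeing with x up to coordinate N,
    are total and permuted by the group: T_t xi_N(x) = xi_N(x t^-1).  The products
    of averages p^-1 C(T_1k), s < k, converge strongly to the projection E_s on the
    span of the xi_s(x).  An element B of the commutant sends
    xi_s(x) - p^-1 xi_(s-1)(x) to a combination of its translates under the powers
    of T_1s, with coefficients beta_r independent of x, and so
    B (E_s - E_(s-1)) = sum_r beta_r (Delta_(s,r) - E_(s-1)).  Finally
    p E_(s-1) = E_s + sum_(r <> 0) Delta_(s,r) puts every E_s, by a geometric
    series, in the closed span of the identity and the Delta_(s,r).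

    (b) If mu_alpha and mu_inv are singular, let M be the multiplication by
    1_{x_k = a}.  Averaging over b the operators x_n |-> x_n + b (x_k - a) gives
    M + (1 - M) p^-1 C(T_1n), so for B in the commutant the vector [B, M] u is
    invariant under the translations of all coordinates n > k; its square times
    mu_alpha is then dominated by mu_inv and it vanishes.  Hence B commutes with
    all cylinder indicators, and B 1 is constant because B commutes with the
    group.

    Kakutani's dichotomy: with c_n = sum_k sqrt(alpha_n(k) / p), the n-th term of
    S^L_11 is p (1 - c_n^2), and both S^L_11 = oo and singularity amount to
    c_1 ... c_N -> 0; the second because this product is the Hellinger affinity
    of the laws of the first N coordinates and measurable sets are approximated
    by cylinder sets. *)

Require Import Defs.
From HB Require Import structures.
From mathcomp Require Import all_boot all_order all_algebra.
From mathcomp Require Import complex sesquilinear ring lra.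
From mathcomp Require Import all_classical all_reals all_analysis.
From mathcomp Require Import measurable_realfun.

Import Order.TTheory GRing.Theory Num.Theory numFieldNormedType.Exports.
Local Open Scope classical_set_scope.
Local Open Scope ring_scope.

(** * Operators on an inner product space *)

(** Multiplication by the square root of d mu_inv / d mu_alpha intertwines the representation with
    the one on L^2(mu_inv), where the group preserves the measure and merely permutes cylinder
    indicators. Case (a) does not build this unitary: it works in an abstract inner product space
    with vectors [xi N x] that satisfy the few relations known for those indicators. Limits are
    exhibited in closed form, E_s being a finite sum over the cylinders of level s, and operator
    identities are checked on a total set of vectors. A product measure is given only by its values
    on cylinders. Density of the cylinder sets for the symmetric difference therefore carries all
    comparisons of measures, and each of them becomes a finite computation. In case (b) no limit in
    n is taken. Each single operator M + (1 - M) p^-1 C(T_1n) is an average of group operators, and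
    commuting with it for every n > k separately already makes [B, M] u invariant beyond coordinate
    k. *)

Section hilbert.
Context {C : numClosedFieldType} {H : lmodType C} (ip : {dot H for Num.conj}).
Implicit Types (u v w : H) (A B : H -> H).

Local Notation nrm := (hilbert_norm ip).

Lemma hnrm_ge0 u : 0 <= nrm u.
Proof. by rewrite sqrtC_ge0 dnorm_ge0. Qed.

Lemma hnrm_sqr u : nrm u ^+ 2 = ip u u.
Proof. exact: sqrtCK. Qed.

Lemma hnrm_eq0 u : (nrm u == 0) = (u == 0).
Proof. by rewrite sqrtC_eq0 dnorm_eq0. Qed.

Lemma hnrm0 : nrm 0 = 0.
Proof. by apply/eqP; rewrite hnrm_eq0. Qed.

Lemma hnrmZ a u : nrm (a *: u) = `|a| * nrm u.
Proof.
apply/eqP; rewrite -(@eqrXn2 _ 2) ?hnrm_ge0 ?mulr_ge0 ?hnrm_ge0//.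
by rewrite exprMn !hnrm_sqr dnormZ.
Qed.

Lemma hnrmN u : nrm (- u) = nrm u.
Proof. by rewrite -scaleN1r hnrmZ normrN1 mul1r. Qed.

Lemma hnrm_distC u v : nrm (u - v) = nrm (v - u).
Proof. by rewrite -hnrmN opprB. Qed.

Lemma hnrm_CS u v : `|ip u v| <= nrm u * nrm v.
Proof.
have [->|v0] := eqVneq v 0; first by rewrite linear0r normr0 mulr_ge0 ?hnrm_ge0.
rewrite -(@ler_sqr _) ?nnegrE ?mulr_ge0 ?hnrm_ge0// exprMn !hnrm_sqr.
have vv : 0 < ip v v by rewrite dnorm_gt0.
set a := ip u v / ip v v; have : 0 <= ip (u - a *: v) (u - a *: v).
  exact: dnorm_ge0.
have o : ip (u - a *: v) v = 0.
  by rewrite linearBl/= linearZl_LR/= divfK ?gt_eqF// subrr.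
rewrite linearBr/= linearZr_LR/= o mulr0 subr0 linearBl/= linearZl_LR/=.
rewrite subr_ge0 -(ler_pM2r vv) mulrAC divfK ?gt_eqF//.
by rewrite normCK [ip v u]hermC/= expr0 mul1r.
Qed.

Lemma hnrmD u v : nrm (u + v) <= nrm u + nrm v.
Proof.
rewrite -(@ler_sqr _) ?nnegrE ?addr_ge0 ?hnrm_ge0// sqrrD !hnrm_sqr dnormD.
rewrite [X in _ <= X]addrAC lerD2l -mulr_natr.
rewrite -[X in X <= _](divfK (negbT (pnatr_eq0 C 2))) -ReE ler_pM2r ?ltr0n//.
by apply: le_trans (hnrm_CS u v); rewrite leif_Re_Creal.
Qed.

End hilbert.

Section linear_operators.
Context {C : numClosedFieldType} {H : lmodType C} (ip : {dot H for Num.conj}).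
Implicit Types (u v w : H) (A B : H -> H) (S : set (H -> H)).

Local Notation nrm := (hilbert_norm ip).

Section linear_theory.
Variables (B : H -> H) (linB : linear B).

Lemma linear_op0 : B 0 = 0.
Proof.
by have := linB (-1) 0 0; rewrite scaler0 addr0 scaleN1r addNr.
Qed.

Lemma linear_opZ a u : B (a *: u) = a *: B u.
Proof. by have := linB a u 0; rewrite linear_op0 !addr0. Qed.

Lemma linear_opD u v : B (u + v) = B u + B v.
Proof. by have := linB 1 u v; rewrite !scale1r. Qed.

Lemma linear_opB u v : B (u - v) = B u - B v.
Proof. by rewrite linear_opD -scaleN1r linear_opZ scaleN1r. Qed.

Lemma linear_op_sum (I : Type) (r : seq I) (P : pred I) (F : I -> H) :
  B (\sum_(i <- r | P i) F i) = \sum_(i <- r | P i) B (F i).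
Proof. exact: (big_morph B linear_opD linear_op0). Qed.

End linear_theory.

Lemma linear_comp A B : linear A -> linear B -> linear (A \o B).
Proof. by move=> lA lB a u v /=; rewrite lB lA. Qed.

Lemma linear_iter n B : linear B -> linear (iter n B).
Proof. by move=> lB; elim: n => // n IH; exact: (@linear_comp B (iter n B)). Qed.

Lemma hnrm_sum (I : Type) (r : seq I) (P : pred I) (F : I -> H) :
  nrm (\sum_(i <- r | P i) F i) <= \sum_(i <- r | P i) nrm (F i).
Proof.
elim/big_rec2: _ => [|i x u _ IH]; first by rewrite hnrm0.
by rewrite (le_trans (hnrmD _ _ _))// lerD2l.
Qed.

Lemma ip_sumr u (I : Type) (r : seq I) (F : I -> H) :
  ip u (\sum_(i <- r) F i) = \sum_(i <- r) ip u (F i).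
Proof.
by apply: (big_morph (ip u)) => [v w|]; [rewrite linearDr|rewrite linear0r].
Qed.

(** In [bounded_op] the constant M is any element of C. The inequality makes M * nrm u nonnegative,
    so |M| + 1 is a positive constant that also works. *)
Lemma bounded_opP B : bounded_op ip B ->
  linear B /\ exists2 M, 0 < M & forall u, nrm (B u) <= M * nrm u.
Proof.
move=> [lB [M BM]]; split => //; exists (`|M| + 1); first by rewrite ltr_wpDl.
move=> u; have h0 := hnrm_ge0 ip u; have MB := BM u.
have : 0 <= M * nrm u by rewrite (le_trans (hnrm_ge0 _ _) MB).
move=> M0; rewrite mulrDl mul1r (le_trans MB)//.
by rewrite -(ger0_norm M0) normrM (ger0_norm h0) lerDl.
Qed.

Lemma bounded_id : bounded_op ip id.
Proof. by split => //; exists 1 => u; rewrite mul1r. Qed.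

Lemma bounded_comp A B : bounded_op ip A -> bounded_op ip B ->
  bounded_op ip (A \o B).
Proof.
move=> /bounded_opP[lA [M M0 AM]] /bounded_opP[lB [L L0 BL]].
split; first exact: linear_comp.
exists (M * L) => u /=; rewrite (le_trans (AM _))// -mulrA.
by rewrite ler_pM2l.
Qed.

Lemma bounded_iter n B : bounded_op ip B -> bounded_op ip (iter n B).
Proof.
by move=> bB; elim: n => [|n IH]; [exact: bounded_id|exact: bounded_comp].
Qed.

Lemma bounded_lin a A B : bounded_op ip A -> bounded_op ip B ->
  bounded_op ip (fun u => a *: A u + B u).
Proof.
move=> [lA [M AM]] [lB [L BL]]; split.
  by move=> c u v; rewrite lA lB !scalerDr !scalerA (mulrC c) addrACA.
exists (`|a| * M + L) => u; rewrite (le_trans (hnrmD _ _ _))// hnrmZ mulrDl.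
by rewrite lerD// -mulrA ler_wpM2l.
Qed.

Lemma bounded_zero : bounded_op ip (fun=> 0).
Proof.
split; first by move=> a u v; rewrite scaler0 addr0.
by exists 0 => u; rewrite hnrm0 mul0r.
Qed.

Lemma bounded_sum (I : Type) (r : seq I) (c : I -> C) (F : I -> H -> H) :
  (forall i, bounded_op ip (F i)) ->
  bounded_op ip (fun u => \sum_(i <- r) c i *: F i u).
Proof.
move=> bF; elim: r => [|i r IH].
  rewrite [X in bounded_op _ X](_ : _ = fun=> 0); first exact: bounded_zero.
  by apply/funext => u; rewrite big_nil.
rewrite [X in bounded_op _ X](_ : _ =
    fun u => c i *: F i u + \sum_(i <- r) c i *: F i u).
  exact: bounded_lin.
by apply/funext => u; rewrite big_cons.
Qed.

Lemma bounded_rank1 v w : bounded_op ip (fun u => ip u v *: w).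
Proof.
split; first by move=> a u u'; rewrite linearPl/= scalerDl scalerA.
exists (nrm v * nrm w) => u.
by rewrite hnrmZ mulrAC ler_wpM2r ?hnrm_ge0// mulrC hnrm_CS.
Qed.

Lemma bounded_isometry B : linear B -> (forall u, nrm (B u) = nrm u) ->
  bounded_op ip B.
Proof. by move=> lB iB; split=> //; exists 1 => u; rewrite iB mul1r. Qed.

(* polarization *)
Lemma isometry_ip B : linear B -> (forall u, nrm (B u) = nrm u) ->
  forall u v, ip (B u) (B v) = ip u v.
Proof.
move=> lB iB; have iB2 u : ip (B u) (B u) = ip u u by rewrite -!hnrm_sqr iB.
have re u v : ip (B u) (B v) + (ip (B u) (B v))^* = ip u v + (ip u v)^*.
  by apply: (addrI (ip u u + ip v v)); rewrite -dnormD -{1}(iB2 u) -(iB2 v)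
    -dnormD -linear_opD// iB2.
move=> u v; have e1 := re u v; have := re u ('i *: v).
rewrite linear_opZ// !linearZr_LR/= conjCi !rmorphM/= rmorphN/= conjCi opprK.
rewrite !mulNr ![- _ + _]addrC -!mulrBr => /(mulfI (neq0Ci C)) e2.
have : ip (B u) (B v) *+ 2 = ip u v *+ 2.
  transitivity (ip (B u) (B v) + (ip (B u) (B v))^* -
      ((ip (B u) (B v))^* - ip (B u) (B v))).
    by rewrite opprB addrACA subrr addr0.
  by rewrite e1 e2 opprB addrACA subrr addr0.
by move/eqP; rewrite eqrMn2r => /eqP.
Qed.

(** Norm convergence in the form used by [strong_limit]; H carries no topology of its own. *)
Definition tends (x : nat -> H) v := forall eps : C, 0 < eps ->
  \forall n \near \oo, nrm (x n - v) < eps.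

Lemma hnrm_small u : (forall eps, 0 < eps -> nrm u < eps) -> u = 0.
Proof.
move=> small; apply/eqP; rewrite -(hnrm_eq0 ip); apply: contraT => u0.
have : 0 < nrm u by rewrite lt_def u0 hnrm_ge0.
by move=> /small; rewrite ltxx.
Qed.

Lemma tends_near x v w : (\forall n \near \oo, x n = w) -> tends x v -> v = w.
Proof.
move=> xw xv; apply/eqP; rewrite eq_sym -subr_eq0; apply/eqP/hnrm_small.
move=> eps /xv h; have [n [-> //]] := filter_ex (filterI xw h).
Qed.

Lemma near_tends x w : (\forall n \near \oo, x n = w) -> tends x w.
Proof.
by move=> xw eps e0; apply: filterS xw => n ->; rewrite subrr hnrm0.
Qed.

Lemma tends_lin a x v y w : tends x v -> tends y w ->
  tends (fun n => a *: x n + y n) (a *: v + w).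
Proof.
move=> xv yw eps e0.
have a0 : 0 < `|a| + 1 by rewrite ltr_wpDl.
have e1 : 0 < eps / 2 / (`|a| + 1) by rewrite !divr_gt0.
have e2 : 0 < eps / 2 by rewrite divr_gt0.
apply: filterS2 (xv _ e1) (yw _ e2) => n h1 h2.
rewrite opprD addrACA -scalerBr (le_lt_trans (hnrmD _ _ _))//.
rewrite (splitr eps) ler_ltD// hnrmZ (@le_trans _ _ ((`|a| + 1) * nrm (x n - v)))//.
  by rewrite ler_wpM2r ?hnrm_ge0// lerDl.
by rewrite mulrC -ler_pdivlMr// ltW.
Qed.

Lemma tends_bounded B x v : bounded_op ip B -> tends x v ->
  tends (fun n => B (x n)) (B v).
Proof.
move=> /bounded_opP[lB [M M0 BM]] xv eps e0.
apply: filterS (xv _ (divr_gt0 e0 M0)) => n h.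
by rewrite -linear_opB// (le_lt_trans (BM _))// mulrC -ltr_pdivlMr.
Qed.

(** The intersection of all subspaces containing D. In this encoding membership is an induction
    principle, without finite families of coefficients. *)
Definition lin_hull (D : set H) : set H := [set v | forall P : set H, P 0 ->
  (forall a u w, P u -> P w -> P (a *: u + w)) -> D `<=` P -> P v].

Definition total (D : set H) := forall u (eps : C), 0 < eps ->
  exists2 v, lin_hull D v & nrm (u - v) < eps.

(** A uniform norm bound spreads strong convergence from a total set to all vectors: linearity gives
    it on the hull, and replacing u by a nearby v costs at most the sum of the two bounds times the
    norm of u - v. *)
Lemma total_tends (D : set H) (A_ : nat -> H -> H) B (M : C) : total D ->
  (forall n, linear (A_ n)) -> (forall n u, nrm (A_ n u) <= M * nrm u) ->
  bounded_op ip B -> (forall d, D d -> tends (A_ ^~ d) (B d)) ->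
  forall u, tends (A_ ^~ u) (B u).
Proof.
move=> tD lA AM bB AB u eps e0; have [lB [L L0 BL]] := bounded_opP _ bB.
have [M' M'0 AM'] : exists2 M', 0 < M' & forall n u, nrm (A_ n u) <= M' * nrm u.
  exists (`|M| + 1); first by rewrite ltr_wpDl.
  move=> n w; have h0 := hnrm_ge0 ip w; have MB := AM n w.
  have M0 : 0 <= M * nrm w by rewrite (le_trans (hnrm_ge0 _ _) MB).
  rewrite mulrDl mul1r (le_trans MB)//.
  by rewrite -(ger0_norm M0) normrM (ger0_norm h0) lerDl.
have ML : 0 < M' + L by exact: addr_gt0.
have e2 : 0 < eps / 2 by rewrite divr_gt0.
have [v hv uv] := tD u _ (divr_gt0 e2 ML).
have tv : tends (A_ ^~ v) (B v).
  apply: (hv (fun v => tends (A_ ^~ v) (B v))) => //.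
    apply: near_tends; near=> n.
    by rewrite (linear_op0 _ (lA n)) (linear_op0 _ lB).
  move=> a w w' h1 h2; rewrite lB => d d0.
  by apply: filterS (tends_lin a _ _ _ _ h1 h2 d d0) => n; rewrite lA.
apply: filterS (tv _ e2) => n h.
have -> : A_ n u - B u = (A_ n (u - v) - B (u - v)) + (A_ n v - B v).
  rewrite (linear_opB _ (lA n)) (linear_opB _ lB).
  by rewrite addrACA subrK opprB addrAC subrr add0r.
rewrite (le_lt_trans (hnrmD _ _ _))// (splitr eps) ler_ltD//.
rewrite (le_trans (hnrmD _ _ _))// hnrmN.
rewrite (le_trans (lerD (AM' n _) (BL _)))// -mulrDl mulrC -ler_pdivlMr//.
exact: ltW.
Unshelve. all: by end_near. Qed.

(** By [total_tends] the constant sequence A tends to B, and limits are unique. *)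
Lemma total_eq (D : set H) A B : total D -> bounded_op ip A -> bounded_op ip B ->
  (forall d, D d -> A d = B d) -> A = B.
Proof.
move=> tD bA bB AB; apply/funext => u.
have [lA [M AM]] := bA.
apply/esym/(tends_near (fun=> A u)); first by near=> n.
apply: (total_tends D (fun=> A) B M) => // d Dd.
by apply: near_tends; near=> n; exact: AB.
Unshelve. all: by end_near. Qed.

Lemma total_orthogonal (D : set H) u : total D -> (forall d, D d -> ip u d = 0) ->
  u = 0.
Proof.
move=> tD uD; apply: hnrm_small => eps e0.
have [v hv uv] := tD u eps e0; apply: le_lt_trans uv.
have uv0 : ip u v = 0.
  apply: (hv (fun v => ip u v = 0)) => //; first exact: linear0r.
  by move=> a w w' h1 h2; rewrite linearPr/= h1 h2 mulr0 addr0.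
have [->|u0] := eqVneq (nrm u) 0; first exact: hnrm_ge0.
have u1 : 0 < nrm u by rewrite lt_def u0 hnrm_ge0.
rewrite -(ler_pM2l u1) -expr2 hnrm_sqr -[X in X <= _]subr0 -[X in _ - X]uv0.
by rewrite -linearBr/= (le_trans (real_ler_norm _)) ?hnrm_CS// ger0_real//
  linearBr/= uv0 subr0 dnorm_ge0.
Qed.

(** Closure for the strong operator topology, with no boundedness of the limit built in; that is
    supplied on passing to [weak_closure]. *)
Definition strong_closure (S : set (H -> H)) : set (H -> H) :=
  [set B | forall (s : seq H) (eps : C), 0 < eps ->
    exists2 A, S A & forall u, u \in s -> nrm (A u - B u) < eps].

Lemma strong_closure_limit S (A_ : nat -> H -> H) B :
  (forall n, strong_closure S (A_ n)) -> (forall u, tends (A_ ^~ u) (B u)) ->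
  strong_closure S B.
Proof.
move=> SA AB s eps e0; have e2 : 0 < eps / 2 by rewrite divr_gt0.
have : \forall n \near \oo, forall u, u \in s -> nrm (A_ n u - B u) < eps / 2.
  elim: s => [|u s IH]; first by near=> n.
  apply: filterS2 IH (AB u _ e2) => n h1 h2 v.
  by rewrite inE => /orP[/eqP->//|/h1].
move=> /filter_ex[n hn]; have [A SA' hA] := SA n s _ e2; exists A => // u us.
rewrite -(subrKA (A_ n u)) (le_lt_trans (hnrmD _ _ _))// (splitr eps).
by rewrite ltrD ?hA ?hn.
Unshelve. all: by end_near. Qed.

Lemma sub_strong_closure S : S `<=` strong_closure S.
Proof. by move=> A SA s eps e0; exists A => // u _; rewrite subrr hnrm0. Qed.

Lemma linear_span_sub S : S `<=` linear_span S.
Proof.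
move=> A SA; exists 1%N, (fun=> 1), (fun=> A); split => //.
by apply/funext => u; rewrite big_ord1 scale1r.
Qed.

Lemma linear_span_lin S a A B : linear_span S A -> linear_span S B ->
  linear_span S (fun u => a *: A u + B u).
Proof.
move=> [n [c [F [SF ->]]]] [m [d [G [SG ->]]]].
exists (n + m)%N, (fun i => match fintype.split i with inl j => a * c j | inr j => d j end),
  (fun i => match fintype.split i with inl j => F j | inr j => G j end).
split; first by move=> i; case: (fintype.split i).
apply/funext => u; rewrite big_split_ord /= scaler_sumr; congr (_ + _).
  by apply: eq_bigr => i _; rewrite (unsplitK (inl i)) scalerA.
by apply: eq_bigr => i _; rewrite (unsplitK (inr i)).
Qed.

Lemma strong_closure_lin S a A B : strong_closure (linear_span S) A ->
  strong_closure (linear_span S) B ->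
  strong_closure (linear_span S) (fun u => a *: A u + B u).
Proof.
move=> SA SB s eps e0.
have a0 : 0 < `|a| + 1 by rewrite ltr_wpDl.
have e1 : 0 < eps / 2 / (`|a| + 1) by rewrite !divr_gt0.
have e2 : 0 < eps / 2 by rewrite divr_gt0.
have [A' SA' h1] := SA s _ e1; have [B' SB' h2] := SB s _ e2.
exists (fun u => a *: A' u + B' u); first exact: linear_span_lin.
move=> u us; rewrite opprD addrACA -scalerBr (le_lt_trans (hnrmD _ _ _))//.
rewrite (splitr eps) ler_ltD ?h2// hnrmZ.
rewrite (@le_trans _ _ ((`|a| + 1) * nrm (A' u - A u)))//.
  by rewrite ler_wpM2r ?hnrm_ge0// lerDl.
by rewrite mulrC -ler_pdivlMr// ltW// h1.
Qed.

Lemma strong_closure_weak S B : bounded_op ip B -> strong_closure S B ->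
  weak_closure ip S B.
Proof.
move=> bB SB; split => // s eps e0.
set K := 1 + \sum_(uv <- s) nrm uv.2.
have K0 : 0 < K by rewrite ltr_pwDl// sumr_ge0// => i _; exact: hnrm_ge0.
have [A SA h] := SB (map fst s) (eps / K) (divr_gt0 e0 K0); exists A => // uv uvs.
rewrite -linearBl/= (le_lt_trans (hnrm_CS _ _ _))//.
have : nrm (A uv.1 - B uv.1) < eps / K by apply: h; exact: map_f.
rewrite ltr_pdivlMr//; apply: le_lt_trans.
rewrite ler_wpM2l ?hnrm_ge0// /K (big_rem _ uvs)/= addrCA lerDl addr_ge0//.
by rewrite sumr_ge0// => i _; exact: hnrm_ge0.
Qed.

(** S lies in its bicommutant, so three commutants amount to one. Hence the commutant of the von
    Neumann algebra is tested against group operators alone. *)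
Lemma commutant_bicommutant S : S `<=` bounded_op ip ->
  commutant ip (bicommutant ip S) = commutant ip S.
Proof.
move=> Sb; apply/seteqP; split => B [bB BS]; split => // A.
  by move=> SA; apply: BS; split; [exact: Sb|move=> D [_ ->]].
by move=> [_ AS]; rewrite AS.
Qed.

End linear_operators.

(** * The group acting on rows *)

Section group_action.
Context {p : nat}.
Implicit Types (s t : B0N p) (x y z : X1 p).

Lemma X1_eqP x y : (forall k, (1 <= k)%N -> x k = y k) -> x = y.
Proof.
move=> xy; apply: val_inj; apply/funext => -[|k]; last exact: xy.
by rewrite /= !row1_0.
Qed.

Lemma row1_mul_coord x t n : row1_mul x t n = \sum_(k < n.+1) x k * t k n.
Proof. by []. Qed.

Lemma row1_mulA x s t : row1_mul x (s * t)%g = row1_mul (row1_mul x s) t.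
Proof.
apply: X1_eqP => n _; rewrite !row1_mul_coord /=.
under [RHS]eq_bigr => j _.
  rewrite mulr_suml -(@sum_widen0 p (fun i => x i * s i j * t j n) j.+1 n.+1)//;
    first over.
  by move=> i /andP[ji _]; rewrite (B0N_lower s)// mulr0 mul0r.
rewrite exchange_big /=; apply: eq_bigr => j _.
rewrite /B0N_mul_val mulr_sumr; apply: eq_bigr => i _.
by rewrite mulrA.
Qed.

Lemma row1_mul1 x : row1_mul x 1%g = x.
Proof.
apply: X1_eqP => n _; rewrite row1_mul_coord big_ord_recr /= /B0N_one_val eqxx mulr1.
by rewrite big1 ?add0r// => i _; rewrite ltn_eqF// mulr0.
Qed.

Lemma RactM s t x : Ract (s * t)%g x = Ract s (Ract t x).
Proof. by rewrite /Ract -row1_mulA invgM. Qed.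

Lemma Ract1 x : Ract 1%g x = x.
Proof. by rewrite /Ract invg1 row1_mul1. Qed.

Lemma RactK t : cancel (Ract t) (Ract t^-1%g).
Proof. by move=> x; rewrite -RactM mulVg Ract1. Qed.

Lemma RactVK t : cancel (Ract t^-1%g) (Ract t).
Proof. by move=> x; rewrite -RactM mulgV Ract1. Qed.

Lemma RactVE t x : Ract t^-1%g x = row1_mul x t.
Proof. by rewrite /Ract invgK. Qed.

(** Coordinate 0 is skipped because it is 1 in every row; in particular [eqlv 0] relates all
    rows. *)
Definition eqlv (N : nat) x y := forall k, (1 <= k <= N)%N -> x k = y k.

Lemma eqlv_sym N x y : eqlv N x y -> eqlv N y x.
Proof. by move=> xy k kN; rewrite xy. Qed.

Lemma eqlv_trans N x y z : eqlv N x y -> eqlv N y z -> eqlv N x z.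
Proof. by move=> xy yz k kN; rewrite xy// yz. Qed.

Lemma eqlv_le N M x y : (N <= M)%N -> eqlv M x y -> eqlv N x y.
Proof. by move=> NM xy k /andP[k1 kN]; rewrite xy// k1 (leq_trans kN NM). Qed.

Lemma eqlv_mul N x y t : eqlv N x y -> eqlv N (row1_mul x t) (row1_mul y t).
Proof.
move=> xy k /andP[k1 kN]; rewrite !row1_mul_coord.
apply: eq_bigr => -[[|i] /= ik] _; first by rewrite !row1_0.
by rewrite xy//= (leq_trans _ kN).
Qed.

Lemma eqlv_Ract N x y t : eqlv N x y -> eqlv N (Ract t x) (Ract t y).
Proof. exact: eqlv_mul. Qed.

Lemma eqlv_RactP N x y t : eqlv N (Ract t^-1%g x) y <-> eqlv N x (Ract t y).
Proof.
split=> [/(@eqlv_Ract _ _ _ t)|/(@eqlv_Ract _ _ _ t^-1%g)].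
  by rewrite RactVK.
by rewrite RactK.
Qed.

(* the matrix with I + \sum_(s < j < N) c j E_(sj) *)
Definition rowmx_val (s N : nat) (c : nat -> 'F_p) (i j : nat) : 'F_p :=
  (i == j)%:R + [&& i == s, (s < j)%N & (j < N)%N]%:R * c j.

Lemma rowmx_subproof (s N : nat) c : B0N_pred (rowmx_val s N c).
Proof.
apply: (@B0N_predP _ _ N) => [i|i j ji|i j Nj ij]; rewrite /rowmx_val.
- rewrite eqxx; case: eqP => [->|_]; last by rewrite mul0r addr0.
  by rewrite ltnn mul0r addr0.
- rewrite gtn_eqF// add0r; case: eqP => [<-|_]; last by rewrite mul0r.
  by rewrite (ltnNge i j) (ltnW ji) mul0r.
- by rewrite ltn_eqF// add0r (ltnNge j N) Nj !andbF mul0r.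
Qed.

Definition rowmx (s N : nat) c : B0N p := MkB0N (rowmx_subproof s N c).

Lemma row1_mul_rowmx x (s N : nat) c n : row1_mul x (rowmx s N c) n =
  x n + ((s < n)%N && (n < N)%N)%:R * (x s * c n).
Proof.
rewrite row1_mul_coord /= /rowmx_val.
under eq_bigr do rewrite mulrDr.
rewrite big_split/=; congr (_ + _).
  rewrite big_ord_recr /= eqxx mulr1 big1 ?add0r// => i _.
  by rewrite ltn_eqF// mulr0.
have [sn|ns] := ltnP s n; last first.
  by rewrite mul0r big1// => i _; rewrite andbF mul0r mulr0.
have sn1 : (s < n.+1)%N by rewrite ltnS ltnW.
rewrite (bigD1 (Ordinal sn1))//= eqxx/= big1 ?addr0; first by rewrite mulrCA.
move=> i; rewrite -val_eqE/= => /negbTE->.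
by rewrite mul0r mulr0.
Qed.

(** The matrix leaves coordinate s unchanged, so its inverse has -c in place of c. This is verified
    on rows, which avoids the recursion defining [B0N_inv]. *)
Lemma Ract_rowmx x (s N : nat) c n : Ract (rowmx s N c) x n =
  x n - ((s < n)%N && (n < N)%N)%:R * (x s * c n).
Proof.
pose y := row1_mul x (rowmx s N (fun j => - c j)).
have -> : Ract (rowmx s N c) x = y.
  rewrite -(RactK (rowmx s N c)^-1%g y) invgK RactVE; congr (Ract _ _).
  apply: X1_eqP => k _; rewrite 2!row1_mul_rowmx row1_mul_rowmx ltnn mul0r addr0.
  by rewrite mulrN mulrN addrNK.
by rewrite row1_mul_rowmx mulrN mulrN.
Qed.

Lemma IsubE_rowmx k n : (k < n)%N ->
  IsubE p k n = rowmx k n.+1 (fun j => - (j == n)%:R).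
Proof.
move=> kn; apply: B0N_eqP => i j; rewrite /= /IsubE_val /rowmx_val kn /=.
congr (_ + _); rewrite mulrN; congr (- _); have [->|jn] := eqVneq j n.
  by rewrite kn ltnSn !andbT mulr1.
by rewrite andbF mulr0.
Qed.

(** The test at 0 keeps the entry 1 of the row even for s = 0. For s >= 1 this is the action of the
    r-th power of the matrix behind T_1s. *)
Definition shift (s : nat) (r : 'F_p) x : X1 p :=
  @MkRow1 p (fun k => if k == 0%N then 1 else x k + (k == s)%:R * r) (eqxx _).

Lemma shiftE (s : nat) r x k : (1 <= k)%N -> shift s r x k = x k + (k == s)%:R * r.
Proof. by case: k. Qed.

Arguments shift : simpl never.

Lemma shift0 (s : nat) x : shift s 0 x = x.
Proof. by apply: X1_eqP => k k1; rewrite shiftE// mulr0 addr0. Qed.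

Lemma shiftD (s : nat) r r' x : shift s r (shift s r' x) = shift s (r + r') x.
Proof. by apply: X1_eqP => k k1; rewrite !shiftE// -addrA -mulrDr (addrC r'). Qed.

Lemma eqlv_shift N (s : nat) r x : (N < s)%N -> eqlv N (shift s r x) x.
Proof.
move=> Ns k /andP[k1 kN]; rewrite shiftE// ltn_eqF ?mul0r ?addr0//.
exact: leq_ltn_trans Ns.
Qed.

Lemma Ract_IsubE k x : (1 <= k)%N -> Ract (IsubE p 0 k) x = shift k 1 x.
Proof.
move=> k0; apply: X1_eqP => n n1; rewrite IsubE_rowmx// Ract_rowmx.
rewrite shiftE// n1/= row1_0 mul1r mulrN opprK mulr1; congr (_ + _).
by have [->|] := eqVneq n k; rewrite ?ltnSn ?mul1r ?mulr0.
Qed.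

(* t acts trivially on the last coordinate of the rows supported at s, up to s *)
Lemma eqlv_Ract_shift (s : nat) r t x : (1 <= s)%N ->
  eqlv s (Ract t (shift s r x)) (shift s r (Ract t x)).
Proof.
move=> s1 k /andP[k1 ks]; rewrite shiftE// /Ract; move: (t^-1)%g => {}t.
have zE j : (1 <= j)%N -> shift s r x j = x j + (j == s)%:R * r by exact: shiftE.
move: (shift s r x) zE => z zE; rewrite !row1_mul_coord !big_ord_recr/= zE//.
rewrite B0N_diag !mulr1 addrA; congr (_ + _ + _).
apply: eq_bigr => -[[|i] /= ik] _; first by rewrite !row1_0.
by rewrite zE// ltn_eqF ?mul0r ?addr0// (leq_trans ik ks).
Qed.

End group_action.

(** * The commutant of a representation permuting cylinder vectors *)

Section cylinder_vector_family.
Context {C : numClosedFieldType} {H : lmodType C} (ip : {dot H for Num.conj}).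
Context {p : nat} (p_prime : prime p).
Context (T : B0N p -> H -> H) (xi : nat -> X1 p -> H).
Hypothesis T_lin : forall t, linear (T t).
Hypothesis T_iso : forall t u, hilbert_norm ip (T t u) = hilbert_norm ip u.
Hypothesis T_mul : forall s t u, T (s * t)%g u = T s (T t u).
Hypothesis T_one : forall u, T 1%g u = u.
Hypothesis xi_ext : forall N x y, eqlv N x y -> xi N x = xi N y.
Hypothesis xi_split : forall N x,
  xi N x = \sum_(r : 'F_p) xi N.+1 (shift N.+1 r x).
Hypothesis xi_act : forall t N x, T t (xi N x) = xi N (Ract t x).
(** The value is the uniform measure of the intersection of two cylinders, which is either the
    smaller one or empty. *)
Hypothesis xi_ip : forall s d x y, ip (xi (s + d)%N x) (xi s y) =
  if `[< eqlv s x y >] then p%:R ^- (s + d) else 0.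
Hypothesis xi_total : total ip [set v | exists N x, v = xi N x].

Local Notation nrm := (hilbert_norm ip).
Local Notation P := (p%:R : C).
Local Notation U k := (T (IsubE p 0 k)).

Let P_neq0 : P != 0.
Proof. by rewrite pnatr_eq0 -lt0n prime_gt0. Qed.

Let P_unit : P \is a GRing.unit.
Proof. by rewrite unitfE. Qed.

Let P_gt0 : 0 < P.
Proof. by rewrite ltr0n prime_gt0. Qed.

Let T_ip t u v : ip (T t u) (T t v) = ip u v.
Proof. exact: isometry_ip. Qed.

Let T_bounded t : bounded_op ip (T t).
Proof. exact: bounded_isometry. Qed.

Definition cyclic_average (k : nat) (u : H) : H :=
  P^-1 *: \sum_(r : 'F_p) iter r (U k) u.

(** Written as the same iterated composition as in [Delta_partial], so that the abstract result
    applies to it by conversion. *)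
Definition average_product (s N : nat) : H -> H :=
  \big[(fun S T : H -> H => S \o T)/id]_(s.+1 <= k < N) cyclic_average k.

Lemma iter_U_xi k (r : 'F_p) N x : (1 <= k)%N ->
  iter r (U k) (xi N x) = xi N (shift k r x).
Proof.
move=> k1; have E (n : nat) : iter n (U k) (xi N x) = xi N (shift k n%:R x).
  elim: n => [|n IH]; first by rewrite /= shift0.
  by rewrite iterS IH xi_act Ract_IsubE// shiftD -natr1 addrC.
by rewrite E natr_Zp.
Qed.

Lemma iter_fix (B : H -> H) v n : B v = v -> iter n B v = v.
Proof. by move=> Bv; elim: n => //= n ->. Qed.

Lemma cyclic_average_fix k v : U k v = v -> cyclic_average k v = v.
Proof.
move=> Uv; rewrite /cyclic_average.
rewrite (eq_bigr (fun=> v)); last by move=> r _; rewrite iter_fix.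
by rewrite sumr_const card_Fp// -[v *+ p]scaler_nat scalerA mulVf// scale1r.
Qed.

Lemma cyclic_average_xi s x :
  cyclic_average s.+1 (xi s.+1 x) = P^-1 *: xi s x.
Proof.
rewrite /cyclic_average (xi_split s); congr (_ *: _).
by apply: eq_bigr => r _; rewrite iter_U_xi.
Qed.

Lemma linear_cyclic_average k : linear (cyclic_average k).
Proof.
move=> a u v; rewrite /cyclic_average scalerA mulrC -scalerA -scalerDr.
congr (_ *: _); rewrite scaler_sumr -big_split/=; apply: eq_bigr => r _.
by rewrite (linear_iter _ _ (T_lin _)).
Qed.

Lemma iter_isometry (n : nat) k u : nrm (iter n (U k) u) = nrm u.
Proof. by elim: n => //= n <-. Qed.

Lemma cyclic_average_le k u : nrm (cyclic_average k u) <= nrm u.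
Proof.
rewrite /cyclic_average hnrmZ ger0_norm ?invr_ge0 ?ler0n//.
rewrite mulrC ler_pdivrMr// (le_trans (hnrm_sum _ _ _ _ _))//.
rewrite (eq_bigr (fun=> nrm u)); last by move=> r _; rewrite iter_isometry.
by rewrite sumr_const card_Fp// mulr_natr.
Qed.

Lemma average_productS s N : (s.+1 < N)%N ->
  average_product s N = cyclic_average s.+1 \o average_product s.+1 N.
Proof. by move=> sN; rewrite /average_product big_ltn. Qed.

Lemma average_product_id s N : (N <= s.+1)%N -> average_product s N = id.
Proof. by move=> sN; rewrite /average_product big_geq. Qed.

(** Induction on N - s, because the outermost factor is the one of smallest index s + 1. *)
Lemma average_product_ind (Q : nat -> (H -> H) -> Prop) N :
  (forall s, Q s id) ->
  (forall s A, Q s.+1 A -> Q s (cyclic_average s.+1 \o A)) ->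
  forall s, Q s (average_product s N).
Proof.
move=> Q0 QS s; have [n nE] : exists n, (N - s)%N = n by exists (N - s)%N.
elim: n s nE => [|n IH] s nE.
  by rewrite average_product_id// ltnW// ltnS -subn_eq0 nE.
have [sN|Ns] := ltnP s.+1 N; last by rewrite average_product_id.
by rewrite average_productS//; apply/QS/IH; rewrite subnS nE.
Qed.

Lemma linear_average_product s N : linear (average_product s N).
Proof.
apply: (average_product_ind (fun _ A => linear A)) => // {}s A lA.
by apply: (@linear_comp _ _ _ A) => //; exact: linear_cyclic_average.
Qed.

Lemma average_product_le s N u : nrm (average_product s N u) <= nrm u.
Proof.
move: u; apply: (average_product_ind (fun _ A => forall u, nrm (A u) <= nrm u)).
  by [].
by move=> {}s A lA u /=; rewrite (le_trans (cyclic_average_le _ _)).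
Qed.

Lemma average_product_fix s N v : (forall k, (s < k)%N -> U k v = v) ->
  average_product s N v = v.
Proof.
apply: (average_product_ind
  (fun s A => (forall k, (s < k)%N -> U k v = v) -> A v = v)) => //.
move=> {}s A IH Uv /=; rewrite IH ?cyclic_average_fix ?Uv//.
by move=> k /ltnW; exact: Uv.
Qed.

Lemma U_xi_fix N k x : (N < k)%N -> U k (xi N x) = xi N x.
Proof.
move=> Nk; rewrite xi_act; apply: xi_ext.
by rewrite Ract_IsubE ?(leq_trans _ Nk)//; exact: eqlv_shift.
Qed.

(** Factors beyond s + d fix the vector, and each of the other d lowers its level by one at the
    price of [P^-1]. The products are thus eventually constant in N on every such vector. *)
Lemma average_product_xi s d N x : (s + d < N)%N ->
  average_product s N (xi (s + d) x) = P ^- d *: xi s x.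
Proof.
elim: d s => [|d IH] s.
  move=> sN; rewrite addn0 average_product_fix ?expr0 ?invr1 ?scale1r//.
  by move=> k sk; rewrite U_xi_fix.
rewrite addnS -addSn => sN; rewrite average_productS/=; last first.
  by rewrite (leq_ltn_trans _ sN)// leq_addr.
rewrite IH// (linear_opZ _ (linear_cyclic_average _)) cyclic_average_xi scalerA.
by rewrite -invfM -exprSr.
Qed.

(** One representative for each cylinder of level s, extended by 0 past s; index i of a stands for
    coordinate i + 1. *)
Definition row_of_ffun s (a : {ffun 'I_s -> 'F_p}) : X1 p :=
  @MkRow1 p (fun k => if k is k'.+1 then
    (if insub k' is Some i then a i else 0) else 1) (eqxx _).

Definition ffun_of_row s (x : X1 p) : {ffun 'I_s -> 'F_p} := [ffun i : 'I_s => x i.+1].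

Lemma row_of_ffunP s (a : {ffun 'I_s -> 'F_p}) x :
  eqlv s x (row_of_ffun s a) <-> a = ffun_of_row s x.
Proof.
split=> [xa|-> [//|k] /andP[_ ks]].
  apply/ffunP => i; rewrite ffunE xa//=; case: insubP => [j _ ji|].
    by congr (a _); exact: val_inj.
  by rewrite ltn_ord.
by rewrite /=; case: insubP => [i _ ik|]; rewrite ?ffunE ?ik ?ks.
Qed.

(** The orthogonal projection onto the span of the vectors of level s; [P ^+ s] is the inverse of
    their squared norm. *)
Definition E s (u : H) : H := \sum_(a : {ffun 'I_s -> 'F_p})
  P ^+ s *: (ip u (xi s (row_of_ffun s a)) *: xi s (row_of_ffun s a)).

Lemma E_bounded s : bounded_op ip (E s).
Proof. by apply: bounded_sum => a; exact: bounded_rank1. Qed.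

Let E_lin s : linear (E s).
Proof. by case: (E_bounded s). Qed.

Lemma E_xi s d x : E s (xi (s + d) x) = P ^- d *: xi s x.
Proof.
rewrite /E (bigD1 (ffun_of_row s x))//= big1 ?addr0; last first.
  move=> a ax; rewrite xi_ip; case: asboolP => [/row_of_ffunP ax'|_].
    by rewrite ax' eqxx in ax.
  by rewrite scale0r scaler0.
have xx : eqlv s x (row_of_ffun s (ffun_of_row s x)) by apply/row_of_ffunP.
rewrite xi_ip asboolT// scalerA exprD invfM mulrA mulfV ?expf_neq0// mul1r.
by rewrite (xi_ext _ _ _ (eqlv_sym _ _ _ xx)).
Qed.

Lemma lin_hull_sub (D : set H) : D `<=` lin_hull D.
Proof. by move=> d Dd Q _ _; exact. Qed.

Lemma lin_hull_lin (D : set H) a u v :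
  lin_hull D u -> lin_hull D v -> lin_hull D (a *: u + v).
Proof. by move=> hu hv Q Q0 QL DQ; apply: (QL); [apply: (hu Q)|apply: (hv Q)]. Qed.

Lemma lin_hull0 (D : set H) : lin_hull D 0.
Proof. by move=> Q. Qed.

Lemma lin_hull_sum (D : set H) (I : Type) (r : seq I) (F : I -> H) :
  (forall i, lin_hull D (F i)) -> lin_hull D (\sum_(i <- r) F i).
Proof.
move=> DF; elim/big_ind: _ => [|u v hu hv|//]; first exact: lin_hull0.
by rewrite -[u]scale1r; exact: lin_hull_lin.
Qed.

(** A vector of low level is a sum of vectors of higher level. Operators built from [E m] can then
    be compared on levels m + d only, where [E_xi] is explicit. *)
Lemma xi_total_from m : total ip [set v | exists d x, v = xi (m + d)%N x].
Proof.
move=> u eps e0; have [v hv uv] := xi_total u eps e0; exists v => //.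
apply: hv => [| |_ [N [x ->]]]; [exact: lin_hull0|exact: lin_hull_lin|].
have [mN|/ltnW Nm] := leqP m N.
  by apply: lin_hull_sub; exists (N - m)%N, x; rewrite subnKC.
rewrite -(subnK Nm) addnC; move: (m - N)%N => n {Nm}.
elim: n N x => [|n IH] N x.
  by rewrite addn0; apply: lin_hull_sub; exists 0%N, x; rewrite addn0.
by rewrite xi_split addnS -addSn; apply: lin_hull_sum => r; exact: IH.
Qed.

Lemma average_product_tends s u :
  tends ip (fun N => average_product s N u) (E s u).
Proof.
move: u; apply: (total_tends ip _ _ _ 1 (xi_total_from s)).
- by move=> N; exact: linear_average_product.
- by move=> N u; rewrite mul1r average_product_le.
- exact: E_bounded.
- move=> _ [d [x ->]]; apply: near_tends; near=> N.
  by rewrite E_xi average_product_xi//; near: N; exact: nbhs_infty_gt.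
Unshelve. all: by end_near. Qed.

Lemma tends_hnrm_le (x : nat -> H) v M : tends ip x v ->
  (forall n, nrm (x n) <= nrm M) -> nrm v <= nrm M.
Proof.
move=> xv xM; rewrite real_leNgt ?ger0_real ?hnrm_ge0//; apply/negP => Mv.
have : 0 < nrm v - nrm M by rewrite subr_gt0.
move=> /xv/filter_ex[n]; rewrite ltrBrDr; apply/negP.
rewrite -real_leNgt ?ger0_real ?addr_ge0 ?hnrm_ge0//.
rewrite -[X in nrm X <= _](subrK (x n)) (le_trans (hnrmD _ _ _))//.
by rewrite hnrm_distC lerD.
Qed.

(** Inherited in the limit from the contractions [average_product], in place of Bessel's
    inequality. *)
Lemma E_le s u : nrm (E s u) <= nrm u.
Proof.
apply: (tends_hnrm_le _ _ _ (average_product_tends s u)) => N.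
exact: average_product_le.
Qed.

(** The products converging to [E s] all fix v. Elements of the commutant preserve the hypothesis on
    v, so this is what confines B (xi s x) to the span of level s. *)
Lemma E_fix s v : (forall k, (s < k)%N -> U k v = v) -> E s v = v.
Proof.
move=> Uv; apply: (tends_near ip _ _ _ _ (average_product_tends s v)).
by near=> N; exact: average_product_fix.
Unshelve. all: by end_near. Qed.

Lemma E_tends u : tends ip (E ^~ u) u.
Proof.
move: u; apply: (total_tends ip _ _ id 1 xi_total) => //.
- by move=> N u; rewrite mul1r E_le.
- exact: bounded_id.
- move=> _ [M [x ->]]; apply: near_tends; near=> N.
  apply: E_fix => k Nk; apply: U_xi_fix; apply: leq_ltn_trans Nk.
  by near: N; exact: nbhs_infty_ge.
Unshelve. all: by end_near. Qed.

(** Closed form of the strong limit. [Delta s 0] is [E s], which [Deltas] excludes and which has to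
    be recovered from the rest. *)
Definition Delta s (r : 'F_p) : H -> H := iter r (U s) \o E s.

Lemma Delta_bounded s (r : 'F_p) : bounded_op ip (Delta s r).
Proof. by apply: bounded_comp; [exact: bounded_iter|exact: E_bounded]. Qed.

Lemma Delta_strong_limit s (r : 'F_p) :
  strong_limit ip (fun N => iter r (U s) \o average_product s N) (Delta s r).
Proof.
split; first exact: Delta_bounded.
move=> u; apply: tends_bounded; last exact: average_product_tends.
exact: bounded_iter.
Qed.

Lemma Delta_xi s r d x : (1 <= s)%N ->
  Delta s r (xi (s + d) x) = P ^- d *: xi s (shift s r x).
Proof.
move=> s1; rewrite /Delta/= E_xi (linear_opZ _ (linear_iter _ _ (T_lin _))).
by rewrite iter_U_xi.
Qed.

(** A unitriangular matrix changes coordinate s by a function of the earlier coordinates, so up to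
    level s it commutes with the translations of that coordinate. *)
Lemma Delta_commutant s r : (1 <= s)%N -> commutant ip (range T) (Delta s r).
Proof.
move=> s1; split; first exact: Delta_bounded.
move=> _ [t _ <-]; apply: (total_eq ip _ _ _ (xi_total_from s)).
- by apply: bounded_comp => //; exact: Delta_bounded.
- by apply: bounded_comp => //; exact: Delta_bounded.
- move=> _ [d [x ->]] /=; rewrite xi_act !Delta_xi// linear_opZ// xi_act.
  by congr (_ *: _); apply: xi_ext; apply: eqlv_sym; exact: eqlv_Ract_shift.
Qed.

Lemma E_Delta s u : P *: E s u = \sum_(r : 'F_p) Delta s.+1 r u.
Proof.
move: u; apply/funeqP; apply: (total_eq ip _ _ _ (xi_total_from s.+1)).
- rewrite [X in bounded_op _ X](_ : _ = fun u => P *: E s u + 0); last first.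
    by apply/funext => u; rewrite addr0.
  by apply: bounded_lin; [exact: E_bounded|exact: bounded_zero].
- rewrite [X in bounded_op _ X](_ : _ =
    fun u => \sum_(r : 'F_p) 1 *: Delta s.+1 r u).
    by apply: bounded_sum => r; exact: Delta_bounded.
  by apply/funext => u; apply: eq_bigr => r _; rewrite scale1r.
- move=> _ [d [x ->]]; rewrite addSnnS E_xi scalerA exprS invfM mulrA mulfV//.
  rewrite mul1r xi_split scaler_sumr; apply: eq_bigr => r _.
  by rewrite -addSnnS Delta_xi.
Qed.

Section commutant_element.
Context (B : H -> H) (BT : commutant ip (range T) B).

Let B_bounded : bounded_op ip B. Proof. by case: BT. Qed.

Let B_lin : linear B. Proof. by case: B_bounded. Qed.

Let B_T t u : B (T t u) = T t (B u).
Proof.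
have [_ /(_ (T t) (ex_intro2 _ _ t I erefl)) e] := BT.
exact: (congr1 (fun f : H -> H => f u) e).
Qed.

Let B_iterT n t u : B (iter n (T t) u) = iter n (T t) (B u).
Proof. by elim: n => //= n IH; rewrite B_T IH. Qed.

Local Notation z := (row1_pt p : X1 p).

Let z_eq0 k : (1 <= k)%N -> z k = 0.
Proof. by case: k. Qed.

Let B_xi_fix s k x : (s < k)%N -> U k (B (xi s x)) = B (xi s x).
Proof. by move=> sk; rewrite -B_T U_xi_fix. Qed.

Lemma commutant_E0 : exists c, forall u, B (E 0 u) = c *: E 0 u.
Proof.
pose c := \sum_(a : {ffun 'I_0 -> 'F_p}) ip (B (xi 0%N z)) (xi 0%N (row_of_ffun 0 a)).
have xi0 x y : xi 0%N x = xi 0%N y.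
  by apply: xi_ext => k /andP[/leq_trans h /h].
exists c; apply/funeqP; apply: (total_eq ip _ _ _ (xi_total_from 0)).
- by apply: (@bounded_comp _ _ _ B) => //; exact: E_bounded.
- rewrite [X in bounded_op _ X](_ : _ = fun u => c *: E 0 u + 0); last first.
    by apply/funext => u; rewrite addr0.
  by apply: bounded_lin; [exact: E_bounded|exact: bounded_zero].
- move=> _ [d [x ->]]; rewrite E_xi linear_opZ// scalerA mulrC -scalerA.
  congr (_ *: _); rewrite (xi0 x z) -[LHS](E_fix 0); last first.
    by move=> k k0; exact: B_xi_fix.
  rewrite /E scaler_suml; apply: eq_bigr => a _.
  by rewrite expr0 scale1r (xi0 (row_of_ffun 0 a) z).
Qed.

(** The component of [xi s.+1 x] orthogonal to the range of [E s]. On [xi s.+1 x] alone, B may also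
    produce cylinders with other first s coordinates; those contributions cancel in the
    difference. *)
Definition difference_xi s x := xi s.+1 x - P^-1 *: xi s x.

Lemma T_difference_xi t s x :
  T t (difference_xi s x) = difference_xi s (Ract t x).
Proof. by rewrite /difference_xi linear_opB// linear_opZ// !xi_act. Qed.

Lemma difference_xi_ext s x y : eqlv s.+1 x y ->
  difference_xi s x = difference_xi s y.
Proof.
move=> xy; rewrite /difference_xi (xi_ext _ _ _ xy) (xi_ext s x y)//.
exact: eqlv_le xy.
Qed.

(* The function [beta] is the convolution kernel of [B] on the range of
   [E s.+1]; invariance under the matrices fixing [z] makes it independent of
   the last coordinate unless all previous coordinates vanish. *)
Lemma commutant_difference_xi s : exists beta : 'F_p -> C, forall x,
  B (difference_xi s x) =
  \sum_(r : 'F_p) beta r *: difference_xi s (shift s.+1 r x).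
Proof.
pose v := B (xi s.+1 z).
(* The coefficient of [xi s.+1 y] in the expansion of v given by [E s.+1]. *)
pose beta y := P ^+ s.+1 * ip v (xi s.+1 y).
have beta_ext x y : eqlv s.+1 x y -> beta x = beta y.
  by move=> xy; rewrite /beta (xi_ext _ _ _ xy).
have beta_shift y r : ~ eqlv s y z -> beta (shift s.+1 r y) = beta y.
  move=> /existsNP[k /not_implyP[kN]]; case/andP: (kN) => k1 ks.
  rewrite z_eq0// => /eqP yk.
  (* Coordinate s + 1 of y receives y k * (r / y k) = r, while z is fixed since z k = 0. The sign is
     negative because [Ract] applies the inverse matrix. *)
  pose t := rowmx k s.+2 (fun j => - (j == s.+1)%:R * (r / y k)).
  have ty : Ract t y = shift s.+1 r y.
    apply: X1_eqP => n n1; rewrite Ract_rowmx shiftE// mulNr mulrN mulrN opprK.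
    congr (_ + _); have [->|_] := eqVneq n s.+1; last by rewrite !mul0r !mulr0.
    by rewrite ltnS ks ltnSn !mul1r mulrCA mulfV// mulr1.
  have tz : Ract t z = z.
    apply: X1_eqP => n n1; rewrite Ract_rowmx (z_eq0 k k1).
    by rewrite mul0r mulr0 subr0.
  rewrite /beta -ty -xi_act; congr (_ * _).
  by rewrite -[in LHS](_ : T t v = v) ?T_ip// /v -B_T xi_act tz.
have Bz : B (difference_xi s z) =
    \sum_(r : 'F_p) beta (shift s.+1 r z) *: difference_xi s (shift s.+1 r z).
  (* w is fixed by U k for every k > s + 1, hence equals E s.+1 w, and it is orthogonal to all
     vectors of level s + 1, hence it vanishes. *)
  apply/eqP; rewrite -subr_eq0; apply/eqP; set w := _ - _.
  have w_fix k : (s.+1 < k)%N -> U k w = w.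
    move=> sk; have dU x : U k (difference_xi s x) = difference_xi s x.
      by rewrite /difference_xi linear_opB// linear_opZ// !U_xi_fix// (ltnW sk).
    rewrite /w linear_opB// -B_T dU; congr (_ - _).
    rewrite linear_op_sum//; apply: eq_bigr => r _.
    by rewrite linear_opZ// dU.
  have ipw y : ip w (xi s.+1 y) = 0.
    apply/eqP; rewrite /w linearBl/= subr_eq0; apply/eqP.
    have ipd x : ip (difference_xi s x) (xi s.+1 y) = P ^- s.+1 *
        ((`[< eqlv s.+1 x y >] : bool)%:R - P^-1 * (`[< eqlv s x y >] : bool)%:R).
      rewrite /difference_xi linearBl/= linearZl_LR/=.
      have -> : ip (xi s x) (xi s.+1 y) =
          P ^- s.+1 * (`[< eqlv s x y >] : bool)%:R.
        rewrite hermC/= expr0 mul1r -{1}[s.+1]addn1 xi_ip addn1.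
        case: asboolP => yx; case: asboolP => xy; last by rewrite rmorph0 mulr0.
        - by rewrite mulr1 fmorphV rmorphXn/= rmorph_nat.
        - by case: xy; exact: eqlv_sym.
        - by case: yx; exact: eqlv_sym.
      rewrite -{1}[s.+1]addn0 xi_ip addn0 mulrBr mulrCA; congr (_ - _).
      by case: asboolP; rewrite ?mulr1 ?mulr0.
    have Bsz : B (xi s z) = \sum_(r : 'F_p) iter r (U s.+1) v.
      rewrite xi_split linear_op_sum//; apply: eq_bigr => r _.
      by rewrite -iter_U_xi// B_iterT.
    have iter_ip (n : nat) u u' :
        ip (iter n (U s.+1) u) (iter n (U s.+1) u') = ip u u'.
      by elim: n => //= n IH; rewrite T_ip.
    have ipU r : ip (iter (r : 'F_p) (U s.+1) v) (xi s.+1 y) =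
        P ^- s.+1 * beta (shift s.+1 (- r) y).
      have <- : iter r (U s.+1) (xi s.+1 (shift s.+1 (- r) y)) = xi s.+1 y.
        by rewrite iter_U_xi// shiftD addrN shift0.
      by rewrite iter_ip /beta mulrA mulVf ?mul1r// expf_neq0.
    have -> : ip (B (difference_xi s z)) (xi s.+1 y) = P ^- s.+1 *
        (beta y - P^-1 * \sum_(r : 'F_p) beta (shift s.+1 (- r) y)).
      rewrite /difference_xi linear_opB// linear_opZ// Bsz linearBl/= linearZl_LR/=.
      rewrite linear_sumlz/= mulrBr [P ^- s.+1 * (P^-1 * _)]mulrCA; congr (_ - _).
        by rewrite /beta mulrA mulVf ?mul1r// expf_neq0.
      by congr (_ * _); rewrite mulr_sumr; apply: eq_bigr => r _; exact: ipU.
    rewrite linear_sumlz/=.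
    under [RHS]eq_bigr => r _ do rewrite linearZl_LR/= ipd mulrCA.
    rewrite -[RHS]mulr_sumr; congr (_ * _).
    (* Off the level-s cylinder of z, beta equals its average over the last coordinate, so the left
       side vanishes together with every term on the right. On that cylinder y is a shift of z, and
       only r = y s.+1 contributes to the first sum. *)
    have [yz|yz] := pselect (eqlv s y z); last first.
      under eq_bigr do rewrite beta_shift//.
      rewrite sumr_const card_Fp// -[beta y *+ p]mulr_natl mulrA mulVf// mul1r subrr.
      rewrite big1// => r _; rewrite (_ : `[< eqlv s _ y >] = false); last first.
        apply/asboolP => sy; apply: yz; apply: eqlv_sym.
        by apply: eqlv_trans sy; apply: eqlv_sym; exact: eqlv_shift.
      rewrite mulr0 subr0 (_ : `[< _ >] = false) ?mulr0//.
      apply/asboolP => sy; apply: yz; apply: eqlv_sym.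
      apply: eqlv_trans (eqlv_le _ _ _ _ (leqnSn s) sy).
      by apply: eqlv_sym; exact: eqlv_shift.
    have yE : eqlv s.+1 y (shift s.+1 (y s.+1) z).
      move=> k /andP[k1]; rewrite shiftE// z_eq0// add0r leq_eqVlt => /orP[/eqP->|ks].
        by rewrite eqxx mul1r.
      by rewrite (ltn_eqF ks) mul0r yz ?z_eq0// k1.
    have syz r : `[< eqlv s (shift s.+1 r z) y >].
      apply/asboolP; apply: eqlv_trans (eqlv_sym _ _ _ yz); exact: eqlv_shift.
    under [RHS]eq_bigr do rewrite syz mulr1 mulrBr.
    rewrite sumrB; congr (_ - _).
      rewrite (bigD1 (y s.+1))//= asboolT ?mulr1; last exact: eqlv_sym.
      rewrite -(beta_ext _ _ yE) big1 ?addr0// => r ry.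
      rewrite (_ : `[< _ >] = false) ?mulr0//; apply/asboolP => sy.
      have := sy s.+1 (leqnn _); rewrite shiftE// z_eq0// eqxx add0r mul1r => /eqP.
      by rewrite (negbTE ry).
    rewrite -mulr_suml mulrC; congr (_ * _).
    rewrite [RHS](reindex_inj (h := fun r => y s.+1 - r)) /=; last first.
      by move=> r r' /addrI /oppr_inj.
    apply: eq_bigr => r _; apply: beta_ext => k ks.
    have k1 : (1 <= k)%N by case/andP: ks.
    by rewrite (shiftE _ _ _ _ k1) (yE k ks) !shiftE// mulrDr addrA.
  have := E_fix s.+1 w w_fix => <-; rewrite /E big1// => a _.
  by rewrite ipw scale0r scaler0.
exists (fun r => beta (shift s.+1 r z)) => x.
(* First-row matrices are transitive on cylinders of level s + 1: this one carries z into the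
   cylinder of x, and T t transports the formula. *)
pose t := rowmx 0 s.+2 (fun j => - x j).
have tz : eqlv s.+1 (Ract t z) x.
  move=> k /andP[k1 ks]; rewrite Ract_rowmx z_eq0// k1 ltnS ks row1_0 !mul1r.
  by rewrite add0r opprK.
rewrite -(difference_xi_ext _ _ _ tz) -T_difference_xi B_T Bz linear_op_sum//.
apply: eq_bigr => r _; rewrite linear_opZ// T_difference_xi; congr (_ *: _).
apply: difference_xi_ext => k ks; rewrite (eqlv_Ract_shift s.+1 r t z)//.
by have k1 : (1 <= k)%N; [case/andP: ks|rewrite !shiftE// tz].
Qed.

Lemma commutant_E s : exists beta : 'F_p -> C, forall u,
  B (E s.+1 u) = B (E s u) + \sum_(r : 'F_p) beta r *: (Delta s.+1 r u - E s u).
Proof.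
have [beta bE] := commutant_difference_xi s; exists beta.
have bD r : bounded_op ip (fun u => Delta s.+1 r u - E s u).
  rewrite [X in bounded_op _ X](_ : _ = fun u => -1 *: E s u + Delta s.+1 r u).
    by apply: bounded_lin; [exact: E_bounded|exact: Delta_bounded].
  by apply/funext => u; rewrite scaleN1r addrC.
have bBE n : bounded_op ip (B \o E n).
  by apply: bounded_comp => //; exact: E_bounded.
apply/funeqP; apply: (total_eq ip _ _ _ (xi_total_from s.+1)).
- exact: bBE.
- rewrite [X in bounded_op _ X](_ : _ = fun u => 1 *: (B \o E s) u +
    \sum_(r : 'F_p) beta r *: (Delta s.+1 r u - E s u)).
    by apply: bounded_lin => //; exact: bounded_sum.
  by apply/funext => u; rewrite scale1r.
- move=> _ [d [x ->]]; have Es : E s (xi (s.+1 + d) x) = P ^- d *: (P^-1 *: xi s x).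
    by rewrite addSnnS E_xi exprS invfM scalerA mulrC.
  rewrite Es E_xi !(linear_opZ B B_lin).
  under eq_bigr => r _ do rewrite Delta_xi// -scalerBr scalerA mulrC -scalerA.
  rewrite -scaler_sumr -(linear_opZ B B_lin P^-1) -scalerDr; congr (_ *: _).
  rewrite -[in LHS](subrK (P^-1 *: xi s x) (xi s.+1 x)) (linear_opD B B_lin) addrC.
  congr (_ + _); rewrite -/(difference_xi s x) bE; apply: eq_bigr => r _.
  congr (_ *: _); rewrite /difference_xi; congr (_ - _ *: _).
  by apply: xi_ext; exact: eqlv_shift.
Qed.

End commutant_element.

Definition Deltas : set (H -> H) := [set D | exists (s : nat) (r : 'F_p),
  [/\ (1 <= s)%N, r != 0 & D = Delta s r]].

Local Notation SC := (strong_closure ip (linear_span ([set id] `|` Deltas))).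

(* The relation [P *: E s = E s.+1 + \sum_(r | r != 0) Delta s.+1 r] iterated
   n times, with [E (s + n)] replaced by the identity at the last step. *)
Lemma span_approx_E n s : linear_span ([set id] `|` Deltas)
  (fun u => P ^- n *: (u - E (s + n) u) + E s u).
Proof.
elim: n s => [|n IH] s.
  rewrite [X in linear_span _ X](_ : _ = id).
    by apply: linear_span_sub; left.
  by apply/funext => u; rewrite expr0 invr1 scale1r addn0 subrK.
have sumD (rs : seq 'F_p) A : linear_span ([set id] `|` Deltas) A ->
    linear_span ([set id] `|` Deltas)
      (fun u => A u + \sum_(r <- rs | r != 0) Delta s.+1 r u).
  elim: rs A => [|r rs IHrs] A SA.
    rewrite [X in linear_span _ X](_ : _ = A)//.
    by apply/funext => u; rewrite big_nil addr0.
  have [r0|r0] := boolP (r != 0); last first.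
    rewrite [X in linear_span _ X](_ : _ =
      fun u => A u + \sum_(r <- rs | r != 0) Delta s.+1 r u); first exact: IHrs.
    by apply/funext => u; rewrite big_cons (negbTE r0).
  rewrite [X in linear_span _ X](_ : _ = fun u => (1 *: A u + Delta s.+1 r u) +
      \sum_(r <- rs | r != 0) Delta s.+1 r u).
    apply: (IHrs (fun u => 1 *: A u + Delta s.+1 r u)).
    by apply: linear_span_lin => //; apply: linear_span_sub; right; exists s.+1, r.
  by apply/funext => u; rewrite big_cons r0 scale1r addrA.
(* Spans are combined in the form a A + B, so P^-1 A is written as (P^-1 - 1) A + A. *)
have := linear_span_lin _ (P^-1 - 1) _ _ (sumD (index_enum _) _ (IH s.+1))
  (sumD (index_enum _) _ (IH s.+1)).
rewrite [X in linear_span _ X -> _](_ : _ =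
  (fun u => P ^- n.+1 *: (u - E (s + n.+1) u) + E s u))//.
apply/funext => u; rewrite -[X in _ + X]scale1r -scalerDl subrK -addrA.
have -> : E s.+1 u + \sum_(r : 'F_p | r != 0) Delta s.+1 r u = P *: E s u.
  by rewrite E_Delta [RHS](bigD1 0).
by rewrite scalerDr !scalerA mulVf// scale1r -invfM -exprS addSnnS.
Qed.

Lemma strong_closure_E s : SC (E s).
Proof.
apply: (strong_closure_limit ip _
    (fun n u => P ^- n *: (u - E (s + n) u) + E s u)).
  by move=> n; apply: sub_strong_closure; exact: span_approx_E.
move=> u eps e0; have h : tends ip (fun n => E (s + n) u) u.
  move=> d d0; have [N _ hN] := E_tends u d d0.
  by exists N => // n /= Nn; apply: hN; exact: leq_trans Nn (leq_addl s n).
(* The error is P ^- n times u - E (s + n) u. The bound P ^- n <= 1 suffices, as the vector itself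
   tends to 0. *)
apply: filterS (h eps e0) => n hn; rewrite addrK hnrmZ.
rewrite hnrm_distC; apply: le_lt_trans hn; rewrite ler_piMl ?hnrm_ge0//.
rewrite ger0_norm ?invr_ge0 ?exprn_ge0 ?ler0n// invf_le1 ?exprn_gt0//.
by rewrite exprn_ege1// ler1n prime_gt0.
Qed.

Lemma strong_closure_Delta s (r : 'F_p) : (1 <= s)%N -> SC (Delta s r).
Proof.
move=> s1; have [->|r0] := eqVneq r 0; first exact: strong_closure_E.
by apply: sub_strong_closure; apply: linear_span_sub; right; exists s, r.
Qed.

Lemma strong_closure_scale a A : SC A -> SC (fun u => a *: A u).
Proof.
move=> SA; rewrite [X in SC X](_ : _ = fun u => (a - 1) *: A u + A u).
  exact: strong_closure_lin.
by apply/funext => u; rewrite scalerBl scale1r subrK.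
Qed.

Lemma strong_closure_sum (rs : seq 'F_p) (c : 'F_p -> C) (F : 'F_p -> H -> H) A :
  SC A -> (forall r, SC (F r)) ->
  SC (fun u => A u + \sum_(r <- rs) c r *: F r u).
Proof.
move=> SA SF; elim: rs => [|r rs IH].
  rewrite [X in SC X](_ : _ = A)//.
  by apply/funext => u; rewrite big_nil addr0.
rewrite [X in SC X](_ : _ = fun u => c r *: F r u +
    (A u + \sum_(r <- rs) c r *: F r u)); first exact: strong_closure_lin.
by apply/funext => u; rewrite big_cons addrCA.
Qed.

(** B is the strong limit of B \o E n, and [commutant_E] obtains each of these from the previous one
    by adding finitely many multiples of Delta and E. *)
Lemma commutant_strong_closure B : commutant ip (range T) B -> SC B.
Proof.
move=> BT; have bB : bounded_op ip B by case: BT.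
apply: (strong_closure_limit ip _ (fun n => B \o E n)); last first.
  by move=> u; apply: tends_bounded => //; exact: E_tends.
elim=> [|n IH].
  have [c cE] := commutant_E0 _ BT.
  rewrite [X in SC X](_ : _ = fun u => c *: E 0 u).
    by apply: strong_closure_scale; exact: strong_closure_E.
  by apply/funext => u; exact: cE.
have [beta bE] := commutant_E _ BT n.
rewrite [X in SC X](_ : _ = fun u => (B \o E n) u +
  \sum_(r : 'F_p) beta r *: (Delta n.+1 r u - E n u)).
  apply: (strong_closure_sum _ _ (fun r u => Delta n.+1 r u - E n u)) => // r.
  rewrite [X in SC X](_ : _ = fun u => -1 *: E n u + Delta n.+1 r u).
    apply: strong_closure_lin; first exact: strong_closure_E.
    exact: strong_closure_Delta.
  by apply/funext => u; rewrite scaleN1r addrC.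
by apply/funext => u; exact: bE.
Qed.

(** Once T t is moved across the inner product, commuting with it is an equality of two matrix
    coefficients, which survives weak limits. *)
Lemma weak_closure_commutant :
  weak_closure ip (linear_span ([set id] `|` Deltas)) `<=` commutant ip (range T).
Proof.
move=> B [bB SB]; split => // _ [t _ <-]; have lB : linear B by case: bB.
apply/funext => u /=; apply: (subr0_eq _); apply: (hnrm_small ip) => eps e0.
have TV v w : ip (T t v) w = ip v (T t^-1%g w).
  by rewrite -[in LHS](T_one w) -(mulgV t) T_mul T_ip.
have spanT A : linear_span ([set id] `|` Deltas) A -> forall v, A (T t v) = T t (A v).
  move=> [n [c [F [SF ->]]]] v; rewrite linear_op_sum//; apply: eq_bigr => i _.
  rewrite linear_opZ//; case: (SF i) => [->//|[s [r [s1 _ ->]]]].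
  have [_ /(_ (T t) (ex_intro2 _ _ t I erefl)) e] := Delta_commutant s r s1.
  by congr (_ *: _); exact: (congr1 (fun f : H -> H => f v) e).
have small (d : C) (w : H) : 0 < d -> `|ip (B (T t u) - T t (B u)) w| < d + d.
  move=> d0; have [A SA h] := SB [:: (T t u, w); (u, T t^-1%g w)] d d0.
  have h1 := h (T t u, w); have h2 := h (u, T t^-1%g w).
  rewrite linearBl/= TV.
  have -> : ip (B (T t u)) w - ip (B u) (T t^-1%g w) =
     (ip (A u) (T t^-1%g w) - ip (B u) (T t^-1%g w)) -
     (ip (A (T t u)) w - ip (B (T t u)) w).
    by rewrite (spanT A SA) TV opprB [RHS]addrC addrA subrK.
  apply: le_lt_trans (ler_normB _ _) _; apply: ltrD.
    by apply: h2; rewrite !inE eqxx orbT.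
  by apply: h1; rewrite !inE eqxx.
(* Testing the commutator against itself turns the weak estimate into one on its norm. *)
set w := B (T t u) - T t (B u); have e2 : 0 < eps ^+ 2 / 2.
  by rewrite divr_gt0 ?exprn_gt0.
have := small _ w e2; rewrite -splitr -hnrm_sqr ger0_norm ?exprn_ge0 ?hnrm_ge0//.
by rewrite ltr_pXn2r ?nnegrE ?hnrm_ge0 ?ltW.
Qed.

Theorem commutant_representation :
  [/\ forall (s : nat) (r : 'F_p), (1 <= s)%N -> r != 0 ->
        strong_limit ip (fun N => iter r (U s) \o average_product s N) (Delta s r),
      commutant ip (range T) =
        weak_closure ip (linear_span ([set id] `|` Deltas)) &
      commutant ip (range T) = bicommutant ip Deltas].
Proof.
split; first by move=> s r _ _; exact: Delta_strong_limit.
  apply/seteqP; split; last exact: weak_closure_commutant.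
  move=> B BT; apply: strong_closure_weak; first by case: BT.
  exact: commutant_strong_closure.
apply/seteqP; split=> B; last first.
  move=> [bB BD]; split => // _ [t _ <-]; apply: BD; split=> // _ [s [r [s1 _ ->]]].
  by have [_ /(_ (T t) (ex_intro2 _ _ t I erefl)) e] := Delta_commutant s r s1.
move=> BT; have [bB _] := BT; split => // A [bA AD].
apply/funext => u /=; apply: (subr0_eq _); apply: (hnrm_small ip) => eps e0.
have [lA [M M0 AM]] := bounded_opP _ _ bA; have [lB _] := bB.
have e2 : 0 < eps / 2 by rewrite divr_gt0.
have M1 : 0 < M + 1 by rewrite addr_gt0.
have e3 : 0 < eps / 2 / (M + 1) by rewrite divr_gt0.
have M2 : eps / 2 / (M + 1) <= eps / 2.
  by rewrite ler_piMr ?(ltW e2)// invf_le1// lerDr (ltW M0).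
(* D commutes with A. With B approximated at both u and A u, the commutator of B and A at u is a sum
   of two small errors, one of them amplified by the bound M of A; hence the factor M + 1. *)
have [D SD h] := commutant_strong_closure B BT [:: u; A u] _ e3.
have DA v : D (A v) = A (D v).
  have [n [c [F [SF ->]]]] := SD; rewrite linear_op_sum//; apply: eq_bigr => i _.
  rewrite linear_opZ//; case: (SF i) => [->//|SFi]; congr (_ *: _).
  by have e := AD _ SFi; exact: (congr1 (fun f : H -> H => f v) (esym e)).
have -> : B (A u) - A (B u) = A (D u - B u) - (D (A u) - B (A u)).
  by rewrite linear_opB// DA opprB [RHS]addrC addrA subrK.
apply: le_lt_trans (hnrmD _ _ _) _; rewrite hnrmN (splitr eps) ler_ltD//.
  apply: le_trans (AM _) _; have hu : nrm (D u - B u) < eps / 2 / (M + 1).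
    by apply: h; rewrite !inE eqxx.
  rewrite (le_trans _ (_ : (M + 1) * nrm (D u - B u) <= _))//.
    by rewrite ler_wpM2r ?hnrm_ge0// lerDl.
  by rewrite mulrC -ler_pdivlMr// ltW.
by apply: lt_le_trans M2; apply: h; rewrite !inE eqxx orbT.
Qed.

End cylinder_vector_family.

(** * Cylinder sets and cylinder functions *)

Section cylinder_sets.
Context {p : nat}.
Implicit Types (x y : X1 p) (A B C : set (X1 p)).

Definition cyl (N : nat) x : set (X1 p) := [set y | eqlv N x y].

Lemma measurable_cyl N x : measurable (cyl N x).
Proof.
rewrite (_ : cyl N x =
  \bigcap_(k in [set: 'I_N]) [set y : X1 p | y k.+1 = x k.+1]).
  by apply: fin_bigcap_measurable => // k _; exact: measurable_coord.
apply/seteqP; split=> [y xy k _|y xy [//|k] /= kN]; first by rewrite /= xy/=.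
exact/esym/(xy (Ordinal kN) I).
Qed.

Definition cylinder_set N C := forall x y, eqlv N x y -> C x -> C y.

Lemma eqlv_row_of_ffun N x : eqlv N (row_of_ffun N (ffun_of_row N x)) x.
Proof. by apply: eqlv_sym; apply/row_of_ffunP. Qed.

Lemma cylinder_set_bigcup N C : cylinder_set N C ->
  C = \bigcup_(a in [set a | C (row_of_ffun N a)]) cyl N (row_of_ffun N a).
Proof.
move=> NC; apply/seteqP; split=> [x Cx|x [a /= Ca xa]]; last exact: NC xa Ca.
exists (ffun_of_row N x) => /=; last exact: eqlv_row_of_ffun.
by apply: NC Cx; apply: eqlv_sym; exact: eqlv_row_of_ffun.
Qed.

Lemma measurable_cylinder_set N C : cylinder_set N C -> measurable C.
Proof.
move=> /cylinder_set_bigcup->; apply: fin_bigcup_measurable => // a _.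
exact: measurable_cyl.
Qed.

Lemma cylinder_set_le N M C : (N <= M)%N -> cylinder_set N C -> cylinder_set M C.
Proof. by move=> NM NC x y /(eqlv_le _ _ _ _ NM); exact: NC. Qed.

Lemma cylinder_setC N C : cylinder_set N C -> cylinder_set N (~` C).
Proof. by move=> NC x y xy nCx Cy; apply: nCx; apply: NC Cy; exact: eqlv_sym. Qed.

Lemma cylinder_setU N C C' :
  cylinder_set N C -> cylinder_set N C' -> cylinder_set N (C `|` C').
Proof. by move=> NC NC' x y xy [/(NC _ _ xy)|/(NC' _ _ xy)]; [left|right]. Qed.

Lemma trivIset_cyl N (D : set {ffun 'I_N -> 'F_p}) :
  trivIset D (fun a => cyl N (row_of_ffun N a)).
Proof.
move=> a b _ _ [x [/eqlv_sym/row_of_ffunP-> /eqlv_sym/row_of_ffunP->]].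
by [].
Qed.

Context {R : realType}.
Local Open Scope ereal_scope.

Lemma measure_cylinder_set (nu : {measure set (X1 p) -> \bar R}) N C :
  cylinder_set N C ->
  nu C = \sum_(a | `[< C (row_of_ffun N a) >]) nu (cyl N (row_of_ffun N a)).
Proof.
move=> NC; rewrite {1}(cylinder_set_bigcup _ _ NC) measure_fin_bigcup//.
- rewrite (@fsbigE _ _ _ _ _ [seq a <- index_enum _ | `[< C (row_of_ffun N a) >]]).
  + rewrite big_filter_cond; apply: eq_bigl => a; apply: andb_idr => /asboolP Ca.
    by rewrite inE.
  + by rewrite filter_uniq// index_enum_uniq.
  + by move=> a /=; rewrite mem_filter => /andP[/asboolP].
  + by move=> a /= Ca; rewrite mem_filter mem_index_enum andbT; case: asboolP.
- exact: finite_finset.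
- exact: trivIset_cyl.
- by move=> a _; exact: measurable_cyl.
Qed.

Lemma measure_le_union (nu : {measure set (X1 p) -> \bar R}) A B C :
  measurable A -> measurable B -> measurable C -> A `<=` B `|` C ->
  nu A <= nu B + nu C.
Proof.
move=> mA mB mC ABC.
rewrite (le_trans (le_measure nu _ _ ABC)) ?inE//; first exact: measurableU.
exact: measureU2.
Qed.

Section approximation.
Variables (nu : {measure set (X1 p) -> \bar R}) (nu_fin : nu setT < +oo).

(** These sets form a sigma-algebra containing the generating cylinders, hence exhaust the
    measurable sets. Finiteness of nu gives continuity from above, which reduces countable unions to
    finite ones. *)
Let approximable : set (set (X1 p)) := [set A | measurable A /\
  forall eps : R, (0 < eps)%R -> exists N C, cylinder_set N C /\ nu (A `+` C) < eps%:E].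

Let approximableU A B : approximable A -> approximable B -> approximable (A `|` B).
Proof.
move=> [mA hA] [mB hB]; split; first exact: measurableU.
move=> eps e0; have e2 : (0 < eps / 2)%R by rewrite divr_gt0.
have [N [C [NC hC]]] := hA _ e2; have [M [D [MD hD]]] := hB _ e2.
exists (maxn N M), (C `|` D).
have mC := measurable_cylinder_set _ _ NC.
have mD := measurable_cylinder_set _ _ MD; split.
  by apply: cylinder_setU; [apply: cylinder_set_le NC; exact: leq_maxl|
    apply: cylinder_set_le MD; exact: leq_maxr].
rewrite (splitr eps) EFinD; apply: le_lt_trans (lteD hC hD).
apply: measure_le_union.
- by apply: measurableU; apply: measurableD; exact: measurableU.
- by apply: measurableU; exact: measurableD.
- by apply: measurableU; exact: measurableD.
- move=> x; rewrite /setY/= => -[[[?|?] /not_orP[? ?]]|[[?|?] /not_orP[? ?]]].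
  + by left; left.
  + by right; left.
  + by left; right.
  + by right; right.
Qed.

Let approximable_bigcup (A_ : nat -> set (X1 p)) :
  (forall n, approximable (A_ n)) -> approximable (\bigcup_k A_ k).
Proof.
move=> hA; have mA_ n : measurable (A_ n) by case: (hA n).
have mA : measurable (\bigcup_k A_ k) by exact: bigcup_measurable.
split => // eps e0; have e2 : (0 < eps / 2)%R by rewrite divr_gt0.
pose B n := \bigcup_(i in `I_n) A_ i.
have aB n : approximable (B n).
  elim: n => [|n IH].
    rewrite /B II0 bigcup_set0; split => // d d0; exists 0%N, set0.
    by split => //; rewrite setYK measure0 lte_fin.
  rewrite (_ : B n.+1 = B n `|` A_ n); first exact: approximableU.
  apply/seteqP; split=> [x [k /=]|x [[k /= kn xk]|xn]].
  - by rewrite ltnS leq_eqVlt => /orP[/eqP->|kn xk]; [right|left; exists k].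
  - by exists k => //=; exact: ltnW.
  - by exists n => /=.
have mB n : measurable (B n) by case: (aB n).
have h : nu \o (fun n => (\bigcup_k A_ k) `\` B n) @ \oo --> 0.
  rewrite -(measure0 nu).
  have -> : set0 = \bigcap_n ((\bigcup_k A_ k) `\` B n).
    apply/esym/seteqP; split=> // x h; have [[k _ xk] _] := h 0%N I.
    have [_ ] := h k.+1 I; apply.
    by exists k => /=.
  apply: nonincreasing_cvg_mu.
  - apply: le_lt_trans nu_fin; apply: le_measure; rewrite ?inE//.
    exact: measurableD.
  - by move=> n; exact: measurableD.
  - by apply: bigcap_measurable => // n _; exact: measurableD.
  - move=> n m nm; apply/subsetPset => x [Ax Bx]; split=> // -[k /= kn Ak].
    by apply: Bx; exists k => //=; exact: leq_trans nm.
have : \forall n \near \oo, nu ((\bigcup_k A_ k) `\` B n) < (eps / 2)%:E.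
  have /h : nbhs (0 : \bar R) [set y | y < (eps / 2)%:E].
    by apply: open_nbhs_nbhs; split; [exact: open_ereal_lt_ereal|rewrite /= lte_fin].
  by [].
move=> /filter_ex[n hn]; have [_ /(_ _ e2)[N [C [NC hC]]]] := aB n.
exists N, C; split => //; have mC := measurable_cylinder_set _ _ NC.
rewrite (splitr eps) EFinD; apply: le_lt_trans (lteD hn hC).
apply: measure_le_union.
+ by apply: measurableU; exact: measurableD.
+ exact: measurableD.
+ by apply: measurableU; exact: measurableD.
+ move=> x [[Ax Cx]|[Cx Ax]].
    by have [Bx|Bx] := pselect (B n x); [right; left|left].
  right; right; split => // Bx; apply: Ax.
  by case: Bx => [k _ Ak]; exists k.
Qed.

Lemma cylinder_set_approx A : measurable A -> forall eps : R, (0 < eps)%R ->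
  exists N C, cylinder_set N C /\ nu (A `+` C) < eps%:E.
Proof.
move: A; suff : (@measurable _ (X1 p)) `<=` approximable by move=> h A /h[].
apply: smallest_sub; last first.
  move=> _ [n [r ->]]; split; first exact: measurable_coord.
  move=> eps e0; exists n, [set x : X1 p | x n = r].
  split; last by rewrite setYK measure0 lte_fin.
  case: n => [|n] x y xy /=; first by rewrite !row1_0.
  by rewrite xy//= leqnn.
split.
- split => // eps e0; exists 0%N, set0.
  by split => //; rewrite setYK measure0 lte_fin.
- move=> A [mA hA]; split; first by rewrite setTD; exact: measurableC.
  move=> eps /hA[N [C [NC hC]]]; exists N, (~` C); split; first exact: cylinder_setC.
  rewrite setTD (_ : ~` A `+` ~` C = A `+` C)//.
  rewrite /setY; apply/seteqP; split=> x /=.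
    by move=> [[? /contrapT ?]|[? /contrapT ?]]; [right|left].
  by move=> [[? ?]|[? ?]]; [right|left]; split => //; apply.
- exact: approximable_bigcup.
Qed.

End approximation.

(** One cylinder set C approximates A for nu1 + nu2. Levels from N0 on suffice, because C is also a
    cylinder set of every higher level. The tolerance eps / (K + 1) absorbs the error nu1 + K nu2 on
    the symmetric difference. *)
Lemma measure_le_cyl (nu1 nu2 : {measure set (X1 p) -> \bar R}) (K : R) N0 :
  (0 <= K)%R -> nu1 setT < +oo -> nu2 setT < +oo ->
  (forall N x, (N0 <= N)%N -> nu1 (cyl N x) <= K%:E * nu2 (cyl N x)) ->
  forall A, measurable A -> nu1 A <= K%:E * nu2 A.
Proof.
move=> K0 fin1 fin2 h A mA; apply/lee_addgt0Pr => eps e0.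
have K1 : (0 < K + 1)%R by rewrite ltr_wpDl.
have e1 : (0 < eps / (K + 1))%R by rewrite divr_gt0.
have fin12 : measure_add nu1 nu2 setT < +oo by rewrite measure_addE lte_add_pinfty.
have [N [C [NC hC']]] := cylinder_set_approx _ fin12 A mA _ e1.
have hC : nu1 (A `+` C) + nu2 (A `+` C) < (eps / (K + 1))%:E.
  by rewrite -(measure_addE nu1 nu2).
have mC := measurable_cylinder_set _ _ NC.
have mAC : measurable (A `+` C) by apply: measurableU; exact: measurableD.
have h1 : nu1 (A `+` C) + K%:E * nu2 (A `+` C) <= eps%:E.
  have -> : eps = ((K + 1) * (eps / (K + 1)))%R by rewrite mulrC divfK ?gt_eqF.
  rewrite EFinM (@le_trans _ _ ((K + 1)%:E * (nu1 (A `+` C) + nu2 (A `+` C))))//.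
    rewrite ge0_muleDr// leeD//.
      by rewrite -[leLHS]mul1e lee_wpmul2r// lee_fin lerDr.
    by rewrite lee_wpmul2r// lee_fin lerDl.
  by apply: lee_wpmul2l; [rewrite lee_fin ltW|exact: ltW].
have h2 : nu1 C <= K%:E * nu2 C.
  have NC' := cylinder_set_le _ (maxn N N0) _ (leq_maxl _ _) NC.
  rewrite !(measure_cylinder_set _ _ _ NC') ge0_sume_distrr//.
  by apply: lee_sum => a _; apply: h; exact: leq_maxr.
have h3 : nu1 A <= nu1 C + nu1 (A `+` C).
  apply: measure_le_union => // x Ax.
  by have [Cx|Cx] := pselect (C x); [left|right; left].
have h4 : nu2 C <= nu2 A + nu2 (A `+` C).
  apply: measure_le_union => // x Cx.
  by have [Ax|Ax] := pselect (A x); [left|right; right].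
apply: (le_trans h3); apply: (le_trans (leeD h2 (lexx _))).
rewrite (le_trans (leeD (lee_wpmul2l _ h4) (lexx _))) ?lee_fin//.
by rewrite ge0_muleDr// -addeA leeD// addeC.
Qed.

Lemma measure_eq_cyl (nu1 nu2 : {measure set (X1 p) -> \bar R}) N0 :
  nu1 setT < +oo -> nu2 setT < +oo ->
  (forall N x, (N0 <= N)%N -> nu1 (cyl N x) = nu2 (cyl N x)) ->
  forall A, measurable A -> nu1 A = nu2 A.
Proof.
move=> fin1 fin2 h A mA; apply/eqP; rewrite eq_le -[leRHS]mul1e.
rewrite -[X in _ && (_ <= X)]mul1e; apply/andP; split;
  by apply: (measure_le_cyl _ _ _ N0) => // N x Nx; rewrite mul1e h.
Qed.

End cylinder_sets.

(** * Square-integrable functions and their approximation by cylinder functions *)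

Section square_integrals.
Context {d : measure_display} {T : measurableType d} {R : realType}.
Variable nu : {measure set T -> \bar R}.
Implicit Types f g : T -> R.
Local Open Scope ereal_scope.

Definition sqint f := \int[nu]_x (f x ^+ 2)%:E.

Lemma measurable_sq f : measurable_fun setT f ->
  measurable_fun setT (fun x => (f x ^+ 2)%:E).
Proof. by move=> mf; apply/measurable_EFinP; exact: measurable_funX. Qed.

Lemma sqint_ge0 f : 0 <= sqint f.
Proof. by apply: integral_ge0 => x _; rewrite lee_fin sqr_ge0. Qed.

Lemma sqintZ f (c : R) : measurable_fun setT f ->
  sqint (fun x => c * f x)%R = (c ^+ 2)%:E * sqint f.
Proof.
move=> mf; rewrite /sqint -ge0_integralZl_EFin ?sqr_ge0//.
- by apply: eq_integral => x _; rewrite exprMn EFinM.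
- by move=> x _; rewrite lee_fin sqr_ge0.
- exact: measurable_sq.
Qed.

Lemma sqintD f g : measurable_fun setT f -> measurable_fun setT g ->
  sqint (fun x => f x + g x)%R <= 2%:E * (sqint f + sqint g).
Proof.
move=> mf mg; have [m2f m2g] := (measurable_sq _ mf, measurable_sq _ mg).
have f0 x : [set: T] x -> 0 <= (f x ^+ 2)%:E by rewrite lee_fin sqr_ge0.
have g0 x : [set: T] x -> 0 <= (g x ^+ 2)%:E by rewrite lee_fin sqr_ge0.
rewrite /sqint -ge0_integralD// -ge0_integralZl_EFin//; last 2 first.
- by move=> x _; rewrite adde_ge0 ?f0 ?g0.
- exact: emeasurable_funD.
apply: ge0_le_integral => //.
- by move=> x _; rewrite lee_fin sqr_ge0.
- by apply: measurable_sq; exact: measurable_funD.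
- by apply: measurable_funeM; exact: emeasurable_funD.
- move=> x _; rewrite -EFinD -EFinM lee_fin -subr_ge0.
  by rewrite (_ : _ - _ = (f x - g x) ^+ 2)%R ?sqr_ge0//; ring.
Qed.

End square_integrals.

Section cylinder_functions.
Import HBNNSimple.
Context {p : nat} {R : realType} (nu : {measure set (X1 p) -> \bar R}).
Implicit Types f g : X1 p -> R.
Local Open Scope ereal_scope.

Definition cylinder_fun {U : Type} N (g : X1 p -> U) := forall x y, eqlv N x y -> g x = g y.

Lemma cylinder_fun_le {U : Type} N M (g : X1 p -> U) :
  (N <= M)%N -> cylinder_fun N g -> cylinder_fun M g.
Proof. by move=> NM Ng x y /(eqlv_le _ _ _ _ NM); exact: Ng. Qed.

Lemma measurable_cylinder_fun N g : cylinder_fun N g -> measurable_fun setT g.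
Proof.
move=> Ng _ Y mY; rewrite setTI; apply: (measurable_cylinder_set N).
by move=> x y xy /=; rewrite (Ng x y xy).
Qed.

Hypothesis nu_fin : nu setT < +oo.

Let approximable : set (X1 p -> R) := [set f : X1 p -> R | measurable_fun setT f /\
  forall eps : R, (0 < eps)%R ->
  exists N g, cylinder_fun N g /\ sqint nu (fun x => f x - g x)%R < eps%:E].

Let approximable0 : approximable (cst 0%R).
Proof.
split; first exact: measurable_cst.
move=> eps e0; exists 0%N, (cst 0%R); split => //.
rewrite (_ : sqint _ _ = 0) ?lte_fin// /sqint.
by under eq_integral do rewrite subr0 expr0n/=; rewrite integral0.
Qed.

Let approximableZ (c : R) f : approximable f -> approximable (fun x => c * f x)%R.
Proof.
move=> [mf hf]; split; first exact: measurable_funM.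
move=> eps e0; have c0 : (0 < c ^+ 2 + 1)%R by rewrite ltr_wpDl// sqr_ge0.
have [N [g [Ng hg]]] := hf _ (divr_gt0 e0 c0); exists N, (fun x => c * g x)%R.
split; first by move=> x y /Ng->.
have mg := measurable_cylinder_fun _ _ Ng.
rewrite (_ : (fun x => _) = (fun x => c * (f x - g x))%R); last first.
  by apply/funext => x; rewrite mulrBr.
rewrite sqintZ; last exact: measurable_funB.
apply: (@le_lt_trans _ _ ((c ^+ 2 + 1)%:E * sqint nu (fun x => f x - g x)%R)).
  by rewrite lee_wpmul2r ?sqint_ge0// lee_fin lerDl.
by rewrite muleC -lte_pdivlMr.
Qed.

Let approximable_tends f : measurable_fun setT f ->
  (forall eps : R, (0 < eps)%R -> exists2 h, approximable h &
    sqint nu (fun x => f x - h x)%R < eps%:E) -> approximable f.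
Proof.
move=> mf hf; split => // eps e0; have e4 : (0 < eps / 4)%R by rewrite divr_gt0.
have [h [mh hh] fh] := hf _ e4; have [N [g [Ng hg]]] := hh _ e4.
have mg := measurable_cylinder_fun _ _ Ng.
exists N, g; split => //.
rewrite (_ : (fun x => _) = (fun x => (f x - h x) + (h x - g x))%R); last first.
  by apply/funext => x; rewrite addrA subrK.
apply: le_lt_trans (sqintD _ _ _ _ _) _; [exact: measurable_funB..|].
have -> : eps = (2 * (eps / 4 + eps / 4))%R by lra.
by rewrite EFinM lte_pmul2l ?lte_fin// EFinD lteD.
Qed.

Let approximableD f g : approximable f -> approximable g ->
  approximable (fun x => f x + g x)%R.
Proof.
move=> [mf hf] [mg hg]; split; first exact: measurable_funD.
move=> eps e0; have e4 : (0 < eps / 4)%R by rewrite divr_gt0.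
have [N [f' [Nf hf']]] := hf _ e4; have [M [g' [Mg hg']]] := hg _ e4.
have mf' := measurable_cylinder_fun _ _ Nf.
have mg' := measurable_cylinder_fun _ _ Mg.
exists (maxn N M), (fun x => f' x + g' x)%R; split.
  move=> x y xy; congr (_ + _)%R.
    by apply: Nf; apply: eqlv_le xy; exact: leq_maxl.
  by apply: Mg; apply: eqlv_le xy; exact: leq_maxr.
rewrite (_ : (fun x => _) = (fun x => (f x - f' x) + (g x - g' x))%R); last first.
  by apply/funext => x; rewrite opprD addrACA.
apply: le_lt_trans (sqintD _ _ _ _ _) _; [exact: measurable_funB..|].
have -> : eps = (2 * (eps / 4 + eps / 4))%R by lra.
by rewrite EFinM lte_pmul2l ?lte_fin// EFinD lteD.
Qed.

Let approximable_indic A : measurable A -> approximable (\1_A : X1 p -> R).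
Proof.
move=> mA; split; first exact: measurable_indic.
move=> eps /(cylinder_set_approx nu nu_fin A mA)[N [C [NC hC]]].
have mC := measurable_cylinder_set _ _ NC.
exists N, \1_C; split.
  move=> x y xy; rewrite !indicE; congr ((nat_of_bool _)%:R); apply/idP/idP; rewrite !inE.
    exact: NC.
  by apply: NC; exact: eqlv_sym.
rewrite (_ : sqint _ _ = nu (A `+` C))// /sqint.
rewrite -(setIT (A `+` C)) -integral_indic//; last first.
  by apply: measurableU; exact: measurableD.
apply: eq_integral => x _; congr (_%:E); rewrite !indicE in_setU !in_setD.
by case: (x \in A); case: (x \in C) => /=; ring.
Qed.

Let approximable_sum (I : Type) (r : seq I) (F : I -> X1 p -> R) :
  (forall i, approximable (F i)) -> approximable (fun x => \sum_(i <- r) F i x)%R.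
Proof.
move=> hF; elim: r => [|i r IH].
  by under eq_fun do rewrite big_nil; exact: approximable0.
by under eq_fun do rewrite big_cons; exact: approximableD.
Qed.

Let approximable_nnsfun (h : {nnsfun (X1 p) >-> R}) : approximable h.
Proof.
have -> : (h : X1 p -> R) = _ := funext (fimfunEord h).
by apply: approximable_sum => i; apply: approximableZ; exact: approximable_indic.
Qed.

Let approximable_ge0 f : (forall x, 0 <= f x)%R -> measurable_fun setT f ->
  sqint nu f < +oo -> approximable f.
Proof.
move=> f0 mf fi; apply: approximable_tends => // eps e0.
have mEf : measurable_fun setT (EFin \o f) by exact/measurable_EFinP.
pose h n : X1 p -> R := nnsfun_approx measurableT mEf n.
have mh n : measurable_fun setT (h n) by [].
have hf n x : (h n x <= f x)%R.
  rewrite -lee_fin /h nnsfun_approxE; apply: (@le_approx _ _ _ setT) => //.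
  by move=> y _; rewrite lee_fin.
have h0 n x : (0 <= h n x)%R by [].
have hcvg x : h ^~ x @ \oo --> f x.
  have := @cvg_nnsfun_approx _ _ _ _ measurableT _ mEf _ x I.
  by move=> /(_ (fun y _ => f0 y)) /fine_cvgP[].
have fint : nu.-integrable setT (fun x => (f x ^+ 2)%:E).
  apply/integrableP; split; first exact: measurable_sq.
  by under eq_integral => x _ do rewrite gee0_abs ?lee_fin ?sqr_ge0//.
pose sq n (x : X1 p) := ((f x - h n x) ^+ 2)%:E.
have msq n : measurable_fun setT (sq n).
  by apply: measurable_sq; exact: measurable_funB.
have sq_cvg : {ae nu, forall x, [set: X1 p] x -> sq ^~ x @ \oo --> 0}.
  apply: aeW => x _; apply: cvg_EFin; first by near=> n.
  rewrite /= (_ : 0%R = ((f x - f x) ^+ 2)%R); last by rewrite subrr expr0n.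
  have c : (f x - h n x)%R @[n --> \oo] --> (f x - f x)%R.
    by apply: cvgB; [exact: cvg_cst|exact: hcvg].
  rewrite expr2; apply: cvg_trans (cvgM c c).
  by apply: near_eq_cvg; near=> n; rewrite /= expr2.
have sq_le : {ae nu, forall x n, [set: X1 p] x -> `|sq n x| <= (f x ^+ 2)%:E}.
  apply: aeW => x n _; rewrite gee0_abs ?lee_fin ?sqr_ge0// ler_sqr ?nnegrE ?subr_ge0//.
  by rewrite lerBlDr lerDl.
have [_ _ H] := dominated_convergence measurableT msq (measurable_cst 0) sq_cvg fint sq_le.
rewrite /= integral0 in H.
have : \forall n \near \oo, sqint nu (fun x => f x - h n x)%R < eps%:E.
  have /H : nbhs (0 : \bar R) [set y | y < eps%:E].
    by apply: open_nbhs_nbhs; split; [exact: open_ereal_lt_ereal|rewrite /= lte_fin].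
  by apply.
by move=> /filter_ex[n hn]; exists (h n) => //; exact: approximable_nnsfun.
Unshelve. all: by end_near. Qed.

(** Indicators come from [cylinder_set_approx], simple functions from linearity, nonnegative
    functions from dominated convergence of simple ones below them, and the general case from
    positive and negative parts. *)
Theorem cylinder_fun_dense f : measurable_fun setT f -> sqint nu f < +oo ->
  forall eps : R, (0 < eps)%R ->
  exists N g, cylinder_fun N g /\ sqint nu (fun x => f x - g x)%R < eps%:E.
Proof.
move=> mf fi; suff : approximable f by case.
have sub g : measurable_fun setT g -> (forall x, 0 <= g x <= `|f x|)%R -> approximable g.
  move=> mg gf; apply: approximable_ge0 => //.
    by move=> x; have /andP[] := gf x.
  apply: le_lt_trans fi; apply: ge0_le_integral => //.
  - by move=> x _; rewrite lee_fin sqr_ge0.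
  - exact: measurable_sq.
  - exact: measurable_sq.
  - move=> x _; have /andP[g0 gx] := gf x.
    by rewrite lee_fin -[leRHS]real_normK ?num_real// ler_sqr ?nnegrE.
rewrite (_ : f = fun x => (f^\+ x + (-1) * f^\- x)%R); last first.
  by rewrite -[LHS]funrposBneg; apply/funext => x; rewrite mulN1r.
apply: approximableD; last apply: approximableZ.
  apply: sub => [|x]; first exact: measurable_funrpos.
  by rewrite funrpos_ge0 /funrpos ge_max normr_ge0 ler_norm.
apply: sub => [|x]; first exact: measurable_funrneg.
by rewrite funrneg_ge0 /funrneg ge_max normr_ge0 -normrN ler_norm.
Qed.

End cylinder_functions.

(** * The quasiregular representation *)

Section density_measure.
Context {d : measure_display} {T : measurableType d} {R : realType}.
Variables (mu : {measure set T -> \bar R}) (f : T -> R).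
Hypotheses (mf : measurable_fun setT f) (f_ge0 : forall x, 0 <= f x).
Local Open Scope ereal_scope.

(** The dummy [let]s make both hypotheses arguments of the definition, so that a measure structure
    can be attached to it. *)
Definition density_measure (A : set T) : \bar R :=
  let _ := mf in let _ := f_ge0 in \int[mu]_(x in A) (f x)%:E.

Let density0 : density_measure set0 = 0.
Proof. exact: integral_set0. Qed.

Let density_ge0 A : 0 <= density_measure A.
Proof. by apply: integral_ge0 => x _; rewrite lee_fin. Qed.

Let density_sigma_additive : semi_sigma_additive density_measure.
Proof.
apply: semi_sigma_additive_nng_induced; first exact/measurable_EFinP.
by move=> x; rewrite lee_fin.
Qed.

HB.instance Definition _ := isMeasure.Build _ _ _ density_measure
  density0 density_ge0 density_sigma_additive.

End density_measure.

Section product_measure.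
Context {R : realType} {p : nat} (alpha : nat -> 'F_p -> R).
Hypothesis alpha_gt0 : forall n r, (1 <= n)%N -> 0 < alpha n r.
Variable mu : probability (X1 p) R.
Hypothesis mu_alpha : is_product_measure alpha mu.
Implicit Types (x y : X1 p) (t : B0N p).

Definition weight N x : R := \prod_(1 <= k < N.+1) alpha k (x k).

Lemma weight_gt0 N x : 0 < weight N x.
Proof.
rewrite /weight big_nat; apply: prodr_gt0 => k /andP[k1 _]; exact: alpha_gt0.
Qed.

Lemma weightS N x : weight N.+1 x = weight N x * alpha N.+1 (x N.+1).
Proof. by rewrite /weight big_nat_recr. Qed.

Lemma cylinder_fun_weight N : cylinder_fun N (weight N).
Proof.
move=> x y xy; rewrite /weight !big_nat; apply: eq_bigr => k kN.
by rewrite xy// -ltnS.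
Qed.

Lemma product_measure_cyl N x : mu (cyl N x) = (weight N x)%:E.
Proof.
rewrite -mu_alpha; congr (mu _); apply/seteqP.
by split=> y /= xy k kN; rewrite xy.
Qed.

(** Such t leave the coordinates beyond N unchanged, so the weights of those coordinates cancel in
    the density and any larger N gives the same quotient. *)
Definition rowlevel N t := forall k n, (N < n)%N -> (k < n)%N -> t k n = 0.

Lemma rowlevel_le N M t : (N <= M)%N -> rowlevel N t -> rowlevel M t.
Proof. by move=> NM Nt k n Mn; apply: Nt; exact: leq_ltn_trans Mn. Qed.

Lemma ex_rowlevel t : exists N, rowlevel N t.
Proof. by have [N Nt] := B0N_bound t; exists N => k n /ltnW; exact: Nt. Qed.

Lemma rowlevel_mul N t x n : rowlevel N t -> (N < n)%N -> row1_mul x t n = x n.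
Proof.
move=> Nt Nn; rewrite row1_mul_coord big_ord_recr /= B0N_diag mulr1.
by rewrite big1 ?add0r// => k _; rewrite Nt// mulr0.
Qed.

Definition dens N t x : R := weight N (row1_mul x t) / weight N x.

Lemma dens_gt0 N t x : 0 < dens N t x.
Proof. by rewrite divr_gt0// weight_gt0. Qed.

Lemma dens_le N M t x : rowlevel N t -> (N <= M)%N -> dens M t x = dens N t x.
Proof.
move=> Nt /subnKC <-; elim: (M - N)%N => [|d IH]; first by rewrite addn0.
rewrite addnS -[RHS]IH /dens !weightS (rowlevel_mul N)//; last first.
  by rewrite ltnS leq_addr.
by rewrite -mulf_div divff ?mulr1// gt_eqF// alpha_gt0.
Qed.

Lemma cylinder_fun_dens N t : cylinder_fun N (dens N t).
Proof.
move=> x y xy; rewrite /dens (cylinder_fun_weight _ _ _ xy).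
by rewrite (cylinder_fun_weight _ _ _ (eqlv_mul _ _ _ t xy)).
Qed.

Lemma measurable_dens N t : measurable_fun setT (dens N t).
Proof. exact: measurable_cylinder_fun (cylinder_fun_dens _ _). Qed.

Lemma measurable_row1_mul t : measurable_fun setT ((row1_mul (p := p))^~ t).
Proof.
rewrite (_ : (row1_mul (p := p))^~ t = Ract t^-1%g); first exact: measurable_Ract.
by apply/funext => x; rewrite RactVE.
Qed.

Local Open Scope ereal_scope.

Let dens_measure N t := density_measure mu (dens N t) (measurable_dens N t)
  (fun x => ltW (dens_gt0 N t x)).

Let dens_measure_cyl N M t x : (N <= M)%N ->
  dens_measure N t (cyl M x) = (dens N t x)%:E * mu (cyl M x).
Proof.
move=> NM; rewrite -integral_cst; last exact: measurable_cyl.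
apply: eq_integral => y; rewrite inE => xy; congr (_%:E).
exact/esym/cylinder_fun_dens/(eqlv_le _ _ _ _ NM).
Qed.

Let translated_setT t : translated mu t setT = 1.
Proof. by rewrite /translated /pushforward preimage_setT probability_setT. Qed.

Lemma translatedE N t A : rowlevel N t -> measurable A ->
  translated mu t A = \int[mu]_(x in A) (dens N t x)%:E.
Proof.
move=> Nt mA; have := @measure_eq_cyl p R (translated mu t) (dens_measure N t) N.
apply => //.
- by rewrite /= translated_setT ltry.
- rewrite (@measure_cylinder_set _ _ (dens_measure N t) N setT)//.
  apply: lte_sum_pinfty => a _.
  have h := dens_measure_cyl N N t (row_of_ffun N a) (leqnn N).
  rewrite product_measure_cyl -EFinM in h.
  have := ltry (dens N t (row_of_ffun N a) * weight N (row_of_ffun N a))%R.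
  by rewrite -h.
(* R_t pulls the cylinder of x back to that of xt. For M >= N the density is constant on the
   cylinder, and both sides equal the weight of xt at level M. *)
- move=> M x NM; transitivity ((dens N t x)%:E * mu (cyl M x)).
    2: by apply/esym; exact: dens_measure_cyl.
  rewrite -(dens_le _ _ _ _ Nt NM).
  rewrite product_measure_cyl -EFinM /dens divfK ?gt_eqF ?weight_gt0//.
  rewrite -product_measure_cyl; congr (mu _).
  by apply/seteqP; split=> y; rewrite /cyl/= -RactVE => /eqlv_RactP.
Qed.

Lemma translated_dominated t : translated mu t `<< mu.
Proof.
apply/null_content_dominatesP => A mA A0; have [N Nt] := ex_rowlevel t.
rewrite (translatedE N)//; apply: null_set_integral => //.
by apply/measurable_EFinP; apply: measurable_funTS; exact: measurable_dens.
Qed.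

Lemma densityE N t : rowlevel N t -> ae_eq mu setT (density mu t) (EFin \o dens N t).
Proof.
move=> Nt; apply: integral_ae_eq => //.
- apply: Radon_Nikodym_integrable; exact: translated_dominated.
- by apply/measurable_EFinP; exact: measurable_dens.
- move=> A _ mA; rewrite -(translatedE N)//.
  rewrite -Radon_Nikodym_integral//; exact: translated_dominated.
Qed.

Lemma integral_row1_mul N t (h : X1 p -> \bar R) : rowlevel N t ->
  (forall x, 0 <= h x) -> measurable_fun setT h ->
  \int[mu]_x (h (row1_mul x t) * (dens N t x)%:E) = \int[mu]_x h x.
Proof.
move=> Nt h0 mh; pose h' x := h (row1_mul x t).
have mh' : measurable_fun setT h'.
  by apply: measurableT_comp => //; exact: measurable_row1_mul.
have tmu := translated_dominated t.
(* An everywhere finite, nonnegative version of the derivative, equal to [dens] almost everywhere;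
   the change of variables formula is stated with it. *)
transitivity (\int[mu]_x (h' x * Radon_Nikodym_SigmaFinite.f (translated mu t) mu x)).
  apply: ae_eq_integral => //.
  - apply: emeasurable_funM => //; by apply/measurable_EFinP; exact: measurable_dens.
  - apply: emeasurable_funM => //.
    exact: measurable_int (Radon_Nikodym_SigmaFinite.f_integrable tmu).
  - have := densityE N t Nt.
    have := ae_eq_Radon_Nikodym_SigmaFinite tmu measurableT.
    apply: filterS2 => x e1 e2 Dx; rewrite /= e1//.
    by have := e2 Dx; rewrite /density => ->.
rewrite Radon_Nikodym_SigmaFinite.change_of_variables//; last first.
  by move=> x; exact: h0.
transitivity (\int[pushforward mu (Ract t)]_x h' x); first by [].
rewrite (ge0_integral_pushforward (measurable_Ract t))//; last first.
  by move=> x _; exact: h0.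
by apply: eq_integral => x _; rewrite /h'/= -RactVE RactK.
Qed.

End product_measure.

Lemma Re_realM {R : realType} (r : R) (z : R[i]) :
  complex.Re (r%:C%C * z) = r * complex.Re z.
Proof. by case: z => a b /=; rewrite mul0r subr0. Qed.

Lemma Im_realM {R : realType} (r : R) (z : R[i]) :
  complex.Im (r%:C%C * z) = r * complex.Im z.
Proof. by case: z => a b /=; rewrite mul0r addr0. Qed.

(** * Norms in complex L^2 and the explicit form of the representation *)

Section L2_norm.
Context {d : measure_display} {T : measurableType d} {R : realType}.
Variable mu : {measure set T -> \bar R}.
Implicit Types (f g : T -> R[i]).
Local Open Scope ereal_scope.

Lemma sqint_eq_ae (h k : T -> R) : measurable_fun setT h -> measurable_fun setT k ->
  h = k %[ae mu] -> sqint mu h = sqint mu k.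
Proof.
move=> mh mk hk; apply: ae_eq_integral => //; [exact: measurable_sq..|].
by apply: filterS hk => x e Dx /=; rewrite e.
Qed.

Lemma Lfun2P (h : T -> R) :
  h \in Lfun mu 2%:E <-> measurable_fun setT h /\ sqint mu h < +oo.
Proof.
have E : 'N[mu]_2%:E[EFin \o h] = sqint mu h `^ 2^-1.
  rewrite unlock /= /sqint; congr (_ `^ _); apply: eq_integral => x _.
  by rewrite powR_mulrn// real_normK ?num_real.
split=> [|[mh hi]].
  rewrite inE => /andP[/[!inE] mh]; rewrite /= /finite_norm E => hi; split => //.
  by apply: lty_poweRy hi; rewrite invr_neq0.
apply/andP; split; first by rewrite inE.
by rewrite inE/= /finite_norm E poweR_lty.
Qed.

Definition sqnorm f := sqint mu (@complex.Re R \o f) + sqint mu (@complex.Im R \o f).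

Definition cmeasurable f := measurable_fun setT (@complex.Re R \o f) /\
  measurable_fun setT (@complex.Im R \o f).

Lemma L2_predP f : L2_pred mu f <-> cmeasurable f /\ sqnorm f < +oo.
Proof.
split=> [/andP[/Lfun2P[m1 i1] /Lfun2P[m2 i2]]|[[m1 m2]]].
  by split => //; exact: lte_add_pinfty.
move=> i; apply/andP; split; apply/Lfun2P; split => //; apply: le_lt_trans i.
  by rewrite leeDl// sqint_ge0.
by rewrite leeDr// sqint_ge0.
Qed.

Lemma sqnorm_eq_ae f g : cmeasurable f -> cmeasurable g -> f = g %[ae mu] ->
  sqnorm f = sqnorm g.
Proof.
move=> [mf1 mf2] [mg1 mg2] fg; rewrite /sqnorm.
by congr (_ + _); apply: sqint_eq_ae => //; apply: filterS fg => x e Dx /=; rewrite e.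
Qed.

Lemma sqint_fineK (h : T -> R) : h \in Lfun mu 2%:E ->
  sqint mu h = (\int[mu]_x (h x ^+ 2)%R)%R%:E.
Proof.
move=> /Lfun2P[mh hi]; rewrite /Rintegral fineK// ge0_fin_numE//; exact: sqint_ge0.
Qed.

Lemma L2_dot_sqnorm (u : L2 mu) : L2_dot mu u u = ((fine (sqnorm u))%:C)%C.
Proof.
have /andP[u1 u2] := L2_reprP u.
have [r i] := L2_integrable_mul (L2_reprP u) (L2_reprP u).
apply/eqP; rewrite eq_complex; apply/andP; split; apply/eqP => /=.
  rewrite /sqnorm sqint_fineK// sqint_fineK//= -RintegralD//.
  - by apply: eq_Rintegral => x _; case: (u x) => a b /=; ring.
  - exact: Lfun2_integrable_sqr u1.
  - exact: Lfun2_integrable_sqr u2.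
transitivity (\int[mu]_x (0 : R))%R; last by rewrite /Rintegral integral0.
by apply: eq_Rintegral => x _; case: (u x) => a b /=; ring.
Qed.

Lemma sqnorm_fin (u : L2 mu) : sqnorm u \is a fin_num.
Proof.
have /L2_predP[_ h] := L2_reprP u; rewrite ge0_fin_numE//.
by rewrite adde_ge0// sqint_ge0.
Qed.

Lemma L2_norm_lt (u : L2 mu) (e : R) : (0 < e)%R -> sqnorm u < (e ^+ 2)%:E ->
  (hilbert_norm (L2_dot mu) u < e%:C%C)%R.
Proof.
move=> e0 ue; rewrite -(@ltr_sqr _) ?nnegrE; last 2 first.
- by rewrite hnrm_ge0.
- by rewrite lecR ltW.
rewrite hnrm_sqr [X in (X < _)%R]L2_dot_sqnorm -rmorphXn/= ltcR.
by rewrite -lte_fin fineK// sqnorm_fin.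
Qed.

Lemma L2_norm_eq (u v : L2 mu) : sqnorm u = sqnorm v ->
  hilbert_norm (L2_dot mu) u = hilbert_norm (L2_dot mu) v.
Proof.
move=> uv; apply/eqP; rewrite -(@eqrXn2 _ 2) ?hnrm_ge0// !hnrm_sqr.
by rewrite [X in X == _]L2_dot_sqnorm [X in _ == X]L2_dot_sqnorm uv.
Qed.

Lemma L2_eq0 (u : L2 mu) : sqnorm u = 0 -> u = 0%R.
Proof.
move=> u0; apply/eqP; rewrite -(dnorm_eq0 (L2_dot mu)).
by rewrite [X in X == _]L2_dot_sqnorm u0.
Qed.

End L2_norm.

Section quasi_regular_unitary.
Context {R : realType} {p : nat} (alpha : nat -> 'F_p -> R).
Hypothesis alpha_gt0 : forall n r, (1 <= n)%N -> 0 < alpha n r.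
Variable mu : probability (X1 p) R.
Hypothesis mu_alpha : is_product_measure alpha mu.
Implicit Types (t : B0N p) (f g : X1 p -> R[i]) (u v : L2 mu).
Local Open Scope complex_scope.

Local Notation T := (@quasi_regular R p mu).

(** The same operator with the explicit density, on functions instead of classes. Its
    multiplicativity holds at every point, by the cocycle identity of [dens]. *)
Definition wact N t f : X1 p -> R[i] :=
  fun x => (Num.sqrt (dens alpha N t x))%:C * f (row1_mul x t).

Let Re_wact N t f : @complex.Re R \o wact N t f =
  (fun x => Num.sqrt (dens alpha N t x) * (@complex.Re R \o f) (row1_mul x t)).
Proof. by apply/funext => x /=; rewrite Re_realM. Qed.

Let Im_wact N t f : @complex.Im R \o wact N t f =
  (fun x => Num.sqrt (dens alpha N t x) * (@complex.Im R \o f) (row1_mul x t)).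
Proof. by apply/funext => x /=; rewrite Im_realM. Qed.

Let measurable_wact_real N t (h : X1 p -> R) : measurable_fun setT h ->
  measurable_fun setT (fun x => Num.sqrt (dens alpha N t x) * h (row1_mul x t)).
Proof.
move=> mh; apply: measurable_funM.
  by apply: (measurable_cylinder_fun N) => x y /cylinder_fun_dens->.
by apply: measurableT_comp => //; exact: measurable_row1_mul.
Qed.

Let sqint_wact_real N t (h : X1 p -> R) : rowlevel N t -> measurable_fun setT h ->
  sqint mu (fun x => Num.sqrt (dens alpha N t x) * h (row1_mul x t)) = sqint mu h.
Proof.
move=> Nt mh; rewrite /sqint.
rewrite -[RHS](integral_row1_mul alpha alpha_gt0 mu mu_alpha N t)//; last 2 first.
- by move=> x; rewrite lee_fin sqr_ge0.
- exact: measurable_sq.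
apply: eq_integral => x _; rewrite -EFinM; congr (_%:E).
by rewrite exprMn sqr_sqrtr ?ltW ?(dens_gt0 _ alpha_gt0)// mulrC.
Qed.

Lemma cmeasurable_wact N t f : cmeasurable f -> cmeasurable (wact N t f).
Proof.
by move=> [m1 m2]; split; rewrite ?Re_wact ?Im_wact; exact: measurable_wact_real.
Qed.

Lemma sqnorm_wact N t f : rowlevel N t -> cmeasurable f ->
  sqnorm mu (wact N t f) = sqnorm mu f.
Proof.
by move=> Nt [m1 m2]; rewrite /sqnorm Re_wact Im_wact !sqint_wact_real.
Qed.

Lemma L2_pred_wact N t f : rowlevel N t -> L2_pred mu f -> L2_pred mu (wact N t f).
Proof.
move=> Nt /L2_predP[mf fi]; apply/L2_predP; split; first exact: cmeasurable_wact.
by rewrite sqnorm_wact.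
Qed.

(** Quasi-invariance: the preimage of a null set under x -> xt has the mass that
    [translated mu t^-1] gives to the null set, namely 0. *)
Lemma ae_row1_mul t (P : X1 p -> Prop) :
  (\forall x \ae mu, P x) -> \forall x \ae mu, P (row1_mul x t).
Proof.
move=> [N [mN N0 PN]]; exists (Ract t^-1%g @^-1` N); split.
- by rewrite -[X in measurable X]setTI; exact: measurable_Ract.
- have /null_content_dominatesP h := translated_dominated alpha alpha_gt0 mu mu_alpha t^-1%g.
  exact: h.
- by move=> x nP; apply: PN; rewrite /= RactVE.
Qed.

Lemma wact_ae N t f g : f = g %[ae mu] -> wact N t f = wact N t g %[ae mu].
Proof.
move=> fg; have := ae_row1_mul t (fun x => f x = g x).
move=> h; apply: filterS (h _); first by move=> x e _; rewrite /wact e.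
by apply: filterS fg => x; exact.
Qed.

(** [L2class] sends a function outside L^2 to 0, so the formula defining T t u must first be shown
    square-integrable; this is inherited from [wact], to which it is equal almost everywhere. *)
Lemma quasi_regularE N t u : rowlevel N t ->
  (T t u : X1 p -> R[i]) = wact N t u %[ae mu].
Proof.
move=> Nt; have uL : L2_pred mu u := L2_reprP u.
have wL := L2_pred_wact N t u Nt uL; have [mu_ _] := (L2_predP _ _).1 uL.
pose f x := (Num.sqrt (fine (density mu t x)))%:C * u (Ract t^-1%g x).
have fw : f = wact N t u %[ae mu].
  apply: filterS (densityE alpha alpha_gt0 mu mu_alpha N t Nt) => x e Dx.
  by rewrite /f e// RactVE.
have mdens : measurable_fun setT (fine \o density mu t).
  apply: measurableT_comp => //; apply: (measurable_int mu).
  apply: Radon_Nikodym_integrable; exact: (translated_dominated alpha).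
have msq : measurable_fun setT (fun x => Num.sqrt (fine (density mu t x))).
  apply: (measurableT_comp (continuous_measurable_fun _) mdens).
  exact: sqrt_continuous.
have mf : cmeasurable f.
  have [m1 m2] := mu_; split.
    rewrite (_ : _ \o _ = fun x => Num.sqrt (fine (density mu t x)) *
      (@complex.Re R \o u) (Ract t^-1%g x)).
      apply: measurable_funM => //; apply: measurableT_comp => //.
      exact: measurable_Ract.
    by apply/funext => x; rewrite /f /= Re_realM.
  rewrite (_ : _ \o _ = fun x => Num.sqrt (fine (density mu t x)) *
    (@complex.Im R \o u) (Ract t^-1%g x)).
    apply: measurable_funM => //; apply: measurableT_comp => //.
    exact: measurable_Ract.
  by apply/funext => x; rewrite /f /= Im_realM.
have fL : L2_pred mu f.
  apply/L2_predP; split => //; rewrite (sqnorm_eq_ae _ _ _ _ _ fw)//.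
    by case/L2_predP: wL.
  exact: cmeasurable_wact.
by apply: filterS2 (L2classE fL) fw => x e1 e2 Dx; rewrite -e2// -e1.
Qed.

Lemma quasi_regular_class N t u f : rowlevel N t -> u = f %[ae mu] ->
  (T t u : X1 p -> R[i]) = wact N t f %[ae mu].
Proof.
move=> Nt uf; apply: filterS2 (quasi_regularE N t u Nt) (wact_ae N t _ _ uf).
by move=> x e1 e2 Dx; rewrite e1// e2.
Qed.

Lemma quasi_regular_linear t : linear (T t).
Proof.
have [N Nt] := ex_rowlevel t.
move=> a u v; apply: L2_eqP.
apply: filterS3 (quasi_regular_class N t _ _ Nt (L2_linE a u v))
  (L2_linE a (T t u) (T t v))
  (filterI (quasi_regularE N t u Nt) (quasi_regularE N t v Nt)).
move=> x e1 e2 [e3 e4] Dx; rewrite e1// e2// e3// e4//.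
by rewrite /wact mulrDr mulrCA.
Qed.

Lemma sqnorm_quasi_regular t u : sqnorm mu (T t u) = sqnorm mu u.
Proof.
have [N Nt] := ex_rowlevel t.
have [mu_ _] := (L2_predP _ _).1 (L2_reprP u).
have [mTu _] := (L2_predP _ _).1 (L2_reprP (T t u)).
rewrite -[RHS](sqnorm_wact N t)//; apply: sqnorm_eq_ae => //.
  exact: cmeasurable_wact.
exact: quasi_regularE.
Qed.

Lemma quasi_regular_isometry t u :
  hilbert_norm (L2_dot mu) (T t u) = hilbert_norm (L2_dot mu) u.
Proof. by apply: L2_norm_eq; exact: sqnorm_quasi_regular. Qed.

Lemma wactM N s t f : wact N (s * t)%g f = wact N s (wact N t f).
Proof.
apply/funext => x; rewrite /wact row1_mulA mulrA -rmorphM/= -sqrtrM; last first.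
  by rewrite ltW// (dens_gt0 _ alpha_gt0).
congr ((Num.sqrt _)%:C * _); rewrite /dens row1_mulA [RHS]mulrC.
by rewrite mulrA divfK// gt_eqF// (weight_gt0 _ alpha_gt0).
Qed.

Lemma quasi_regularM s t u : T (s * t)%g u = T s (T t u).
Proof.
have [N1 Ns] := ex_rowlevel s; have [N2 Nt] := ex_rowlevel t.
have [N3 Nst] := ex_rowlevel (s * t)%g; pose N := maxn N1 (maxn N2 N3).
have {}Ns : rowlevel N s by apply: rowlevel_le Ns; exact: leq_maxl.
have {}Nt : rowlevel N t.
  by apply: rowlevel_le Nt; rewrite /N maxnCA leq_maxl.
have {}Nst : rowlevel N (s * t)%g.
  by apply: rowlevel_le Nst; rewrite /N maxnA leq_maxr.
apply: L2_eqP; apply: filterS2 (quasi_regularE N _ u Nst)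
  (quasi_regular_class N s _ _ Ns (quasi_regularE N t u Nt)) => x e1 e2 Dx.
by rewrite e1// e2// wactM.
Qed.

Lemma quasi_regular1 u : T 1%g u = u.
Proof.
have N1 : rowlevel 0 (1%g : B0N p).
  by move=> k n _ kn; rewrite /= /B0N_one_val ltn_eqF.
apply: L2_eqP; apply: filterS (quasi_regularE 0 _ u N1) => x e Dx.
rewrite e// /wact /dens row1_mul1 divff ?sqrtr1 ?mul1r//.
by rewrite gt_eqF// (weight_gt0 _ alpha_gt0).
Qed.

Lemma commutant_vN_algebra :
  commutant (L2_dot mu) (vN_algebra mu) = commutant (L2_dot mu) (range T).
Proof.
apply: commutant_bicommutant => _ [t _ <-].
by apply: bounded_isometry; [exact: quasi_regular_linear|exact: quasi_regular_isometry].
Qed.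

End quasi_regular_unitary.

(** * Equivalent measures *)

Section cylinder_vectors.
Context {R : realType} {p : nat}.
Variables (mu nu : probability (X1 p) R) (w : X1 p -> R).
Hypothesis mw : measurable_fun setT w.
Hypothesis w_ge0 : forall x, 0 <= w x.
Hypothesis w_neq0 : \forall x \ae mu, w x != 0.
Hypothesis integral_w : forall h : X1 p -> \bar R, measurable_fun setT h ->
  (forall x, 0 <= h x)%E ->
  (\int[nu]_x h x = \int[mu]_x (h x * (w x ^+ 2)%:E))%E.
Implicit Types (x y : X1 p) (u v : L2 mu).
Local Open Scope complex_scope.

Lemma L2_sumE (I : Type) (r : seq I) (F : I -> L2 mu) (f : I -> X1 p -> R[i]) :
  (forall i, (F i : X1 p -> R[i]) = f i %[ae mu]) ->
  ((\sum_(i <- r) F i : L2 mu) : X1 p -> R[i]) =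
    (fun x => \sum_(i <- r) f i x) %[ae mu].
Proof.
move=> Ff; elim: r => [|i r IH].
  rewrite big_nil; apply: filterS (L2_zeroE mu) => x e Dx.
  by rewrite big_nil; exact: e.
rewrite big_cons; apply: filterS3 (Ff i) IH (L2_addE (F i) (\sum_(j <- r) F j)).
by move=> x e1 e2 e3 Dx; rewrite big_cons -e1// -e2//; exact: e3.
Qed.

Lemma L2_dot_real u v (F G : X1 p -> R) :
  measurable_fun setT F -> measurable_fun setT G ->
  (u : X1 p -> R[i]) = (fun x => (F x)%:C) %[ae mu] ->
  (v : X1 p -> R[i]) = (fun x => (G x)%:C) %[ae mu] ->
  L2_dot mu u v = (fine (\int[mu]_x (F x * G x)%:E)%E)%:C.
Proof.
move=> mF mG uF vG.
have [/measurable_int r /measurable_int i] := L2_integrable_mul (L2_reprP u) (L2_reprP v).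
rewrite /L2_dot /L2_dotfun; congr (_ +i* _).
  rewrite /Rintegral; congr fine; apply: ae_eq_integral => //.
    by apply/measurable_EFinP; exact: measurable_funM.
  apply: filterS2 uF vG => x e1 e2 Dx; rewrite e1// e2//=.
  by rewrite oppr0 mulr0 subr0.
rewrite -[RHS](_ : \int[mu]_x 0 = 0); last by rewrite /Rintegral integral0.
rewrite /Rintegral; congr fine; apply: ae_eq_integral => //.
apply: filterS2 uF vG => x e1 e2 Dx; rewrite e1// e2//=.
by rewrite oppr0 mulr0 mul0r addr0.
Qed.

(** As d nu = w^2 d mu, multiplication by w carries L^2(nu) isometrically into L^2(mu), and these
    are the images of cylinder indicators. The equivalent case takes nu = mu_inv and w^2 its
    density; the singular case takes nu = mu and w = 1. *)
Definition cylfun N x y : R := \1_(cyl N x) y * w y.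

Lemma measurable_indic_cyl N x : measurable_fun setT (\1_(cyl N x) : X1 p -> R).
Proof. by apply: measurable_indic; exact: measurable_cyl. Qed.

Lemma measurable_cylfun N x : measurable_fun setT (cylfun N x).
Proof.
by apply: measurable_funM => //; exact: measurable_indic_cyl.
Qed.

Lemma sqint_w (f : X1 p -> R) : measurable_fun setT f ->
  sqint mu (fun x => f x * w x) = sqint nu f.
Proof.
move=> mf; rewrite /sqint integral_w; last 2 first.
- exact: measurable_sq.
- by move=> x; rewrite lee_fin sqr_ge0.
by apply: eq_integral => x _; rewrite exprMn EFinM.
Qed.

Lemma sqint_indic A : measurable A -> sqint nu (\1_A : X1 p -> R) = nu A.
Proof.
move=> mA; rewrite /sqint -[in RHS](setIT A) -integral_indic//.
by apply: eq_integral => x _; rewrite indicE; case: (x \in A) => /=; rewrite ?expr1n ?expr0n.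
Qed.

Lemma sqint0 : sqint mu (cst 0 : X1 p -> R) = 0%E.
Proof. by rewrite /sqint; under eq_integral do rewrite expr0n/=; exact: integral0. Qed.

Lemma L2_pred_cylfun N x : L2_pred mu (fun y => (cylfun N x y)%:C).
Proof.
apply/L2_predP; rewrite /sqnorm /cmeasurable.
rewrite (_ : @complex.Re R \o _ = cylfun N x)// (_ : @complex.Im R \o _ = cst 0)//.
split; first by split; [exact: measurable_cylfun|exact: measurable_cst].
rewrite sqint0 adde0 sqint_w; last exact: measurable_indic_cyl.
by rewrite sqint_indic ?(le_lt_trans (probability_le1 _ _)) ?ltry//; exact: measurable_cyl.
Qed.

Definition cylvec N x : L2 mu := L2class mu (fun y => (cylfun N x y)%:C).

Lemma cylvecE N x :
  (cylvec N x : X1 p -> R[i]) = (fun y => (cylfun N x y)%:C) %[ae mu].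
Proof. by apply: L2classE; exact: L2_pred_cylfun. Qed.

Lemma cyl_ext N x y : eqlv N x y -> cyl N x = cyl N y.
Proof.
move=> xy; apply/seteqP; split=> z; first exact: eqlv_trans (eqlv_sym _ _ _ xy).
exact: eqlv_trans.
Qed.

Lemma cylvec_ext N x y : eqlv N x y -> cylvec N x = cylvec N y.
Proof. by move=> xy; rewrite /cylvec /cylfun (cyl_ext _ _ _ xy). Qed.

Lemma eqlvS N x y : eqlv N.+1 x y <-> eqlv N x y /\ x N.+1 = y N.+1.
Proof.
split=> [xy|[xy xyN] k /andP[k1]].
  by split; [exact: eqlv_le xy|apply: xy; rewrite /= leqnn].
by rewrite leq_eqVlt => /orP[/eqP->//|kN]; apply: xy; rewrite k1.
Qed.

Lemma indic_cyl_split N x y :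
  \1_(cyl N x) y = \sum_(r : 'F_p) \1_(cyl N.+1 (shift N.+1 r x)) y :> R.
Proof.
rewrite (bigD1 (y N.+1 - x N.+1))//= big1 ?addr0; last first.
  move=> r ry; rewrite indicE memNset// => /eqlvS[_].
  by rewrite shiftE// eqxx mul1r => e; rewrite -e addrAC subrr add0r eqxx in ry.
rewrite !indicE; congr ((nat_of_bool _)%:R); apply/idP/idP; rewrite !inE => xy.
  apply/eqlvS; split; last by rewrite shiftE// eqxx mul1r addrC subrK.
  by apply: eqlv_trans xy; exact: eqlv_shift.
move/eqlvS : xy => [xy _]; apply: eqlv_trans xy; apply: eqlv_sym.
exact: eqlv_shift.
Qed.

Lemma cylvec_split N x :
  cylvec N x = \sum_(r : 'F_p) cylvec N.+1 (shift N.+1 r x).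
Proof.
apply: L2_eqP; apply: filterS2 (cylvecE N x) (L2_sumE _ (index_enum _) _ _
  (fun r : 'F_p => cylvecE N.+1 (shift N.+1 r x))) => y e1 e2 Dy.
rewrite e1// e2// /cylfun indic_cyl_split mulr_suml.
by rewrite -[RHS](raddf_sum (real_complex R)).
Qed.

Lemma cylvec_ip M s x y : (s <= M)%N -> L2_dot mu (cylvec M x) (cylvec s y) =
  if `[< eqlv s x y >] then (fine (nu (cyl M x)))%:C else 0.
Proof.
move=> sM; rewrite (L2_dot_real _ _ _ _ (measurable_cylfun M x)
  (measurable_cylfun s y) (cylvecE M x) (cylvecE s y)).
case: asboolP => xy.
  congr (fine _)%:C; rewrite -sqint_indic; last exact: measurable_cyl.
  rewrite -sqint_w; last exact: measurable_indic_cyl.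
  apply: eq_integral => z _; congr (_%:E); rewrite /cylfun !indicE.
  have [xz|xz] := boolP (z \in cyl M x); last by rewrite !mul0r expr0n.
  rewrite mem_set ?expr2//; rewrite inE in xz.
  by apply: eqlv_trans (eqlv_le _ _ _ _ sM xz); exact: eqlv_sym.
rewrite (_ : integral _ _ _ = 0%E)// -[RHS](integral0 mu setT).
apply: eq_integral => z _; congr (_%:E); rewrite /cylfun !indicE.
have [xz|xz] := boolP (z \in cyl M x); last by rewrite !mul0r.
have [yz|yz] := boolP (z \in cyl s y); last by rewrite !mul0r mulr0.
exfalso; apply: xy; rewrite !inE in xz yz.
by apply: eqlv_trans (eqlv_le _ _ _ _ sM xz) _; exact: eqlv_sym.
Qed.

Lemma L2_subE u v : ((u - v : L2 mu) : X1 p -> R[i]) = (fun x => u x - v x) %[ae mu].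
Proof.
rewrite addrC -scaleN1r; apply: filterS (L2_linE (-1) v u) => x e Dx.
by rewrite e// mulN1r addrC.
Qed.

Lemma sum_indic_cyl N y (c : X1 p -> R) : cylinder_fun N c ->
  \sum_(a : {ffun 'I_N -> 'F_p}) c (row_of_ffun N a) * \1_(cyl N (row_of_ffun N a)) y = c y.
Proof.
move=> Nc; rewrite (bigD1 (ffun_of_row N y))//= big1 ?addr0; last first.
  move=> a ay; rewrite indicE memNset ?mulr0// => /eqlv_sym /row_of_ffunP ay'.
  by rewrite ay' eqxx in ay.
rewrite indicE mem_set ?mulr1; last exact: eqlv_row_of_ffun.
by apply: Nc; exact: eqlv_row_of_ffun.
Qed.

(** Division by w leads to L^2(nu), where cylinder functions are dense; multiplying back by w gives
    combinations of cylinder vectors. Real and imaginary parts each get half of the squared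
    error. *)
Lemma cylvec_total : total (L2_dot mu) [set v | exists N x, v = cylvec N x].
Proof.
suff H (u : L2 mu) (eps : R[i]) : 0 < eps -> exists2 v : L2 mu,
    lin_hull [set v : L2 mu | exists N x, v = cylvec N x] v &
    hilbert_norm (L2_dot mu) (u - v) < eps by exact: H.
move=> eps0; have [e0 epsE] : 0 < complex.Re eps /\ eps = (complex.Re eps)%:C.
  move: eps0; case: eps => a b; rewrite ltcE /= => /andP[/eqP b0 a0].
  by split => //; rewrite b0.
set e := complex.Re eps in e0 epsE; rewrite epsE.
have [[m1 m2] ui] := (L2_predP _ _).1 (L2_reprP u).
(* Division by 0 returns 0, but w vanishes only on a null set. *)
pose q (h : X1 p -> R) x := h x / w x.
have mq h : measurable_fun setT h -> measurable_fun setT (q h).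
  move=> mh; apply: measurable_funM => //.
  rewrite (_ : (fun x => (w x)^-1) = (fun x => w x `^ (-1))).
    exact: measurableT_comp (measurable_powR _) mw.
  by apply/funext => x; rewrite powR_inv1.
have qw h : (fun x => q h x * w x) = h %[ae mu].
  by apply: filterS w_neq0 => x wx Dx; rewrite /q divfK.
have sq h : measurable_fun setT h -> sqint nu (q h) = sqint mu h.
  move=> mh; rewrite -sqint_w; last exact: mq.
  by apply: sqint_eq_ae => //; apply: measurable_funM => //; exact: mq.
have nu_fin : (nu setT < +oo)%E by rewrite probability_setT ltry.
have e2 : 0 < e ^+ 2 / 2 by rewrite divr_gt0 ?exprn_gt0.
have approx (h : X1 p -> R) : measurable_fun setT h -> (sqint mu h < +oo)%E ->
    exists N (g : X1 p -> R), cylinder_fun N g /\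
      (sqint mu (fun x => h x - g x * w x)%R < (e ^+ 2 / 2)%:E)%E.
  move=> mh hi; have [|N [g [Ng hg]]] := cylinder_fun_dense nu nu_fin _ (mq h mh) _ _ e2.
    by rewrite sq.
  exists N, g; split => //; move: hg.
  have mg := measurable_cylinder_fun _ _ Ng.
  have md : measurable_fun setT (fun x => q h x - g x).
    by apply: measurable_funB => //; exact: mq.
  rewrite -sqint_w//; congr (_ < _)%E; apply: sqint_eq_ae.
  - exact: measurable_funM.
  - by apply: measurable_funB => //; exact: measurable_funM.
  - by apply: filterS (qw h) => x ex Dx; rewrite mulrBl ex.
have i1 : (sqint mu (@complex.Re R \o u) < +oo)%E.
  by apply: le_lt_trans ui; rewrite leeDl// sqint_ge0.
have i2 : (sqint mu (@complex.Im R \o u) < +oo)%E.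
  by apply: le_lt_trans ui; rewrite leeDr// sqint_ge0.
have [N1 [g1 [Ng1 h1]]] := approx _ m1 i1.
have [N2 [g2 [Ng2 h2]]] := approx _ m2 i2.
pose N := maxn N1 N2.
have {}Ng1 : cylinder_fun N g1 by apply: cylinder_fun_le Ng1; exact: leq_maxl.
have {}Ng2 : cylinder_fun N g2 by apply: cylinder_fun_le Ng2; exact: leq_maxr.
pose v : L2 mu := \sum_(a : {ffun 'I_N -> 'F_p})
  (g1 (row_of_ffun N a) +i* g2 (row_of_ffun N a)) *: cylvec N (row_of_ffun N a).
exists v.
  apply: lin_hull_sum => a; rewrite -[X in lin_hull _ X]addr0.
  apply: lin_hull_lin; last exact: lin_hull0.
  by apply: lin_hull_sub; exists N, (row_of_ffun N a).
have vE : (v : X1 p -> R[i]) = (fun x => (g1 x * w x) +i* (g2 x * w x)) %[ae mu].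
  have scE (a : {ffun 'I_N -> 'F_p}) :
      (((g1 (row_of_ffun N a) +i* g2 (row_of_ffun N a)) *: cylvec N (row_of_ffun N a)
        : L2 mu) : X1 p -> R[i]) = (fun x => (g1 (row_of_ffun N a) +i* g2 (row_of_ffun N a))
          * (cylfun N (row_of_ffun N a) x)%:C) %[ae mu].
    apply: filterS2 (L2_scaleE (g1 (row_of_ffun N a) +i* g2 (row_of_ffun N a))
      (cylvec N (row_of_ffun N a))) (cylvecE N (row_of_ffun N a)) => x ex1 ex2 Dx.
    by rewrite -ex2//; exact: ex1.
  apply: filterS (L2_sumE _ (index_enum _) _ _ scE) => x ex Dx; rewrite ex//.
  rewrite -[in RHS](sum_indic_cyl N x g1 Ng1) -[in RHS](sum_indic_cyl N x g2 Ng2).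
  rewrite !mulr_suml; apply/eqP; rewrite eq_complex; apply/andP; split; apply/eqP.
    rewrite [LHS](raddf_sum (@complex.Re R)) /=; apply: eq_bigr => a _.
    by rewrite /cylfun mulr0 subr0 mulrA.
  rewrite [LHS](raddf_sum (@complex.Im R)) /=; apply: eq_bigr => a _.
  by rewrite /cylfun mulr0 add0r mulrA.
apply: L2_norm_lt => //.
have [[m3 m4] _] := (L2_predP _ _).1 (L2_reprP (u - v)).
have mg1 := measurable_cylinder_fun _ _ Ng1.
have mg2 := measurable_cylinder_fun _ _ Ng2.
rewrite (splitr (e ^+ 2)) EFinD; apply: le_lt_trans (lteD h1 h2).
rewrite /sqnorm; apply: leeD; rewrite le_eqVlt; apply/orP; left; apply/eqP;
  apply: sqint_eq_ae => //.
- by apply: measurable_funB => //; exact: measurable_funM.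
- apply: filterS2 (L2_subE u v) vE => x ex1 ex2 Dx /=; rewrite ex1// ex2//.
  by case: (u x).
- by apply: measurable_funB => //; exact: measurable_funM.
- apply: filterS2 (L2_subE u v) vE => x ex1 ex2 Dx /=; rewrite ex1// ex2//.
  by case: (u x).
Qed.

End cylinder_vectors.

Section uniform_measure.
Context {R : realType} {p : nat} (p_prime : prime p).
Local Notation unif := (@uniform_weights R p).

Lemma uniform_weights_gt0 n r : (1 <= n)%N -> 0 < unif n r.
Proof. by move=> _; rewrite invr_gt0 ltr0n prime_gt0. Qed.

Lemma uniform_weight N (x : X1 p) : weight unif N x = p%:R ^- N.
Proof.
by rewrite /weight /uniform_weights prodr_const_nat subn1/= exprVn.
Qed.

(** All cylinders of one level have the same uniform mass; hence the group preserves [mu_inv]. *)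
Lemma uniform_dens N t (x : X1 p) : dens unif N t x = 1.
Proof.
by rewrite /dens !uniform_weight divff// invr_neq0// expf_neq0// pnatr_eq0 -lt0n prime_gt0.
Qed.

End uniform_measure.

Section equivalent_case.
Context {R : realType} {p : nat} (p_prime : prime p) (alpha : nat -> 'F_p -> R).
Hypothesis alpha_gt0 : forall n r, (1 <= n)%N -> 0 < alpha n r.
Variables mu mu_inv : probability (X1 p) R.
Hypothesis mu_alpha : is_product_measure alpha mu.
Hypothesis mu_invE : is_product_measure (@uniform_weights R p) mu_inv.
Hypothesis mu_equiv : measure_equivalent mu mu_inv.
Local Open Scope ereal_scope.

Let rho := Radon_Nikodym_SigmaFinite.f mu_inv mu.

Let inv_mu : mu_inv `<< mu. Proof. by case: mu_equiv. Qed.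

Let rho_ge0 x : 0 <= rho x.
Proof. exact: Radon_Nikodym_SigmaFinite.f_ge0. Qed.

Let rho_fin x : rho x \is a fin_num.
Proof. exact: Radon_Nikodym_SigmaFinite.f_fin_num. Qed.

Let rho_int : mu.-integrable setT rho.
Proof. exact: Radon_Nikodym_SigmaFinite.f_integrable. Qed.

Let mrho : measurable_fun setT rho.
Proof. exact: measurable_int rho_int. Qed.

Let integral_rho (h : X1 p -> \bar R) : measurable_fun setT h -> (forall x, 0 <= h x) ->
  \int[mu_inv]_x h x = \int[mu]_x (h x * rho x).
Proof.
by move=> mh h0; rewrite -(Radon_Nikodym_SigmaFinite.change_of_variables inv_mu).
Qed.

Let w (x : X1 p) : R := Num.sqrt (fine (rho x)).

Let w_sqr x : (w x ^+ 2)%:E = rho x.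
Proof. by rewrite sqr_sqrtr ?fineK// fine_ge0. Qed.

Let mw : measurable_fun setT w.
Proof.
apply: (measurableT_comp (continuous_measurable_fun _)).
  exact: sqrt_continuous.
exact: measurableT_comp mrho.
Qed.

Let w_ge0 x : (0 <= w x)%R. Proof. exact: sqrtr_ge0. Qed.

(** The zero set of rho is null for [mu_inv], hence for mu: this is where domination of mu by
    [mu_inv] enters. *)
Let w_neq0 : \forall x \ae mu, w x != 0%R.
Proof.
have mA : measurable [set x | rho x = 0].
  rewrite (_ : [set x | _] = setT `&` rho @^-1` [set 0]) ?setTI//.
  by rewrite -[X in measurable X]setTI; exact: mrho.
exists [set x | rho x = 0]; split => //.
- have A0 : mu_inv [set x | rho x = 0] = 0.
    rewrite (Radon_Nikodym_SigmaFinite.f_integral inv_mu)//.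
    exact: integral0_eq.
  by case: mu_equiv => /null_content_dominatesP h _; exact: h.
- move=> x /=; rewrite -w_sqr; case: eqP => [->|_]; last by move=> h; case: h.
  by rewrite expr0n.
Qed.

Let integral_w (h : X1 p -> \bar R) : measurable_fun setT h -> (forall x, 0 <= h x) ->
  \int[mu_inv]_x h x = \int[mu]_x (h x * (w x ^+ 2)%:E).
Proof.
by move=> mh h0; rewrite integral_rho//; apply: eq_integral => x _; rewrite w_sqr.
Qed.

(** Both sides integrate to mu_inv(A) over every A; on the left this combines the change of
    variables for mu with the invariance of [mu_inv]. The square root of this identity removes the
    density factor from the action on cylinder vectors. *)
Let rho_row1_mul N t : rowlevel N t ->
  ae_eq mu setT (fun x => rho (row1_mul x t) * (dens alpha N t x)%:E) rho.
Proof.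
move=> Nt; have mdens : measurable_fun setT (EFin \o dens alpha N t).
  by apply/measurable_EFinP; exact: measurable_dens.
have mrt : measurable_fun setT (fun x => rho (row1_mul x t)).
  by apply: measurableT_comp => //; exact: measurable_row1_mul.
have key A : measurable A ->
    \int[mu]_(x in A) (rho (row1_mul x t) * (dens alpha N t x)%:E) = mu_inv A.
  (* Chosen so that h(xt) is the indicator of A at x times rho(xt). *)
  move=> mA; pose h x := (\1_A (Ract t x))%:E * rho x.
  have mh1 : measurable_fun setT (fun x => (\1_A (Ract t x))%:E : \bar R).
    apply/measurable_EFinP; apply: measurableT_comp; first exact: measurable_indic.
    exact: measurable_Ract.
  rewrite integral_mkcond.
  transitivity (\int[mu]_x (h (row1_mul x t) * (dens alpha N t x)%:E)).
    apply: eq_integral => x _; rewrite /h -RactVE RactVK patchE indicE RactVE.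
    by case: (x \in A); rewrite ?mul1e ?mul0e.
  rewrite (integral_row1_mul alpha alpha_gt0 mu mu_alpha)//; last first.
  - by apply: emeasurable_funM.
  - by move=> x; rewrite mule_ge0// lee_fin.
  rewrite -integral_rho//.
  rewrite -(integral_row1_mul _ (uniform_weights_gt0 p_prime) _ mu_invE N t)//.
  rewrite -[in RHS](setIT A) -integral_indic//.
  apply: eq_integral => x _; rewrite uniform_dens// mule1.
  by rewrite -RactVE RactVK.
apply: integral_ae_eq => //.
- apply/integrableP; split; first exact: emeasurable_funM.
  under eq_integral => x _ do rewrite gee0_abs ?mule_ge0 ?lee_fin
    ?(ltW (dens_gt0 _ alpha_gt0 _ _ _))//.
  by rewrite key// probability_setT ltry.
- move=> A _ mA; rewrite key//.
  by rewrite (Radon_Nikodym_SigmaFinite.f_integral inv_mu).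
Qed.

Let xi := cylvec mu w.

Let xi_act t N x : quasi_regular t (xi N x) = xi N (Ract t x).
Proof.
have [M Mt] := ex_rowlevel t; apply: L2_eqP.
have c := cylvecE mu mu_inv w mw integral_w.
apply: filterS3 (quasi_regular_class alpha alpha_gt0 mu mu_alpha M t _ _ Mt (c N x))
  (c N (Ract t x)) (rho_row1_mul M t Mt) => y e1 e2 e3 Dy.
rewrite e1// e2// /wact -rmorphM/=; congr (_%:C)%C; rewrite /cylfun mulrCA.
congr (_ * _)%R.
  rewrite !indicE; congr ((nat_of_bool _)%:R)%R; apply/idP/idP; rewrite !inE.
    by rewrite -RactVE => /eqlv_sym/eqlv_RactP/eqlv_sym.
  by move=> /eqlv_sym/eqlv_RactP/eqlv_sym; rewrite RactVE.
by rewrite /w -(e3 Dy) fineM//= [RHS]sqrtrM ?fine_ge0 ?rho_ge0// mulrC.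
Qed.

Let xi_ip s d x y : L2_dot mu (xi (s + d) x) (xi s y) =
  if `[< eqlv s x y >] then (p%:R ^- (s + d))%R else 0%R.
Proof.
rewrite (cylvec_ip mu mu_inv w mw integral_w) ?leq_addr//; case: asboolP => // _.
rewrite (product_measure_cyl _ _ mu_invE) uniform_weight /=.
by rewrite fmorphV rmorphXn/= rmorph_nat.
Qed.

Lemma commutant_equivalent :
  exists Delta : nat -> 'F_p -> (L2 mu -> L2 mu),
      let Deltas := [set D | exists (s : nat) (r : 'F_p),
        [/\ (1 <= s)%N, r != 0%R & D = Delta s r]] in
      [/\ forall (s : nat) (r : 'F_p), (1 <= s)%N -> r != 0%R ->
            strong_limit (L2_dot mu) (Delta_partial mu s r) (Delta s r),
          commutant (L2_dot mu) (vN_algebra mu) =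
            weak_closure (L2_dot mu) (linear_span ([set id] `|` Deltas)) &
          commutant (L2_dot mu) (vN_algebra mu) =
            bicommutant (L2_dot mu) Deltas].
Proof.
have T_lin := quasi_regular_linear alpha alpha_gt0 mu mu_alpha.
have T_iso := quasi_regular_isometry alpha alpha_gt0 mu mu_alpha.
have T_mul := quasi_regularM alpha alpha_gt0 mu mu_alpha.
have T_one := quasi_regular1 alpha alpha_gt0 mu mu_alpha.
have xi_total := cylvec_total mu mu_inv w mw w_ge0 w_neq0 integral_w.
have xi_split := cylvec_split mu mu_inv w mw integral_w.
have [H1 H2 H3] := commutant_representation (L2_dot mu) p_prime (@quasi_regular R p mu) xi
  T_lin T_iso T_mul T_one (cylvec_ext mu w) xi_split xi_act xi_ip xi_total.
exists (Delta (L2_dot mu) (@quasi_regular R p mu) xi) => Ds.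
by rewrite (commutant_vN_algebra alpha alpha_gt0 mu mu_alpha); split.
Qed.

End equivalent_case.

(** * Singular measures *)

(** With b the average of B u over coordinate n, this isolates [B, M] u on the left and leaves its
    average on the right. *)
Lemma addKB {V : zmodType} (a b c d e : V) : a + b - c = d + b - e -> a - d = c - e.
Proof.
rewrite ![_ + b - _]addrAC => /addIr h; apply/eqP; rewrite subr_eq -(subrK c a) h.
by rewrite [X in X == _]addrC addrA [X in _ == X]addrAC.
Qed.

Section indicator_multiplication.
Context {d : measure_display} {T : measurableType d} {R : realType}.
Variable mu : {measure set T -> \bar R}.
Implicit Types (A : set T) (u v : L2 mu).
Local Open Scope complex_scope.

Let mulfun A (f : T -> R[i]) : T -> R[i] := fun x => (\1_A x)%:C * f x.

Let Re_mulfun A f : @complex.Re R \o mulfun A f =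
  (fun x => \1_A x * (@complex.Re R \o f) x).
Proof. by apply/funext => x; exact: Re_realM. Qed.

Let Im_mulfun A f : @complex.Im R \o mulfun A f =
  (fun x => \1_A x * (@complex.Im R \o f) x).
Proof. by apply/funext => x; exact: Im_realM. Qed.

Let measurable_mul A (h : T -> R) : measurable A -> measurable_fun setT h ->
  measurable_fun setT (fun x => \1_A x * h x).
Proof. by move=> mA mh; apply: measurable_funM => //; exact: measurable_indic. Qed.

Let sqint_mul A (h : T -> R) : measurable A -> measurable_fun setT h ->
  sqint mu (fun x => \1_A x * h x) = (\int[mu]_(x in A) (h x ^+ 2)%:E)%E.
Proof.
move=> mA mh; rewrite [RHS]integral_mkcond; apply: eq_integral => x _.
rewrite patchE indicE; case: (x \in A) => /=; first by rewrite mul1r.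
by rewrite mul0r expr0n.
Qed.

Let sqint_mul_le A (h : T -> R) : measurable A -> measurable_fun setT h ->
  (sqint mu (fun x => \1_A x * h x)%R <= sqint mu h)%E.
Proof.
move=> mA mh; rewrite sqint_mul//; apply: ge0_subset_integral => //.
  exact: measurable_sq.
by move=> x _; rewrite lee_fin sqr_ge0.
Qed.

Lemma sqnorm_mulfun A f : measurable A -> cmeasurable f ->
  sqnorm mu (mulfun A f) = (\int[mu]_(x in A)
    (complex.Re (f x) ^+ 2 + complex.Im (f x) ^+ 2)%:E)%E.
Proof.
move=> mA [m1 m2]; rewrite /sqnorm Re_mulfun Im_mulfun !sqint_mul//.
rewrite -ge0_integralD//.
- by move=> x _; rewrite lee_fin sqr_ge0.
- by apply: measurable_funTS; exact: (measurable_sq (@complex.Re R \o f)).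
- by move=> x _; rewrite lee_fin sqr_ge0.
- by apply: measurable_funTS; exact: (measurable_sq (@complex.Im R \o f)).
Qed.

Lemma cmeasurable_mulfun A f : measurable A -> cmeasurable f -> cmeasurable (mulfun A f).
Proof.
by move=> mA [m1 m2]; split; rewrite ?Re_mulfun ?Im_mulfun; exact: measurable_mul.
Qed.

Lemma sqnorm_mulfun_le A f : measurable A -> cmeasurable f ->
  (sqnorm mu (mulfun A f) <= sqnorm mu f)%E.
Proof.
by move=> mA [m1 m2]; rewrite /sqnorm Re_mulfun Im_mulfun leeD// sqint_mul_le.
Qed.

Definition Mul A u : L2 mu := L2class mu (fun x => (\1_A x)%:C * u x).

Lemma MulE A u : measurable A ->
  (Mul A u : T -> R[i]) = (fun x => (\1_A x)%:C * u x) %[ae mu].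
Proof.
move=> mA; apply: L2classE; have [mu_ ui] := (L2_predP _ _).1 (L2_reprP u).
apply/L2_predP; split; first exact: cmeasurable_mulfun.
exact: le_lt_trans (sqnorm_mulfun_le _ _ mA mu_) ui.
Qed.

Lemma sqnorm_Mul A u : measurable A -> sqnorm mu (Mul A u) =
  (\int[mu]_(x in A) (complex.Re (u x) ^+ 2 + complex.Im (u x) ^+ 2)%:E)%E.
Proof.
move=> mA; have [mu_ _] := (L2_predP _ _).1 (L2_reprP u).
have [mM _] := (L2_predP _ _).1 (L2_reprP (Mul A u)).
rewrite -sqnorm_mulfun//; apply: sqnorm_eq_ae => //; last exact: MulE.
exact: cmeasurable_mulfun.
Qed.

Lemma Mul_linear A : measurable A -> linear (Mul A).
Proof.
move=> mA a u v; apply: L2_eqP.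
apply: filterS3 (MulE A (a *: u + v) mA) (L2_linE a (Mul A u) (Mul A v))
  (filterI (L2_linE a u v) (filterI (MulE A u mA) (MulE A v mA))).
move=> x e1 e2 [e3 [e4 e5]] Dx; rewrite e1// e2// e3// e4// e5//.
by rewrite mulrDr mulrCA.
Qed.

Lemma MulI A A' u : measurable A -> measurable A' ->
  Mul A (Mul A' u) = Mul (A `&` A') u.
Proof.
move=> mA mA'; apply: L2_eqP.
apply: filterS3 (MulE A (Mul A' u) mA) (MulE A' u mA')
  (MulE (A `&` A') u (measurableI _ _ mA mA')) => x e1 e2 e3 Dx.
by rewrite e1// e2// e3// indicI mulrA -rmorphM.
Qed.

Lemma MulT u : Mul setT u = u.
Proof.
apply: L2_eqP; apply: filterS (MulE setT u measurableT) => x e Dx.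
by rewrite e// indicT mul1r.
Qed.

Lemma Mul_ip A u v : measurable A -> L2_dot mu (Mul A u) v = L2_dot mu u (Mul A v).
Proof.
move=> mA.
have [/measurable_int r1 /measurable_int i1] :=
  L2_integrable_mul (L2_reprP (Mul A u)) (L2_reprP v).
have [/measurable_int r2 /measurable_int i2] :=
  L2_integrable_mul (L2_reprP u) (L2_reprP (Mul A v)).
have E : \forall x \ae mu, Mul A u x * conjc (v x) = u x * conjc (Mul A v x).
  apply: filterS2 (MulE A u mA) (MulE A v mA) => x e1 e2.
  rewrite e1// e2// rmorphM/= -mulrA mulrCA.
  by congr (_ * (_ * _)); apply/eqP; rewrite eq_complex /= oppr0 !eqxx.
rewrite /L2_dot /L2_dotfun; congr (_ +i* _); rewrite /Rintegral; congr fine;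
  by apply: ae_eq_integral => //; apply: filterS E => x e _; rewrite /= e.
Qed.

End indicator_multiplication.

Section cylinder_split.
Context {R : realType} {p : nat}.

Lemma measure_cyl_split (nu : {measure set (X1 p) -> \bar R}) N x :
  nu (cyl N x) = (\sum_(r : 'F_p) nu (cyl N.+1 (shift N.+1 r x)))%E.
Proof.
rewrite (_ : cyl N x = \bigcup_(r in [set: 'F_p]) cyl N.+1 (shift N.+1 r x)); last first.
  apply/seteqP; split=> [y xy|y [r _ /eqlvS[xy _]]].
    exists (y N.+1 - x N.+1) => //; apply/eqlvS.
    split; last by rewrite shiftE// eqxx mul1r addrC subrK.
    by apply: eqlv_trans xy; exact: eqlv_shift.
  by apply: eqlv_trans xy; apply: eqlv_sym; exact: eqlv_shift.
rewrite measure_fin_bigcup.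
- rewrite (@fsbigE _ _ _ _ _ (index_enum 'F_p)).
  + by apply: eq_bigl => r; rewrite in_setT.
  + exact: index_enum_uniq.
  + by [].
  + by move=> r _; rewrite mem_index_enum.
- exact: finite_finset.
- move=> r r' _ _ [y [/eqlvS[_] + /eqlvS[_]]].
  by rewrite !shiftE// eqxx !mul1r => <- /addrI.
- by move=> r _; exact: measurable_cyl.
Qed.

End cylinder_split.

(** * The singular case: commutators with coordinate indicators *)

Section singular_case.
Context {R : realType} {p : nat} (p_prime : prime p) (alpha : nat -> 'F_p -> R).
Hypothesis alpha_gt0 : forall n r, (1 <= n)%N -> 0 < alpha n r.
Variables mu mu_inv : probability (X1 p) R.
Hypothesis mu_alpha : is_product_measure alpha mu.
Hypothesis mu_invE : is_product_measure (@uniform_weights R p) mu_inv.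
Hypothesis mu_sing : mutually_singular mu mu_inv.
Implicit Types (A : set (X1 p)) (u v g : L2 mu) (x y : X1 p) (t : B0N p).
Local Open Scope complex_scope.

Local Notation T := (@quasi_regular R p mu).
Local Notation nrm := (hilbert_norm (L2_dot mu)).
Let TE N t u := quasi_regularE alpha alpha_gt0 mu mu_alpha N t u.
Let T_lin t : linear (T t).
Proof. exact: (quasi_regular_linear alpha alpha_gt0 mu mu_alpha). Qed.
Let T_iso t u : nrm (T t u) = nrm u.
Proof. exact: (quasi_regular_isometry alpha alpha_gt0 mu mu_alpha). Qed.
Let T_mul s t u : T (s * t)%g u = T s (T t u).
Proof. exact: (quasi_regularM alpha alpha_gt0 mu mu_alpha). Qed.
Let T_one u : T 1%g u = u.
Proof. exact: (quasi_regular1 alpha alpha_gt0 mu mu_alpha). Qed.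
Let T_ip t u v : L2_dot mu (T t u) (T t v) = L2_dot mu u v.
Proof. exact: (isometry_ip (L2_dot mu) _ (T_lin t) (T_iso t)). Qed.

(** T t u at x depends on t only through the row xt. Sums of group operators can therefore be
    compared piece by piece over a partition of the rows. *)
Lemma quasi_regular_local A s t u : measurable A ->
  (forall x, A x -> row1_mul x s = row1_mul x t) -> Mul mu A (T s u) = Mul mu A (T t u).
Proof.
move=> mA st; have [N1 Ns] := ex_rowlevel s; have [N2 Nt] := ex_rowlevel t.
have {}Ns : rowlevel (maxn N1 N2) s by apply: rowlevel_le Ns; exact: leq_maxl.
have {}Nt : rowlevel (maxn N1 N2) t by apply: rowlevel_le Nt; exact: leq_maxr.
apply: L2_eqP; apply: filterS2 (filterI (MulE mu A (T s u) mA) (TE _ s u Ns))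
  (filterI (MulE mu A (T t u) mA) (TE _ t u Nt)) => x [e1 e2] [e3 e4] Dx.
rewrite e1// e2// e3// e4//.
have [xA|xA] := pselect (A x); last by rewrite indicE memNset// !mul0r.
by rewrite /wact /dens st.
Qed.

Lemma quasi_regular_action s t u : (forall x, row1_mul x s = row1_mul x t) -> T s u = T t u.
Proof.
by move=> st; rewrite -[LHS]MulT -[RHS]MulT; exact: quasi_regular_local.
Qed.

Lemma quasi_regular_Mul A A' t u : measurable A -> measurable A' ->
  (forall x, A' x <-> A (row1_mul x t)) -> T t (Mul mu A u) = Mul mu A' (T t u).
Proof.
move=> mA mA' AA'; have [N Nt] := ex_rowlevel t; apply: L2_eqP.
apply: filterS3 (quasi_regular_class alpha alpha_gt0 mu mu_alpha N t _ _ Nt (MulE mu A u mA))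
  (MulE mu A' (T t u) mA') (TE N t u Nt) => x e1 e2 e3 Dx.
rewrite e1// e2// e3// /wact mulrCA; congr (_%:C * _).
by rewrite !indicE; congr ((nat_of_bool _)%:R); apply/idP/idP; rewrite !inE => /AA'.
Qed.

Definition translation n (b : 'F_p) : B0N p := rowmx 0 n.+1 (fun j => (j == n)%:R * b).

Lemma translation_coord n b x j : (1 <= n)%N ->
  row1_mul x (translation n b) j = x j + (j == n)%:R * b.
Proof.
move=> n1; rewrite row1_mul_rowmx row1_0 mul1r; congr (_ + _).
by have [->|_] := eqVneq j n; rewrite ?n1 ?ltnSn ?mul1r// !mul0r mulr0.
Qed.

Definition average n u : L2 mu := p%:R^-1 *: \sum_(b : 'F_p) T (translation n b) u.

Let Pu : (p%:R : R[i]) != 0.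
Proof. by rewrite pnatr_eq0 -lt0n prime_gt0. Qed.

Lemma translation_average n b u : (1 <= n)%N ->
  T (translation n b) (average n u) = average n u.
Proof.
move=> n1; rewrite /average (linear_opZ _ (T_lin _)) (linear_op_sum _ (T_lin _)).
congr (_ *: _).
rewrite [RHS](reindex_inj (addrI b)) /=; apply: eq_bigr => c _.
rewrite -T_mul; apply: quasi_regular_action => x; rewrite row1_mulA.
by apply: X1_eqP => j _; rewrite !translation_coord// -addrA -mulrDr.
Qed.

Lemma Mul_average n A u : measurable A -> (1 <= n)%N ->
  (forall b x, A x <-> A (row1_mul x (translation n b))) ->
  average n (Mul mu A u) = Mul mu A (average n u).
Proof.
move=> mA n1 invA; have lM := Mul_linear mu A mA.
rewrite /average (linear_opZ _ lM) (linear_op_sum _ lM); congr (_ *: _).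
by apply: eq_bigr => b _; exact: quasi_regular_Mul.
Qed.

Let coord_set k a : set (X1 p) := [set x | x k = a].

Let measurable_coord_set k a : measurable (coord_set k a).
Proof. exact: measurable_coord. Qed.

Definition shear k a n (b : 'F_p) : B0N p :=
  (rowmx k n.+1 (fun j => (j == n)%:R * b)%R * translation n (- (a * b))%R)%g.

Lemma shear_coord k a n b x j : (1 <= k < n)%N ->
  row1_mul x (shear k a n b) j = x j + (j == n)%:R * ((x k - a) * b).
Proof.
move=> /andP[k1 kn]; have n1 := leq_trans k1 (ltnW kn).
rewrite row1_mulA translation_coord// row1_mul_rowmx -addrA; congr (_ + _).
have [->|_] := eqVneq j n; rewrite ?kn ?ltnSn/= ?mul1r ?mul0r ?mulr0 ?addr0//.
by rewrite mulrBl.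
Qed.

(* On [x k = a] the shears act trivially; elsewhere they run over all
   translations of the coordinate [n]. *)
Lemma shear_sum k a n u : (1 <= k < n)%N ->
  \sum_(b : 'F_p) T (shear k a n b) u = p%:R *:
    (Mul mu (coord_set k a) u + average n u - Mul mu (coord_set k a) (average n u)).
Proof.
move=> /[dup] kn /andP[k1 kn']; have n1 := leq_trans k1 (ltnW kn').
have pdecomp v : v = \sum_(c : 'F_p) Mul mu (coord_set k c) v.
  apply: L2_eqP; apply: filterS (L2_sumE mu _ (index_enum _) _ _
    (fun c : 'F_p => MulE mu (coord_set k c) v (measurable_coord_set k c))) => x e Dx.
  rewrite e// (bigD1 (x k))//= big1 ?addr0; first by rewrite indicE mem_set// mul1r.
  by move=> c cx; rewrite indicE memNset ?mul0r// => xc; rewrite -xc eqxx in cx.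
have lM c := Mul_linear mu _ (measurable_coord_set k c).
have Mcc c c' v : c != c' -> Mul mu (coord_set k c) (Mul mu (coord_set k c') v) = 0.
  move=> cc'; rewrite MulI//; apply: L2_eqP.
  apply: filterS2 (MulE mu _ v (measurableI _ _ (measurable_coord_set k c)
    (measurable_coord_set k c'))) (L2_zeroE mu) => x e1 e2 Dx; rewrite e1//.
  rewrite indicE memNset ?mul0r; first by rewrite [RHS]e2.
  by move=> [xc xc']; move: cc'; rewrite -xc -xc' eqxx.
have Mc c v : Mul mu (coord_set k c) (Mul mu (coord_set k c) v) = Mul mu (coord_set k c) v.
  by rewrite MulI// setIid.
have sumT v : p%:R *: average n v = \sum_(b : 'F_p) T (translation n b) v.
  by rewrite /average scalerA mulfV// scale1r.
rewrite [LHS]pdecomp [RHS]pdecomp; apply: eq_bigr => c _.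
rewrite (linear_op_sum _ (lM c)) (linear_opZ _ (lM c)).
rewrite (linear_opB _ (lM c)) (linear_opD _ (lM c)).
have [->|ca] := eqVneq c a.
  rewrite !Mc addrK [RHS](_ : _ = \sum_(b : 'F_p) Mul mu (coord_set k a) u).
    2: by rewrite sumr_const card_Fp// scaler_nat.
  apply: eq_bigr => b _.
  rewrite -[in RHS](T_one u); apply: quasi_regular_local => // x /= xk.
  rewrite row1_mul1; apply: X1_eqP => j _; rewrite shear_coord// xk.
  by rewrite subrr mul0r mulr0 addr0.
rewrite !Mcc// add0r subr0 -(linear_opZ _ (lM c)) sumT (linear_op_sum _ (lM c)).
have ca0 : c - a != 0 by rewrite subr_eq0.
(* For c != a, multiplication by c - a permutes the field, so the shears become all translations of
   coordinate n. *)
rewrite [RHS](reindex_inj (mulfI ca0)) /=; apply: eq_bigr => b _.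
apply: quasi_regular_local => // x /= xk.
by apply: X1_eqP => j _; rewrite shear_coord// translation_coord// xk.
Qed.

(* A vector invariant under all translations of the coordinates beyond [k] has
   [|g|^2 mu <= K mu_inv], which singularity rules out. *)
Lemma translation_invariant_eq0 k g :
  (forall n b, (k < n)%N -> T (translation n b) g = g) -> g = 0.
Proof.
move=> Tg; have [[m1 m2] gi] := (L2_predP _ _).1 (L2_reprP g).
pose f x := complex.Re (g x) ^+ 2 + complex.Im (g x) ^+ 2.
have f0 x : 0 <= f x by rewrite addr_ge0// sqr_ge0.
have mf : measurable_fun setT f.
  by apply: measurable_funD; apply: measurable_funX.
(* nu = |g|^2 mu, with total mass the squared norm of g. Translating a cylinder amounts to applying
   an isometry that fixes g. *)
pose nu : {measure set (X1 p) -> \bar R} := density_measure mu f mf f0.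
have nuE A : measurable A -> nu A = sqnorm mu (Mul mu A g).
  by move=> mA; rewrite sqnorm_Mul.
have nuT : nu setT = sqnorm mu g by rewrite nuE// MulT.
have nu_fin : (nu setT < +oo)%E by rewrite nuT.
have nuS N x r : (k <= N)%N -> nu (cyl N.+1 (shift N.+1 r x)) = nu (cyl N.+1 x).
  move=> kN; rewrite !nuE; try exact: measurable_cyl.
  have -> : Mul mu (cyl N.+1 (shift N.+1 r x)) g =
      T (translation N.+1 (- r)) (Mul mu (cyl N.+1 x) g).
    rewrite (quasi_regular_Mul _ (cyl N.+1 (shift N.+1 r x))) ?Tg//;
      try exact: measurable_cyl.
    move=> y; split=> xy j jN; have j1 : (1 <= j)%N by case/andP: jN.
      by rewrite translation_coord// -(xy j jN) shiftE// mulrN addrK.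
    by have := xy j jN; rewrite translation_coord// shiftE// => ->; rewrite mulrN subrK.
  exact: (sqnorm_quasi_regular alpha alpha_gt0 mu mu_alpha).
(* Beyond level k a cylinder splits into p parts of equal nu-mass, so each further level divides the
   mass by p. *)
have nu_cyl d x : (nu (cyl (k + d) x) <= (p%:R ^- d)%:E * nu setT)%E.
  elim: d x => [|d IH] x.
    rewrite addn0 expr0 invr1 mul1e le_measure ?inE//; exact: measurable_cyl.
  have := IH x; rewrite (measure_cyl_split nu).
  under eq_bigr do rewrite nuS ?leq_addr//.
  have iterE n (c : \bar R) : (0 <= c)%E -> iter n (adde c) 0%E = (n%:R%:E * c)%E.
    move=> c0; elim: n => [|n IHn]; first by rewrite mul0e.
    by rewrite iterS IHn -nat1r EFinD ge0_muleDl ?lee_fin// mul1e.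
  rewrite addnS big_const card_Fp// iterE// => h.
  have p0 : (p%:R : R) != 0 by rewrite pnatr_eq0 -lt0n prime_gt0.
  have pV0 : (0 <= (p%:R^-1 : R)%:E)%E by rewrite lee_fin invr_ge0 ler0n.
  have := lee_wpmul2l pV0 h; rewrite !muleA -!EFinM mulVf// mul1e.
  by rewrite -invfM -exprS.
have finE : nu setT = (fine (nu setT))%:E by rewrite fineK// ge0_fin_numE.
(* The factor p^k converts p^-d, counted from level k, into the uniform mass p^-(k + d) of the
   cylinder. *)
have nu_le A : measurable A -> (nu A <= (p%:R ^+ k * fine (nu setT))%:E * mu_inv A)%E.
  have K0 : 0 <= p%:R ^+ k * fine (nu setT).
    by rewrite mulr_ge0 ?exprn_ge0 ?ler0n// fine_ge0.
  have inv_fin : (mu_inv setT < +oo)%E by rewrite probability_setT ltry.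
  apply: (measure_le_cyl nu mu_inv _ k K0 nu_fin inv_fin) => N x kN.
 rewrite [X in (_ <= _ * X)%E](product_measure_cyl _ _ mu_invE) uniform_weight.
  rewrite -(subnKC kN).
  rewrite exprD invfM -EFinM mulrACA mulfV ?mul1r ?expf_neq0//; last first.
    by rewrite pnatr_eq0 -lt0n prime_gt0.
  by rewrite mulrC EFinM -finE.
have [A [mA A0 A0']] := mu_sing.
have nuA : nu A = 0%E.
  rewrite nuE// sqnorm_Mul// null_set_integral//.
  by apply: measurable_funTS; apply/measurable_EFinP; exact: mf.
have nuA' : nu (~` A) = 0%E.
  apply/eqP; rewrite eq_le measure_ge0 andbT.
  by rewrite (le_trans (nu_le _ (measurableC mA)))// A0' mule0.
apply: L2_eq0; apply/eqP; rewrite -nuT eq_le measure_ge0 andbT.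
rewrite -(adde0 0%E) -{1}nuA -nuA'; apply: measure_le_union => //.
  exact: measurableC.
by rewrite setUv.
Qed.

Lemma commutant_scalar : commutant (L2_dot mu) (range T) = @scalar_ops R[i] (L2 mu).
Proof.
apply/seteqP; split=> [B [bB BT]|_ [l ->]]; last first.
  split=> [|_ [t _ <-]]; last by apply/funext => u /=; rewrite (linear_opZ _ (T_lin t)).
  split=> [a u v|]; first by rewrite scalerDr !scalerA mulrC.
  by exists `|l| => u; rewrite hnrmZ.
have [lB _] := bB.
have B_T t u : B (T t u) = T t (B u).
  exact: (congr1 (fun f : L2 mu -> L2 mu => f u) (BT (T t) (ex_intro2 _ _ t I erefl))).
have B_average n u : B (average n u) = average n (B u).
  rewrite /average (linear_opZ _ lB) (linear_op_sum _ lB); congr (_ *: _).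
  by apply: eq_bigr => b _; exact: B_T.
have B_coord k a u : (1 <= k)%N ->
    B (Mul mu (coord_set k a) u) = Mul mu (coord_set k a) (B u).
  move=> k1; set M := Mul mu (coord_set k a).
  have lM : linear M by exact: Mul_linear.
  apply: (subr0_eq _); apply: (translation_invariant_eq0 k) => n b kn.
  have n1 : (1 <= n)%N by exact: leq_trans kn.
  have kkn : (1 <= k < n)%N by rewrite k1.
  set g := B (M u) - M (B u).
  have MC v : average n (M v) = M (average n v).
    apply: Mul_average => // c x; have e := translation_coord n c x k n1.
    rewrite (ltn_eqF kn) mul0r addr0 in e.
    by split=> xk; [exact: etrans e xk|exact: etrans (esym e) xk].
  have shears : B (\sum_(b : 'F_p) T (shear k a n b) u) =
      \sum_(b : 'F_p) T (shear k a n b) (B u).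
    by rewrite (linear_op_sum _ lB); apply: eq_bigr => c _; exact: B_T.
  suff -> : g = average n g by exact: translation_average.
  move: shears; rewrite !shear_sum// (linear_opZ _ lB) => /eqP.
  rewrite (inj_eq (scalerI Pu)) => /eqP.
  rewrite (linear_opB _ lB) (linear_opD _ lB) !B_average -/M => e.
  have lC : linear (average n).
    move=> c v w; rewrite /average scalerA mulrC -scalerA -scalerDr.
    congr (_ *: _); rewrite scaler_sumr -big_split/=; apply: eq_bigr => r _.
    exact: T_lin.
  rewrite /g (linear_opB _ lC) -B_average !MC.
  exact: addKB e.
have B_cyl N x u : B (Mul mu (cyl N x) u) = Mul mu (cyl N x) (B u).
  elim: N u => [|N IH] u.
    rewrite (_ : cyl 0 x = setT) ?MulT//.
    by apply/seteqP; split=> // y _ k /andP[/leq_trans h /h].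
  rewrite (_ : cyl N.+1 x = cyl N x `&` coord_set N.+1 (x N.+1)); last first.
    by apply/seteqP; split=> y /=; rewrite /cyl/= eqlvS; case=> ? e; split.
  by rewrite -!MulI ?IH ?B_coord//; exact: measurable_cyl.
pose w : X1 p -> R := cst 1.
have mw : measurable_fun setT w by exact: measurable_cst.
have w_neq0 : \forall x \ae mu, w x != 0 by apply: aeW => x; exact: oner_neq0.
have int_w (h : X1 p -> \bar R) : measurable_fun setT h -> (forall x, 0 <= h x)%E ->
    (\int[mu]_x h x = \int[mu]_x (h x * (w x ^+ 2)%:E))%E.
  by move=> _ _; apply: eq_integral => x _; rewrite expr1n mule1.
pose zeta := cylvec mu w.
have zE := cylvecE mu mu w mw int_w.
have ztot := cylvec_total mu mu w mw (fun=> ler01) w_neq0 int_w.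
have zip := cylvec_ip mu mu w mw int_w.
pose one := zeta 0%N (row1_pt p).
have zMul N x : zeta N x = Mul mu (cyl N x) one.
  apply: L2_eqP; apply: filterS3 (zE N x) (zE 0%N (row1_pt p))
    (MulE mu _ one (measurable_cyl N x)) => y e1 e2 e3 Dy.
  rewrite e1// e3// e2// -rmorphM/=; congr (_%:C); rewrite /cylfun mulrA; congr (_ * _).
  rewrite [X in _ * X]indicE mem_set ?mulr1//.
  by move=> k /andP[/leq_trans h /h].
have zMulK N x : Mul mu (cyl N x) (zeta N x) = zeta N x.
  by rewrite zMul MulI ?setIid//; exact: measurable_cyl.
have zip1 N x : L2_dot mu (zeta N x) (zeta N x) = (weight alpha N x)%:C.
  rewrite zip// asboolT//.
  by rewrite (product_measure_cyl alpha mu mu_alpha).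
have T_zeta N t x : rowlevel N t -> T t (zeta N x) =
    (Num.sqrt (weight alpha N x / weight alpha N (Ract t x)))%:C *: zeta N (Ract t x).
  move=> Nt; apply: L2_eqP.
  apply: filterS3 (quasi_regular_class alpha alpha_gt0 mu mu_alpha N t _ _ Nt (zE N x))
    (zE N (Ract t x)) (L2_scaleE (Num.sqrt (weight alpha N x /
      weight alpha N (Ract t x)))%:C (zeta N (Ract t x))) => y e1 e2 e3 Dy.
  rewrite e1// [RHS]e3// e2// /wact -!rmorphM/=; congr (_%:C).
  rewrite /cylfun /= !mulr1.
  have [xy|xy] := pselect (eqlv N (Ract t x) y).
    have xyt : eqlv N x (row1_mul y t).
      by apply: eqlv_sym; rewrite -RactVE; apply/eqlv_RactP; exact: eqlv_sym.
    rewrite !indicE !mem_set// !mulr1 /dens; congr (Num.sqrt (_ / _)).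
      exact/esym/cylinder_fun_weight.
    exact/esym/cylinder_fun_weight.
  rewrite !indicE !memNset ?mulr0// => xyt; apply: xy; apply: eqlv_sym.
  by apply/eqlv_RactP; rewrite RactVE; exact: eqlv_sym.
pose c N x := L2_dot mu (B one) (zeta N x).
(* Multiplication by the indicator is a self-adjoint projection commuting with B, so the coefficient
   is diagonal. *)
have cE N x : c N x = L2_dot mu (B (zeta N x)) (zeta N x).
  rewrite /c {2}zMul B_cyl Mul_ip; last exact: measurable_cyl.
  by rewrite zMulK.
(* A first-row matrix carries one cylinder onto the other. T t scales the indicator by the square
   root of the weight ratio, and this factor occurs twice in a diagonal coefficient. *)
have c_inv N x y : c N x = (weight alpha N x / weight alpha N y)%:C * c N y.
  pose t := rowmx 0 N.+1 (fun j => x j - y j).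
  have Nt : rowlevel N t.
    move=> k n Nn kn; rewrite /= /rowmx_val (ltn_eqF kn) add0r ltnS.
    by rewrite [(n <= N)%N]leqNgt Nn/= !andbF mul0r.
  have txy : eqlv N (Ract t x) y.
    move=> k /andP[k1 kN]; rewrite Ract_rowmx k1 ltnS kN row1_0 !mul1r.
    by rewrite opprB addrC subrK.
  have tz : T t (zeta N x) =
      (Num.sqrt (weight alpha N x / weight alpha N y))%:C *: zeta N y.
    rewrite T_zeta// (cylinder_fun_weight _ _ _ _ txy).
    by rewrite /zeta (cylvec_ext mu w _ _ _ txy).
  rewrite !cE -(T_ip t) -B_T tz (linear_opZ _ lB).
  rewrite [LHS](linearZl_LR (L2_dot mu)) /=.
  rewrite [X in _ * X = _](linearZr_LR (L2_dot mu)) /= mulrA.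
  congr (_ * _); rewrite (_ : Num.conj _ =
    (Num.sqrt (weight alpha N x / weight alpha N y))%:C); last exact: conjc_real.
  rewrite -rmorphM /= -expr2 sqr_sqrtr//.
  by rewrite divr_ge0// ltW// (weight_gt0 _ alpha_gt0).
have one_sum N : one = \sum_(a : {ffun 'I_N -> 'F_p}) zeta N (row_of_ffun N a).
  apply: L2_eqP; apply: filterS2 (zE 0%N (row1_pt p)) (L2_sumE mu _ (index_enum _) _ _
    (fun a : {ffun 'I_N -> 'F_p} => zE N (row_of_ffun N a))) => y e1 e2 Dy.
  rewrite e1// e2// -[RHS](raddf_sum (real_complex R)) /=; congr (_%:C).
  rewrite /cylfun -mulr_suml; congr (_ * _).
  rewrite indicE mem_set; last by move=> k /andP[/leq_trans h /h].
  rewrite -[LHS](sum_indic_cyl N y (cst 1))//.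
  by apply: eq_bigr => a _; rewrite mul1r.
have weight_sum N : \sum_(a : {ffun 'I_N -> 'F_p}) weight alpha N (row_of_ffun N a) = 1.
  have : mu setT = 1%E by exact: probability_setT.
  rewrite (measure_cylinder_set mu N setT)//.
  rewrite (eq_bigr (fun a => (weight alpha N (row_of_ffun N a))%:E)); last first.
    by move=> a _; exact: product_measure_cyl.
  rewrite sumEFin => -[<-]; apply: eq_bigl => a; exact/esym/asboolT.
pose l := L2_dot mu (B one) one.
have cl N x : c N x = l * (weight alpha N x)%:C.
  rewrite /l {2}(one_sum N) [L2_dot _ _ _](ip_sumr (L2_dot mu)) /=.
  rewrite mulr_suml (eq_bigr (fun a => c N x * (weight alpha N (row_of_ffun N a))%:C)).
    by rewrite -mulr_sumr -[X in _ * X](raddf_sum (real_complex R)) /= weight_sum mulr1.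
  move=> a _; rewrite -/(c N (row_of_ffun N a)) (c_inv N (row_of_ffun N a) x).
  rewrite mulrAC -rmorphM/= divfK 1?mulrC// gt_eqF// (weight_gt0 _ alpha_gt0).
  by [].
have Bone : B one = l *: one.
  apply: subr0_eq; apply: (total_orthogonal (L2_dot mu) _ _ ztot) => _ [N [x ->]].
  rewrite linearBl/= linearZl_LR/= -/(c N x) cl; apply/eqP; rewrite subr_eq0.
  apply/eqP; congr (_ * _); rewrite -zip1 {1}zMul.
  by rewrite Mul_ip ?zMulK//; exact: measurable_cyl.
exists l; apply: (total_eq (L2_dot mu) _ _ _ ztot) => //.
- split=> [a u v|]; first by rewrite scalerDr !scalerA mulrC.
  by exists `|l| => u; rewrite hnrmZ.
- move=> _ [N [x ->]]; rewrite -/(zeta N x) zMul B_cyl Bone.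
  by rewrite (linear_opZ _ (Mul_linear mu _ (measurable_cyl N x))).
Qed.

End singular_case.

(** * Kakutani's dichotomy *)

Section almost_disjoint.
Context {d : measure_display} {T : measurableType d} {R : realType}.
Variables mu nu : {measure set T -> \bar R}.
Local Open Scope ereal_scope.

Let small_le (x e : R) (y : \bar R) : (0 < e)%R ->
  (forall n : nat, y <= (e / (2 ^ n.+1)%:R)%:E) -> y <= 0.
Proof.
move=> e0 h; apply/lee_addgt0Pr => eps eps0; rewrite add0e.
have [n _ hn] := near_infty_natSinv_expn_lt (PosNum (divr_gt0 eps0 e0)).
apply: (le_trans (h n)); rewrite lee_fin; have := hn n (leqnn n).
rewrite /= ltr_pdivlMr// => /ltW; apply: le_trans.
rewrite mulrC ler_pM2r// div1r -natrX lef_pV2 ?posrE ?ltr0n ?expn_gt0//.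
by rewrite ler_nat leq_exp2l.
Qed.

(** The union of sets for the tolerances e / 2^(n + 1) has mu-mass at most e and a nu-null
    complement; intersecting such unions for smaller and smaller e removes the mu-mass as well. *)
Lemma mutually_singular_approx :
  (forall e : R, (0 < e)%R -> exists E, [/\ measurable E, mu E <= e%:E &
    nu (~` E) <= e%:E]) ->
  mutually_singular mu nu.
Proof.
move=> h.
have h1 e : (0 < e)%R -> exists B, [/\ measurable B, mu B <= e%:E & nu (~` B) = 0].
  move=> e0.
  have e0n n : (0 < e / (2 ^ n.+1)%:R)%R by rewrite divr_gt0// ltr0n expn_gt0.
  have [E EP] := choice (fun n => h _ (e0n n)).
  have mE n : measurable (E n) by case: (EP n).
  have mB : measurable (\bigcup_n E n) by exact: bigcup_measurable.
  exists (\bigcup_n E n); split => //.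
    apply: le_trans (epsilon_trick0 xpredT (ltW e0)).
    apply: le_trans (measure_sigma_subadditive mu mE mB (@subset_refl _ _)) _.
    by apply: lee_nneseries => // n _; case: (EP n).
  apply/eqP; rewrite eq_le measure_ge0 andbT; apply: (small_le 0 e) => // n.
  have [_ _ hn] := EP n; apply: le_trans hn; apply: le_measure; rewrite ?inE.
  - exact: measurableC.
  - exact: measurableC.
  - by apply: subsetC; exact: bigcup_sup.
have e0n n : (0 < 1 / (2 ^ n.+1)%:R :> R)%R by rewrite divr_gt0// ltr0n expn_gt0.
have [B BP] := choice (fun n => h1 _ (e0n n)).
have mB n : measurable (B n) by case: (BP n).
have mA : measurable (\bigcap_n B n) by exact: bigcapT_measurable.
exists (\bigcap_n B n); split => //.
  apply/eqP; rewrite eq_le measure_ge0 andbT; apply: (small_le 0 1) => // n.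
  have [_ hn _] := BP n; apply: le_trans hn; apply: le_measure; rewrite ?inE//.
  exact: bigcap_inf.
rewrite setC_bigcap; apply/negligibleP.
  by apply: bigcup_measurable => n _; exact: measurableC.
apply: negligible_bigcup => n; apply/negligibleP; first exact: measurableC.
by case: (BP n).
Qed.

End almost_disjoint.

Section product_bounds.
Variables (F : realFieldType) (d : nat -> F) (m : nat).
Hypothesis d01 : forall k, (m <= k)%N -> 0 <= d k <= 1.

Lemma prod_one_sub01 n : 0 <= \prod_(m <= k < n) (1 - d k) <= 1.
Proof.
rewrite big_nat; apply/andP; split.
  by apply: prodr_ge0 => k /andP[/d01/andP[_ h] _]; rewrite subr_ge0.
apply: prodr_ile1 => k /andP[/d01/andP[d0 d1] _].
by rewrite subr_ge0 d1 gerBl.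
Qed.

(** From (1 - e)(1 + S + e) <= 1 + S. Quantifies that a divergent sum forces the product to 0. *)
Lemma prod_one_sub_upper n :
  \prod_(m <= k < n) (1 - d k) * (1 + \sum_(m <= k < n) d k) <= 1.
Proof.
have [nm|/ltnW/subnKC<-] := leqP n m; first by rewrite !big_geq// addr0 mulr1.
elim: (n - m)%N => [|k IH]; first by rewrite addn0 !big_geq// addr0 mulr1.
rewrite addnS !big_nat_recr ?leq_addr//=; apply: le_trans IH.
have /andP[P0 _] := prod_one_sub01 (m + k)%N.
have S0 : 0 <= \sum_(m <= i < m + k) d i.
  by rewrite big_nat; apply: sumr_ge0 => i /andP[/d01/andP[]].
have /andP[] := d01 (m + k)%N (leq_addr _ _).
move: (\prod_(_ <= _ < _) _) (\sum_(_ <= _ < _) _) (d _) P0 S0 => P S e P0 S0 e0 e1.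
rewrite -subr_ge0 (_ : _ - _ = P * (e * (S + e))); last by ring.
by rewrite !mulr_ge0// addr_ge0.
Qed.

(** The Weierstrass inequality: a tail of sum below 1/2 keeps its product above 1/2. *)
Lemma prod_one_sub_lower n :
  1 - \sum_(m <= k < n) d k <= \prod_(m <= k < n) (1 - d k).
Proof.
have [nm|/ltnW/subnKC<-] := leqP n m; first by rewrite !big_geq// subr0.
elim: (n - m)%N => [|k IH]; first by rewrite addn0 !big_geq// subr0.
rewrite addnS !big_nat_recr ?leq_addr//=.
have /andP[_ P1] := prod_one_sub01 (m + k)%N.
have /andP[] := d01 (m + k)%N (leq_addr _ _).
move: (\prod_(_ <= _ < _) _) (\sum_(_ <= _ < _) _) (d _) P1 IH => P S e P1 PS e0 e1.
by rewrite mulrBr mulr1 opprD addrA lerB// ler_piMl.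
Qed.

End product_bounds.

Section kakutani.
Context {R : realType} {p : nat} (p_prime : prime p) (alpha : nat -> 'F_p -> R).
Hypothesis alpha_gt0 : forall n r, (1 <= n)%N -> 0 < alpha n r.
Hypothesis alpha_sum1 : forall n, (1 <= n)%N -> \sum_(r : 'F_p) alpha n r = 1.
Variables mu mu_inv : probability (X1 p) R.
Hypothesis mu_alpha : is_product_measure alpha mu.
Hypothesis mu_invE : is_product_measure (@uniform_weights R p) mu_inv.

Let P_gt0 : 0 < (p%:R : R).
Proof. by rewrite ltr0n prime_gt0. Qed.

(* the Hellinger affinity of [alpha n] and the uniform distribution *)
Definition affinity n : R := \sum_(k : 'F_p) Num.sqrt (alpha n k / p%:R).

Definition affinity_prod N : R := \prod_(1 <= n < N.+1) affinity n.

Definition SL11_term n : R := \sum_(r : 'F_p | r != 0)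
  (1 - \sum_(k : 'F_p) Num.sqrt (alpha n (k + r) * alpha n k)).

Lemma SL11_termE n : (1 <= n)%N -> SL11_term n = p%:R * (1 - affinity n ^+ 2).
Proof.
move=> n1; have a0 k : 0 <= alpha n k by rewrite ltW ?alpha_gt0.
(* Summed over all r, the double sum factors as a square; its r = 0 part is the total mass 1, and p
   - 1 values of r remain. *)
have E : \sum_(r : 'F_p) \sum_(k : 'F_p) Num.sqrt (alpha n (k + r) * alpha n k) =
    (\sum_(k : 'F_p) Num.sqrt (alpha n k)) ^+ 2.
  rewrite exchange_big /= expr2 mulr_suml; apply: eq_bigr => k _.
  rewrite mulr_sumr [RHS](reindex_inj (addrI k)) /=; apply: eq_bigr => r _.
  by rewrite sqrtrM// mulrC.
have -> : affinity n = (\sum_(k : 'F_p) Num.sqrt (alpha n k)) / Num.sqrt p%:R.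
  rewrite /affinity mulr_suml; apply: eq_bigr => k _.
  by rewrite sqrtrM// sqrtrV// ltW.
rewrite expr_div_n sqr_sqrtr ?ltW// mulrBr mulr1 mulrC divfK ?gt_eqF// -E.
rewrite /SL11_term sumrB sumr_const [X in _ = _ - X](bigD1 0)//=.
have -> : \sum_(k : 'F_p) Num.sqrt (alpha n (k + 0) * alpha n k) = 1.
  rewrite -[RHS](alpha_sum1 n n1); apply: eq_bigr => k _.
  by rewrite addr0 -expr2 sqrtr_sqr ger0_norm.
have -> : #|[pred r : 'F_p | r != 0]| = p.-1.
  by have := cardC1 (0 : 'F_p); rewrite card_Fp.
have -> : (p%:R : R) = 1 + p.-1%:R by rewrite nat1r prednK// prime_gt0.
by ring.
Qed.

Lemma SL11_term_ge0 n : (1 <= n)%N -> 0 <= SL11_term n.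
Proof.
move=> n1; apply: sumr_ge0 => r _; rewrite subr_ge0.
have -> : 1 = \sum_(k : 'F_p) (alpha n (k + r) + alpha n k) / 2.
  rewrite -mulr_suml big_split/= alpha_sum1// [X in X + _](_ : _ = 1).
    by rewrite -[1 + 1]/(2%:R) divff.
  by rewrite -[RHS](alpha_sum1 n n1) [RHS](reindex_inj (addIr r)).
apply: ler_sum => k _; rewrite sqrtrM; last by rewrite ltW// alpha_gt0.
have h (x y : R) : 0 <= x -> 0 <= y -> Num.sqrt x * Num.sqrt y <= (x + y) / 2.
  move=> x0 y0; rewrite ler_pdivlMr//.
  rewrite -{2}(sqr_sqrtr x0) -{2}(sqr_sqrtr y0) -subr_ge0.
  by rewrite (_ : _ - _ = (Num.sqrt x - Num.sqrt y) ^+ 2) ?sqr_ge0//; ring.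
by apply: h; rewrite ltW ?alpha_gt0.
Qed.

Lemma affinity_gt0 n : (1 <= n)%N -> 0 < affinity n.
Proof.
move=> n1; rewrite /affinity (bigD1 0)//= ltr_pwDl//.
  by rewrite sqrtr_gt0 divr_gt0// alpha_gt0.
by apply: sumr_ge0 => k _; exact: sqrtr_ge0.
Qed.

Lemma affinity_prod_gt0 N : 0 < affinity_prod N.
Proof.
rewrite /affinity_prod big_nat; apply: prodr_gt0 => n /andP[n1 _].
exact: affinity_gt0.
Qed.

Let defect n : R := 1 - affinity n ^+ 2.

Let SL11_defect n : (1 <= n)%N -> SL11_term n = p%:R * defect n.
Proof. exact: SL11_termE. Qed.

Let defect_ge0 n : (1 <= n)%N -> 0 <= defect n.
Proof.
by move=> n1; rewrite -(pmulr_rge0 _ P_gt0) -SL11_defect// SL11_term_ge0.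
Qed.

Let defect01 n : (1 <= n)%N -> 0 <= defect n <= 1.
Proof. by move=> n1; rewrite defect_ge0//= lerBlDr lerDl sqr_ge0. Qed.

Let affinity_prod_sqr N : affinity_prod N ^+ 2 = \prod_(1 <= n < N.+1) (1 - defect n).
Proof.
by rewrite -prodrXl; apply: eq_bigr => n _; rewrite /defect subKr.
Qed.

Let partial_SL11 N : (\sum_(1 <= n < N) (SL11_term n)%:E =
  (p%:R * \sum_(1 <= n < N) defect n)%:E)%E.
Proof.
rewrite sumEFin; congr (_%:E); rewrite mulr_sumr !big_nat.
by apply: eq_bigr => n /andP[n1 _]; exact: SL11_termE.
Qed.

Lemma SL11_infinite :
  SL11 alpha = +oo%E <-> forall e, 0 < e -> exists N, affinity_prod N <= e.
Proof.
have t0 n : (1 <= n)%N -> true -> (0 <= (SL11_term n)%:E)%E.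
  by move=> n1 _; rewrite lee_fin SL11_term_ge0.
have SE : SL11 alpha = (\sum_(1 <= n <oo) (SL11_term n)%:E)%E by [].
have le_SL11 (M : R) : (forall N, p%:R * \sum_(1 <= n < N) defect n <= M) ->
    (SL11 alpha <= M%:E)%E.
  move=> h; rewrite SE; apply: lime_le; first exact: is_cvg_nneseries.
  by apply: nearW => N; rewrite partial_SL11 lee_fin.
split=> [Soo e e0|small].
  apply: contrapT => /forallNP h.
  suff /le_SL11 : forall N,
      (* If all affinity products exceed e, [prod_one_sub_upper] bounds the partial sums of defects
         by e^-2. *)
      p%:R * \sum_(1 <= n < N) defect n <= p%:R * (e ^+ 2)^-1 by rewrite Soo.
  move=> [|N]; rewrite ler_pM2l//; first by rewrite big_geq// invr_ge0 sqr_ge0.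
  have e1 : e ^+ 2 <= \prod_(1 <= n < N.+1) (1 - defect n).
    have a0 := affinity_prod_gt0 N.
    rewrite -affinity_prod_sqr ler_sqr ?nnegrE; [|exact: ltW..].
    by rewrite leNgt; apply/negP => lt; apply: (h N); exact: ltW.
  have := prod_one_sub_upper _ _ _ defect01 N.+1.
  have : 0 <= \sum_(1 <= n < N.+1) defect n.
    by rewrite big_nat; apply: sumr_ge0 => n /andP[/defect_ge0].
  rewrite -[(_ ^+ 2)^-1]div1r ler_pdivlMr ?exprn_gt0//.
  by move: e1; nra.
apply/eqP; rewrite eq_le leey /= leNgt; apply/negP => Slt.
have S0 : (0 <= SL11 alpha)%E by apply: nneseries_ge0.
have Sfin : (SL11 alpha)%E = (fine (SL11 alpha))%:E by rewrite fineK// ge0_fin_numE.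
set S := fine (SL11 alpha) in Sfin.
have Sle N : p%:R * \sum_(1 <= n < N) defect n <= S.
  by rewrite -lee_fin -Sfin -partial_SL11 SE; apply: nneseries_lim_ge.
(* From M on the defects sum to less than 1/2, since p times their partial sums never exceeds S. *)
have [M hM] : exists M, S - p%:R / 2 < p%:R * \sum_(1 <= n < M) defect n.
  apply: contrapT => /forallNP h.
  have /le_SL11 : forall N, p%:R * \sum_(1 <= n < N) defect n <= S - p%:R / 2.
    by move=> N; rewrite leNgt; apply/negP => /h.
  by rewrite Sfin lee_fin; move: P_gt0; lra.
wlog M1 : M hM / (1 <= M)%N => [wl|].
  case: M hM => [|M] hM; last exact: (wl M.+1).
  by apply: (wl 1%N) => //; move: hM; rewrite !big_geq.
have low N : (M <= N)%N -> (affinity_prod M.-1) ^+ 2 / 2 <= (affinity_prod N) ^+ 2.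
  move=> MN; rewrite !affinity_prod_sqr prednK//.
  rewrite [leRHS](@big_cat_nat _ _ _ M)//= ?(leq_trans MN)//.
  apply: ler_wpM2l.
    by have /andP[] := prod_one_sub01 _ _ _ defect01 M.
  have d01 k : (M <= k)%N -> 0 <= defect k <= 1 by move/(leq_trans M1)/defect01.
  apply: le_trans (prod_one_sub_lower _ _ _ d01 N.+1).
  have := Sle N.+1; rewrite (@big_cat_nat _ _ _ M)//= ?(leq_trans MN)//.
  by move: hM P_gt0; nra.
have q0 := affinity_prod_gt0 M.-1.
(* By [low] the squared products from M on stay above half the square at M - 1, whereas halving the
   product would leave a quarter. *)
have [N hN] := small (affinity_prod M.-1 / 2) (divr_gt0 q0 (ltr0Sn _ 1)).
have aM : affinity_prod (maxn M N) <= affinity_prod M.-1 / 2.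
  apply: le_trans hN.
  rewrite -ler_sqr ?nnegrE; [|exact/ltW/affinity_prod_gt0..].
  rewrite !affinity_prod_sqr [leLHS](@big_cat_nat _ _ _ N.+1)//= ?ltnS ?leq_maxr//.
  apply: ler_piMr; first by have /andP[] := prod_one_sub01 _ _ _ defect01 N.+1.
  have d01 k : (N < k)%N -> 0 <= defect k <= 1.
    by move=> Nk; apply: defect01; apply: leq_trans Nk.
  by have /andP[] := prod_one_sub01 _ _ _ d01 (maxn M N).+1.
have := low _ (leq_maxl M N); have := affinity_prod_gt0 (maxn M N).
by move: aM q0; nra.
Qed.

Lemma affinity_prod_sum N : affinity_prod N = \sum_(a : {ffun 'I_N -> 'F_p})
  Num.sqrt (weight alpha N (row_of_ffun N a) * p%:R ^- N).
Proof.
rewrite /affinity_prod /affinity big_add1 big_mkord bigA_distr_bigA /=.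
apply: eq_bigr => a _; rewrite /weight big_add1 big_mkord -exprVn.
have -> : (p%:R^-1 : R) ^+ N = \prod_(i < N) p%:R^-1.
  by rewrite prodr_const card_ord.
rewrite -big_split /=; elim/big_rec2: _ => [|i x y _ ->]; first by rewrite sqrtr1.
rewrite -sqrtrM; first by rewrite valK.
by rewrite divr_ge0// ltW// alpha_gt0.
Qed.

Local Open Scope ereal_scope.

Let w N (a : {ffun 'I_N -> 'F_p}) := weight alpha N (row_of_ffun N a).

Let w_gt0 N a : (0 < @w N a)%R.
Proof. exact: weight_gt0. Qed.

Let pV_gt0 N : (0 < p%:R ^- N :> R)%R.
Proof. by rewrite invr_gt0 exprn_gt0. Qed.

Let mu_cylinder N C : cylinder_set N C ->
  mu C = (\sum_(a | `[< C (row_of_ffun N a) >]) w N a)%:E.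
Proof.
move=> NC; rewrite (measure_cylinder_set mu N C)// -sumEFin.
by apply: eq_bigr => a _; exact: product_measure_cyl.
Qed.

Let mu_inv_cylinder N C : cylinder_set N C ->
  mu_inv C = (\sum_(a : {ffun 'I_N -> 'F_p} | `[< C (row_of_ffun N a) >]) p%:R ^- N)%:E.
Proof.
move=> NC; rewrite (measure_cylinder_set mu_inv N C)// -sumEFin.
apply: eq_bigr => a _; rewrite -(@uniform_weight R p N (row_of_ffun N a)).
exact: product_measure_cyl.
Qed.

(** The likelihood ratio test: on C the mu-weight is the smaller one, off C the uniform weight is.
    The smaller of two positive numbers is at most their geometric mean, so the affinity bounds both
    errors. *)
Lemma affinity_singular : (forall e : R, (0 < e)%R -> exists N, (affinity_prod N <= e)%R) ->
  mutually_singular mu mu_inv.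
Proof.
move=> small; apply: mutually_singular_approx => e /small[N hN].
pose C := [set x : X1 p | (weight alpha N x <= p%:R ^- N)%R].
have NC : cylinder_set N C.
  by move=> x y xy; rewrite /C /= (cylinder_fun_weight _ _ _ _ xy).
exists C; split.
- exact: measurable_cylinder_set NC.
- rewrite [leLHS](mu_cylinder _ _ NC) lee_fin (le_trans _ hN)// affinity_prod_sum.
  rewrite [leRHS](bigID (fun a => `[< C (row_of_ffun N a) >])) /= ler_wpDr//.
    by apply: sumr_ge0 => a _; exact: sqrtr_ge0.
  apply: ler_sum => a /asboolP h; rewrite -/(w N a).
  rewrite -{1}(ger0_norm (ltW (w_gt0 N a))) -sqrtr_sqr ler_wsqrtr// expr2.
  by rewrite ler_wpM2l// ltW.
- rewrite [leLHS](mu_inv_cylinder _ _ (cylinder_setC _ _ NC)) lee_fin (le_trans _ hN)//.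
  rewrite affinity_prod_sum.
  rewrite [leRHS](bigID (fun a => `[< (~` C) (row_of_ffun N a) >])) /= ler_wpDr//.
    by apply: sumr_ge0 => a _; exact: sqrtr_ge0.
  apply: ler_sum => a /asboolP /negP; rewrite -ltNge => /ltW h.
  rewrite -{1}(ger0_norm (ltW (pV_gt0 N))) -sqrtr_sqr ler_wsqrtr// expr2.
  by rewrite ler_wpM2r// ltW.
Qed.

(** A cylinder set C close to the separating set has small mu-mass and a complement of small uniform
    mass. The affinity is split over C and its complement, where one of the two laws is small. *)
Lemma singular_affinity : mutually_singular mu mu_inv ->
  forall e : R, (0 < e)%R -> exists N, (affinity_prod N <= e)%R.
Proof.
move=> [A [mA muA muiA]] e e0; pose d := (e / 2)%R.
have d0 : (0 < d)%R by rewrite divr_gt0.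
have fin : measure_add mu mu_inv setT < +oo.
  by rewrite measure_addE lte_add_pinfty// ?fin_num_fun_lty.
have d2 : (0 < d ^+ 2)%R by rewrite exprn_gt0.
have [N [C [NC hC']]] := cylinder_set_approx _ fin A mA _ d2.
have hC : mu (A `+` C) + mu_inv (A `+` C) < (d ^+ 2)%:E.
  by rewrite -(measure_addE mu mu_inv).
have mC := measurable_cylinder_set _ _ NC.
have mAC : measurable (A `+` C) by apply: measurableU; exact: measurableD.
have muC : mu C <= (d ^+ 2)%:E.
  apply: le_trans (ltW (le_lt_trans (leeDl _ _) hC)) => //.
  rewrite -[leRHS]add0e -muA; apply: measure_le_union => // x Cx.
  by have [Ax|Ax] := pselect (A x); [left|right; right].
have muiC : mu_inv (~` C) <= (d ^+ 2)%:E.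
  apply: le_trans (ltW (le_lt_trans (leeDr _ _) hC)) => //.
  rewrite -[leRHS]add0e -muiA; apply: measure_le_union => //.
  - exact: measurableC.
  - exact: measurableC.
  - by move=> x Cx; have [Ax|Ax] := pselect (A x); [right; left|left].
exists N; rewrite affinity_prod_sum (bigID (fun a => `[< C (row_of_ffun N a) >])) /=.
(* Weighted so that masses d^2 and 1 contribute d / 2 each; the two pieces then add up to 2 d =
   e. *)
have agm x y : (0 < x -> 0 < y -> Num.sqrt (x * y) <= d^-1 / 2 * x + d / 2 * y)%R.
  move=> x0 y0; rewrite sqrtrM; last exact: ltW.
  have dE : (d * d^-1 = 1)%R by rewrite divff// gt_eqF.
  have i0 : (0 < d^-1)%R by rewrite invr_gt0.
  have := sqr_sqrtr (ltW x0); have := sqr_sqrtr (ltW y0).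
  move: (Num.sqrt x) (Num.sqrt y) => X Y <- <-.
  rewrite -subr_ge0 (_ : _ - _ = (d^-1 * X - Y) ^+ 2 * (d / 2))%R.
    by rewrite mulr_ge0 ?sqr_ge0// ltW// divr_gt0.
  by field; rewrite gt_eqF.
have agm_sum (P : pred {ffun 'I_N -> 'F_p}) (x y : {ffun 'I_N -> 'F_p} -> R) :
    (forall a, 0 < x a)%R -> (forall a, 0 < y a)%R ->
    (\sum_(a | P a) x a <= d ^+ 2)%R -> (\sum_(a | P a) y a <= 1)%R ->
    (\sum_(a | P a) Num.sqrt (x a * y a) <= d)%R.
  move=> x0 y0 X Y.
  apply: (@le_trans _ _ (\sum_(a | P a) (d^-1 / 2 * x a + d / 2 * y a))%R).
    by apply: ler_sum => a _; exact: agm.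
  rewrite big_split /= -!mulr_sumr {3}(splitr d) lerD//.
    rewrite -ler_pdivlMl ?divr_gt0 ?invr_gt0//; apply: le_trans X _.
    by rewrite [leRHS](_ : _ = d ^+ 2)%R//; field; rewrite gt_eqF.
  by rewrite ler_piMr// ltW// divr_gt0.
have inC : [pred a | ~~ `[< C (row_of_ffun N a) >]] =1
    (fun a => `[< (~` C) (row_of_ffun N a) >]) by move=> a /=; rewrite asbool_neg.
rewrite -(@divfK _ 2%:R _ e)// -/d mulr2n mulrDr mulr1.
rewrite [X in (_ + X <= _)%R](eq_bigl _ _ inC) lerD//.
  apply: (agm_sum _ (@w N) (fun=> p%:R ^- N)%R) => //.
  - by rewrite -lee_fin -(mu_cylinder _ _ NC).
  - by rewrite -lee_fin -(mu_inv_cylinder _ _ NC); exact: probability_le1.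
under eq_bigr do rewrite mulrC.
apply: (agm_sum _ (fun=> p%:R ^- N)%R (@w N)) => //.
- by rewrite -lee_fin -(mu_inv_cylinder _ _ (cylinder_setC _ _ NC)).
- rewrite -lee_fin -(mu_cylinder _ _ (cylinder_setC _ _ NC)).
  by apply: probability_le1; exact: measurableC.
Qed.

Theorem mutually_singular_SL11 : mutually_singular mu mu_inv <-> SL11 alpha = +oo.
Proof.
split=> [/singular_affinity|] h; first exact/SL11_infinite.
by apply: affinity_singular; exact/SL11_infinite.
Qed.

End kakutani.

Theorem lemma4p14 (R : realType) (p : nat) (p_prime : prime p)
    (alpha : nat -> 'F_p -> R)
    (alpha_gt0 : forall n r, (1 <= n)%N -> 0 < alpha n r)
    (alpha_sum1 : forall n, (1 <= n)%N -> \sum_(r : 'F_p) alpha n r = 1)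
    (mu mu_inv : probability (X1 p) R)
    (mu_alpha : is_product_measure alpha mu)
    (mu_invE : is_product_measure (@uniform_weights R p) mu_inv) :
  (measure_equivalent mu mu_inv ->
    exists Delta : nat -> 'F_p -> (L2 mu -> L2 mu),
      let Deltas := [set D | exists (s : nat) (r : 'F_p),
        [/\ (1 <= s)%N, r != 0 & D = Delta s r]] in
      [/\ forall (s : nat) (r : 'F_p), (1 <= s)%N -> r != 0 ->
            strong_limit (L2_dot mu) (Delta_partial mu s r) (Delta s r),
          commutant (L2_dot mu) (vN_algebra mu) =
            weak_closure (L2_dot mu) (linear_span ([set id] `|` Deltas)) &
          commutant (L2_dot mu) (vN_algebra mu) =
            bicommutant (L2_dot mu) Deltas]) /\
  ((mutually_singular mu mu_inv <-> SL11 alpha = +oo%E) /\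
   (mutually_singular mu mu_inv ->
     commutant (L2_dot mu) (vN_algebra mu) = @scalar_ops R[i] (L2 mu))).
Proof.
split.
  exact: (commutant_equivalent p_prime alpha alpha_gt0 mu mu_inv mu_alpha mu_invE).
split.
  exact: (mutually_singular_SL11 p_prime alpha alpha_gt0 alpha_sum1 mu mu_inv
    mu_alpha mu_invE).
move=> mu_sing.
rewrite (commutant_vN_algebra alpha alpha_gt0 mu mu_alpha).
exact: (commutant_scalar p_prime alpha alpha_gt0 mu mu_inv mu_alpha mu_invE).
Qed.
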